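(* Let $H$, $b$, $\widetilde\Lambda$, $\widetilde\Lambda_{H\tau}$ and $w$ be as in one of the four cases (i)--(iv) of the context. Let $(u,\lambda)\in\mathbb{W}(0,T)\times\widetilde\Lambda$ with $u(0)=u_0$ satisfy $$\int_0^T\langle\partial_tu,v\rangle+a(u,v)+b(\lambda,v)\,dt=\int_0^T\langle f,v\rangle\,dt,\qquad \int_0^Tb(\mu-\lambda,u)\,dt\le\int_0^T\langle\mu-\lambda,w\rangle\,dt$$ for all $v\in\mathbb{W}(0,T)$, $\mu\in\widetilde\Lambda$, and let $(u_{h\tau},\lambda_{H\tau})\in\mathbb{W}_{h\tau}(0,T)\times\widetilde\Lambda_{H\tau}$ satisfy $$B_{DG}(u_{h\tau},v_{h\tau})+\sum_{k=1}^M\int_{I_k}b(\lambda_{H\tau},v_{h\tau})\,dt+\sum_{k=1}^M\big\langle[u_{h\tau}]^{k-1},v^{k-1}_{h\tau,+}\big\rangle=\sum_{k=1}^M\int_{I_k}\langle f,v_{h\tau}\rangle\,dt,$$ $$\sum_{k=1}^M\int_{I_k}b(\mu_{H\tau}-\lambda_{H\tau},u_{h\tau})\,dt\le\sum_{k=1}^M\int_{I_k}\langle\mu_{H\tau}-\lambda_{H\tau},w\rangle\,dt$$ for all $v_{h\tau}\in\mathbb{W}_{h\tau}(0,T)$, $\mu_{H\tau}\in\widetilde\Lambda_{H\tau}$. Let $\mathcal{U}$ be the continuous-in-time interpolant of $u_{h\tau}$ defined in the context, and $r_{h\tau}=f-\partial_t\mathcal{U}-(-\Delta)^su_{h\tau}$.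 Then $$\begin{aligned} &\|(u-\mathcal{U})(T)\|^2_{L^2(\Omega)}+\sum_{k=1}^M\int_{I_k}\|\partial_t(u-\mathcal{U})+(\lambda-\lambda_{H\tau})\|^2_{H^*}+\|u-\mathcal{U}\|_H^2+\|u-u_{h\tau}\|_H^2\,dt\\ &\lesssim\|(u-\mathcal{U})(0)\|^2_{L^2(\Omega)}+\sum_{k=1}^M\int_{I_k}b(\lambda_{H\tau}-\lambda,u-\mathcal{U})\,dt+\sum_{k=1}^M\int_{I_k}\|r_{h\tau}-\lambda_{H\tau}\|^2_{H^*}+\|u_{h\tau}-\mathcal{U}\|^2_H\,dt . \end{aligned}$$
   Context: Let $0<s<1$ and let $\Omega\subset\mathbb{R}^n$ be a bounded Lipschitz domain with polygonal boundary. $H^s(\Omega)$ has norm $\|v\|_{L^2(\Omega)}+|v|_{H^s(\Omega)}$, $|v|^2_{H^s(\Omega)}=\iint_{\Omega\times\Omega}\frac{(v(x)-v(y))^2}{|x-y|^{n+2s}}\,dy\,dx$. $H^s_0(\Omega)$ is the closure in $H^s(\Omega)$ of the $v\in C^\infty(\overline\Omega)$ with $v=0$ on $\partial\Omega$; $H^{-s}(\Omega)$ is its dual. For a codimension-one set $\widetilde\Gamma$, $H^s_{\widetilde\Gamma^C}(\Omega)$ is the closure in $H^s(\Omega)$ of the $v\in C^\infty(\overline\Omega)$ with $v=0$ on $\partial\Omega\setminus\widetilde\Gamma$. $H^{1/2-s}(\widetilde\Gamma)$ is the dual of $H^{s-1/2}(\widetilde\Gamma)$. $\langle\cdot,\cdot\rangle$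 denotes the appropriate duality pairing, extending the $L^2$ inner product. Functions are extended by $0$ to $\mathbb{R}^n\setminus\overline\Omega$, and $$a(u,v)=\frac{c_{n,s}}2\iint_{(\Omega\times\mathbb{R}^n)\cup(\mathbb{R}^n\times\Omega)}\frac{(u(x)-u(y))(v(x)-v(y))}{|x-y|^{n+2s}}\,dy\,dx,\qquad c_{n,s}=\frac{2^{2s}s\,\Gamma(\frac{n+2s}2)}{\pi^{n/2}\Gamma(1-s)}.$$ Standing fact: $a$ is continuous and coercive on $H$: $a(u,v)\le C\|u\|_H\|v\|_H$, $a(u,u)\ge\alpha\|u\|_H^2$. $(-\Delta)^s:H\to H^*$ is given by $\langle(-\Delta)^su,v\rangle=a(u,v)$. $\mathbb{W}(0,T)=\{v\in L^2(0,T;H):\partial_tv\in L^2(0,T;H^* )\}$, continuously embedded in $C^0(0,T;L^2(\Omega))$. Data: $f\in L^2(0,T;H^* )$, initial value $u_0$. $\mathbb{V}_h\subset H$: continuous piecewise linear functions in $H$ on a shape-regular triangulation $\mathcal{T}_h$; $\mathbb{M}_H$: piecewise constants on a triangulation $\mathcal{T}_H$; $\widetilde{\mathbb{M}}_H$: its analogue on $\widetilde\Gamma$. $[0,T]$ is decomposed into $I_k=[t_{k-1},t_k)$, $k=1,\dots,M$, with steps $\tau_k$; $\mathbb{T}_\tau$ is the space of (possibly discontinuous) piecewise polynomials in time of degree $q$ ($q=0,1$); $\mathbb{W}_{h\tau}(0,T)=\mathbb{V}_h\otimes\mathbb{T}_\tau$. $v^k_\pm$ are the one-sided limits of $v$ at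 $t_k$ (also written $v_{h\tau,\pm}^k$), $[v]^k=v^k_+-v^k_-$, and $u^0_{h\tau,-}$ is the prescribed discrete initial value ($u_0$ or an approximation of it in $\mathbb{V}_h$). $$B_{DG}(u,v)=\sum_{k=1}^M\int_{I_k}\langle\partial_tu,v\rangle+a(u,v)\,dt.$$ Interpolant: $\mathcal{U}\in\mathbb{W}(0,T)$ is the continuous function that on each $I_k$ is a polynomial in $t$ of degree $q+1$ determined by $\mathcal{U}(t_k^j)=u_{h\tau}(t_k^j)$ for $j=1,\dots,q+1$ and $\mathcal{U}(t_{k-1})=u^{k-1}_{h\tau,-}$, where $t_k^1<\dots<t_k^{q+1}=t_k$ are the right Radau points in $(t_{k-1},t_k]$ (the value of $u_{h\tau}$ at $t_k$ being its limit from the left), for which the jump form of the scheme is equivalent to $\sum_k\int_{I_k}\langle\partial_t\mathcal{U},V\rangle+a(u_{h\tau},V)+b(\lambda_{H\tau},V)\,dt=\sum_k\int_{I_k}\langle f,V\rangle\,dt$ for $V\in\mathbb{W}_{h\tau}(0,T)$. Cases: $\mathcal{F}\ge0$ is a bounded function (on $S\subset\Omega$ open in (iii), with $\mathcal F$ understood as $0$ outside $S$; on $\widetilde\Gamma$ in (iv)); conditions hold for a.e. $t\in(0,T)$. (i) (obstacle) $H=H^s_0(\Omega)$, $b(\mu,v)=\langle\mu,v\rangle$, $\widetilde\Lambda=\{\mu\in L^2(0,T;H^{-s}(\Omega)):\langle\mu,v\rangle\ge0\ \forall v\in\mathbb{W}(0,T),\,v\le0\}$, $\widetilde\Lambda_{H\tau}=\{\mu_{H\tau}\in\mathbb{M}_H\otimes\mathbb{T}_\tau:\mu_{H\tau}\le0\}$,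 $w=\chi\in H^s_0(\Omega)$. (ii) (Signorini, $s\in(\frac12,1)$) $H=H^s_{\widetilde\Gamma^C}(\Omega)$, $b(\mu,v)=\langle\mu,v|_{\widetilde\Gamma}\rangle$, $\widetilde\Lambda=\{\mu\in L^2(0,T;H^{1/2-s}(\widetilde\Gamma)):\langle\mu,v\rangle\ge0\ \forall v\in L^2(0,T;H^{s-1/2}(\widetilde\Gamma)),\,v\le0\}$, $\widetilde\Lambda_{H\tau}=\{\mu_{H\tau}\in\widetilde{\mathbb{M}}_H\otimes\mathbb{T}_\tau:\mu_{H\tau}\le0\}$, $w=g\in H^{s-1/2}(\widetilde\Gamma)$. (iii) (interior friction) $H=H^s_0(\Omega)$, $b(\mu,v)=\langle\mu,v\rangle$, $\widetilde\Lambda=\{\mu\in L^2(0,T;H^{-s}(\Omega)):\langle\mu,v\rangle\le\langle\mathcal{F},|v|\rangle\ \forall v\in\mathbb{W}(0,T)\}$, $\widetilde\Lambda_{H\tau}=\{\mu_{H\tau}\in\mathbb{M}_H\otimes\mathbb{T}_\tau:|\mu_{H\tau}|\le\mathcal{F}\}$, $w=0$. (iv) (friction, $s\in(\frac12,1)$) $H=H^s_{\widetilde\Gamma^C}(\Omega)$, $b(\mu,v)=\langle\mu,v|_{\widetilde\Gamma}\rangle$, $\widetilde\Lambda=\{\mu\in L^2(0,T;H^{1/2-s}(\widetilde\Gamma)):\langle\mu,v\rangle\le\langle\mathcal{F},|v|\rangle\ \forall v\in L^2(0,T;H^{s-1/2}(\widetilde\Gamma))\}$, $\widetilde\Lambda_{H\tau}=\{\mu_{H\tau}\in\widetilde{\mathbb{M}}_H\otimes\mathbb{T}_\tau:|\mu_{H\tau}|\le\mathcal{F}\}$,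 $w=0$. A multiplier $\mu$ is identified with the functional $v\mapsto b(\mu,v)$ in $H^*$, and $\|\mu\|_{H^*}$ is the norm of this functional. $X\lesssim Y$ means $X\le C'Y$ with $C'>0$ independent of the mesh sizes, time steps, data and solutions.
   Formalization: The multiplier term (the sum of the integrals of b(λ_Hτ−λ, u−U)) has no sign and carries its own constant C2, the other right-hand terms carry C1; with a single constant in front of the whole right-hand side the estimate fails, since that side can be negative. *)

(* Defs.v *)
From HB Require Import structures.
From mathcomp Require Import all_boot all_order all_algebra.
From mathcomp Require Import all_classical all_reals all_analysis.

Set Implicit Arguments.
Unset Strict Implicit.
Unset Printing Implicit Defensive.

Import Order.TTheory GRing.Theory Num.Theory.
Import numFieldNormedType.Exports.

Local Open Scope classical_set_scope.
Local Open Scope ring_scope.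

(* 'rV_n carries the sigma-algebra generated by the coordinates, i.e. the Borel
   sigma-algebra. *)
Section measurable_rV.
Context {d} {T : measurableType d}.
Variable n : nat.

Let coors : 'I_n -> 'rV[T]_n -> T := fun i x => x ord0 i.

Let rV_set0 : g_sigma_preimage coors set0.
Proof. exact: sigma_algebra0. Qed.

Let rV_setC A : g_sigma_preimage coors A -> g_sigma_preimage coors (~` A).
Proof. exact: sigma_algebraC. Qed.

Let rV_bigcup (F : _^nat) : (forall i, g_sigma_preimage coors (F i)) ->
  g_sigma_preimage coors (\bigcup_i (F i)).
Proof. exact: sigma_algebra_bigcup. Qed.

HB.instance Definition _ := @isMeasurable.Build (measure_tuple_display d)
  'rV[T]_n (g_sigma_preimage coors) rV_set0 rV_setC rV_bigcup.

End measurable_rV.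

Lemma measurable_coord d (T : measurableType d) n (i : 'I_n) :
  measurable_fun [set: 'rV[T]_n] (fun x : 'rV[T]_n => x ord0 i).
Proof.
move=> _ Y mY; rewrite setTI; apply: sub_sigma_algebra => /=.
rewrite -bigcup_seq/=; exists i => /=; first by rewrite mem_index_enum.
by exists Y => //; rewrite setTI.
Qed.

Lemma measurable_fun_coordP d1 d2 (T1 : measurableType d1)
    (T2 : measurableType d2) n (f : T1 -> 'rV[T2]_n) :
  measurable_fun [set: T1] f <->
  forall i, measurable_fun [set: T1] (fun x => f x ord0 i).
Proof.
split=> [mf i|mf].
  exact: (measurableT_comp (measurable_coord i) mf).
move=> _ A mA; rewrite setTI.
have H : <<s preimage_set_system [set: T1] f
   (\big[setU/set0]_(i < n) preimage_set_system setT
      (fun x : 'rV[T2]_n => x ord0 i) measurable) >> `<=` measurable.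
  apply: smallest_sub; first exact: sigma_algebra_measurable.
  move=> B [C + <-]; rewrite -bigcup_seq => -[i _ [D mD <-]].
  by rewrite !setTI; have := mf i measurableT D mD; rewrite setTI.
apply: H; rewrite g_sigma_preimageE; exists A => //.
by rewrite setTI.
Qed.

Section lebesgue_rV.
Variable R : realType.

Definition rV_cons n (z : R * 'rV[R]_n) : 'rV[R]_n.+1 :=
  \row_i (if unlift ord0 i is Some j then z.2 ord0 j else z.1).

Definition rV_uncons n (x : 'rV[R]_n.+1) : R * 'rV[R]_n :=
  (x ord0 ord0, \row_j x ord0 (lift ord0 j)).

Lemma rV_consK n : cancel (@rV_cons n) (@rV_uncons n).
Proof.
case=> a v; rewrite /rV_uncons /rV_cons; congr pair.
  by rewrite mxE unlift_none.
by apply/rowP => j; rewrite !mxE liftK.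
Qed.

Lemma rV_unconsK n : cancel (@rV_uncons n) (@rV_cons n).
Proof.
move=> x; apply/rowP => i; rewrite /rV_cons mxE.
by case: unliftP => [j ->|->] /=; rewrite ?mxE.
Qed.

Lemma measurable_rV_cons n : measurable_fun [set: R * 'rV[R]_n] (@rV_cons n).
Proof.
apply/measurable_fun_coordP => i.
under eq_fun do rewrite mxE.
case: unlift => [j|] /=; last exact: measurable_fst.
exact: (measurableT_comp (measurable_coord j) measurable_snd).
Qed.

Lemma measurable_rV_uncons n : measurable_fun [set: 'rV[R]_n.+1] (@rV_uncons n).
Proof.
apply/measurable_fun_pairP; split; first exact: measurable_coord.
apply/measurable_fun_coordP => i /=.
under eq_fun do rewrite /= mxE.
exact: measurable_coord.
Qed.

Section step.
Local Open Scope ereal_scope.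
Variables (n : nat) (mu : {sigma_finite_measure set 'rV[R]_n -> \bar R}).

Definition lebesgue_step : set 'rV[R]_n.+1 -> \bar R :=
  pushforward (@lebesgue_measure R \x mu) (@rV_cons n).

Let step0 : lebesgue_step set0 = 0.
Proof. by rewrite /lebesgue_step /pushforward preimage_set0 measure0. Qed.

Let step_ge0 A : 0 <= lebesgue_step A.
Proof. exact: (measure_ge0 (@lebesgue_measure R \x mu)%E). Qed.

Let step_sigma_additive : semi_sigma_additive lebesgue_step.
Proof.
move=> F mF tF mUF; rewrite /lebesgue_step /pushforward preimage_bigcup.
have mp i : measurable (@rV_cons n @^-1` F i).
  by rewrite -[X in measurable X]setTI; exact: measurable_rV_cons.
apply: measure_semi_sigma_additive => //.
- apply/trivIsetP => /= i j _ _ ij; rewrite -preimage_setI.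
  by move/trivIsetP : tF => /(_ _ _ _ _ ij) ->//; rewrite preimage_set0.
- by apply: bigcup_measurable => k _; exact: mp.
Qed.

HB.instance Definition _ := isMeasure.Build _ _ _ lebesgue_step
  step0 step_ge0 step_sigma_additive.

Let step_sigma_finite : sigma_finite setT lebesgue_step.
Proof.
have /sigma_finiteP[F [FT ndF mF]] := sigma_finiteT (@lebesgue_measure R).
have /sigma_finiteP[G [GT ndG mG]] := sigma_finiteT mu.
exists (fun i => @rV_uncons n @^-1` (F i `*` G i)).
  rewrite -preimage_bigcup -[LHS](preimage_setT (@rV_uncons n)).
  congr (_ @^-1` _); apply/seteqP; split=> // -[x y] _.
  have [i _ Fx] : (\bigcup_i F i) x by rewrite -FT.
  have [j _ Gy] : (\bigcup_i G i) y by rewrite -GT.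
  exists (maxn i j) => //; split => /=.
    by move: x Fx; exact/subsetPset/ndF/leq_maxl.
  by move: y Gy; exact/subsetPset/ndG/leq_maxr.
move=> i; have [mFi Fi] := mF i; have [mGi Gi] := mG i; split.
  rewrite -[X in measurable X]setTI; apply: measurable_rV_uncons => //.
  exact: measurableX.
rewrite /lebesgue_step /pushforward -comp_preimage.
rewrite (_ : @rV_uncons n \o @rV_cons n = id); last first.
  by apply/funext => z /=; rewrite rV_consK.
rewrite preimage_id product_measure1E//.
by rewrite lte_mul_pinfty// ge0_fin_numE.
Qed.

HB.instance Definition _ := Measure_isSigmaFinite.Build _ _ _ lebesgue_step
  step_sigma_finite.

End step.

Let dirac_rV : {sigma_finite_measure set 'rV[R]_0 -> \bar R} :=
  \d_(0 : 'rV[R]_0).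

Fixpoint lebesgue_rV n : {sigma_finite_measure set 'rV[R]_n -> \bar R} :=
  if n is m.+1 then lebesgue_step (lebesgue_rV m) else dirac_rV.

Lemma lebesgue_rV_box n (a b : 'rV[R]_n) : (forall i, a ord0 i <= b ord0 i) ->
  lebesgue_rV n [set x | forall i, a ord0 i <= x ord0 i <= b ord0 i] =
  (\prod_(i < n) (b ord0 i - a ord0 i))%:E.
Proof.
elim: n a b => [|n IH] a b ab /=.
  rewrite big_ord0 /dirac_rV /dirac indicE mem_set//.
  by move=> -[].
pose B := [set x : 'rV[R]_n |
  forall i, (rV_uncons a).2 ord0 i <= x ord0 i <= (rV_uncons b).2 ord0 i].
have AB : @rV_cons n @^-1`
    [set x : 'rV[R]_n.+1 | forall i, a ord0 i <= x ord0 i <= b ord0 i] =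
    `[a ord0 ord0, b ord0 ord0] `*` B.
  apply/seteqP; split=> [[x y] /= H|[x y] /= [Hx Hy] i].
    split.
      by have := H ord0; rewrite /rV_cons mxE unlift_none in_itv.
    by move=> i; have := H (lift ord0 i); rewrite !mxE liftK.
  rewrite /rV_cons mxE; case: unliftP => [j ->|->] /=.
    by have := Hy j; rewrite !mxE.
  by move: Hx; rewrite in_itv.
have mB : measurable B.
  rewrite [X in measurable X](_ : _ = \bigcap_(i in [set: 'I_n])
     [set x : 'rV[R]_n |
       (rV_uncons a).2 ord0 i <= x ord0 i <= (rV_uncons b).2 ord0 i]);
    last first.
    by apply/seteqP; split=> x /= H i; have := H i => //; exact.
  apply: fin_bigcap_measurable => // i _.
  rewrite [X in measurable X](_ : _ = (fun x : 'rV[R]_n => x ord0 i) @^-1`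
    `[(rV_uncons a).2 ord0 i, (rV_uncons b).2 ord0 i]%classic); last first.
    by apply/seteqP; split=> x /=; rewrite in_itv.
  rewrite -[X in measurable X]setTI; exact: measurable_coord.
rewrite /lebesgue_step /pushforward.
transitivity ((@lebesgue_measure R \x lebesgue_rV n)
    (`[a ord0 ord0, b ord0 ord0] `*` B))%E; first by congr (_ _); exact: AB.
rewrite product_measure1E//=.
rewrite IH; last by move=> i; rewrite !mxE.
rewrite [lebesgue_measure _](_ : _ = (b ord0 ord0 - a ord0 ord0)%:E);
    last first.
  have := lebesgue_measure_itv `[a ord0 ord0, b ord0 ord0] => /= ->.
  rewrite lte_fin; have := ab ord0; rewrite le_eqVlt => /orP[/eqP ->|->].
    by rewrite ltxx subrr.
  by rewrite EFinB.
rewrite -EFinM big_ord_recl; congr (_ * _)%:E.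
by apply: eq_bigr => i _; rewrite !mxE.
Qed.

End lebesgue_rV.

Arguments lebesgue_rV R n : clear implicits.

Section euclidean.
Variables (R : realType) (n : nat).
Local Notation E := 'rV[R]_n.

(* The norm of the normed module 'rV_n is the sup norm, hence this one. *)
Definition edot (x y : E) : R := \sum_(i < n) x ord0 i * y ord0 i.
Definition enorm (x : E) : R := Num.sqrt (edot x x).

Definition boundary (A : set E) : set E := closure A `\` A°.

Definition lipschitz_domain (Omega : set E) : Prop :=
  [/\ open Omega, connected Omega, Omega !=set0, bounded_set Omega &
    forall x, boundary Omega x ->
      exists (r L : R) (e : E) (phi : E -> R),
        [/\ 0 < r, enorm e = 1,
            forall y z, `|phi y - phi z| <= L * enorm (y - z) &
            forall y, enorm (y - x) < r ->
              (Omega y <-> phi (y - edot y e *: e) < edot y e)]].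

Definition dir_derive (vs : seq E) (f : E -> R) : E -> R :=
  foldr (fun v g x => 'D_v g x) f vs.

Definition smooth_fun (f : E -> R) : Prop :=
  forall vs x, differentiable (dir_derive vs f) x.

(* A k-simplex is given by the rows of a matrix, its k + 1 vertices. *)
Definition edges k (K : 'M[R]_(k.+1, n)) : 'M[R]_(k, n) :=
  \matrix_(i, j) (K (lift ord0 i) j - K ord0 j).

Definition nondegenerate k (K : 'M[R]_(k.+1, n)) : Prop := row_free (edges K).

Definition barycentric k (c : 'rV[R]_k.+1) : Prop :=
  (forall i, 0 <= c ord0 i) /\ \sum_i c ord0 i = 1.

Definition simplex k (K : 'M[R]_(k.+1, n)) : set E :=
  [set x | exists2 c, barycentric c & x = c *m K].

Definition open_simplex k (K : 'M[R]_(k.+1, n)) : set E :=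
  [set x | exists c, [/\ barycentric c, forall i, 0 < c ord0 i & x = c *m K]].

Definition common_face k (K L : 'M[R]_(k.+1, n)) : set E :=
  [set x | exists c, [/\ barycentric c, x = c *m K &
     forall i, c ord0 i != 0 -> exists j, row i K = row j L]].

Definition polyhedron k (T : seq 'M[R]_(k.+1, n)) : set E :=
  [set x | exists2 K, K \in T & simplex K x].

Definition conforming k (T : seq 'M[R]_(k.+1, n)) : Prop :=
  [/\ uniq T, forall K, K \in T -> nondegenerate K &
    forall K L, K \in T -> L \in T -> K != L ->
      open_simplex K `&` open_simplex L = set0 /\
      simplex K `&` simplex L `<=` common_face K L].

Definition triangulates k (T : seq 'M[R]_(k.+1, n)) (A : set E) : Prop :=
  conforming T /\ polyhedron T = A.

(* diameter at most kappa times the radius of an inscribed ball *)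
Definition shape_regular (kappa : R) k (T : seq 'M[R]_(k.+1, n)) : Prop :=
  forall K, K \in T -> exists (x : E) (r : R),
    [/\ 0 < r, [set y | enorm (y - x) <= r] `<=` simplex K &
      forall y z, simplex K y -> simplex K z -> enorm (y - z) <= kappa * r].

Definition polygonal_boundary (Omega : set E) : Prop :=
  exists T : seq 'M[R]_(n.-1.+1, n),
    (forall K, K \in T -> nondegenerate K) /\ boundary Omega = polyhedron T.

Definition affine_on (A : set E) (v : E -> R) : Prop :=
  exists (a : R) (b : E), forall x, A x -> v x = a + edot b x.

(* Elements of M_H; the values on the null set of lower-dimensional faces are
   set to 0. *)
Definition piecewise_constant k (T : seq 'M[R]_(k.+1, n)) : set (E -> R) :=
  [set g | exists c : 'M[R]_(k.+1, n) -> R,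
    g = fun x => \sum_(K <- T) c K * \1_(open_simplex K) x].

(* Integration over a polyhedral surface, through the affine parametrization
   of each simplex by the standard one. *)
Definition std_simplex k : set 'rV[R]_k :=
  [set y | (forall i, 0 <= y ord0 i) /\ \sum_i y ord0 i <= 1].
Arguments std_simplex : clear implicits.

Definition param k (K : 'M[R]_(k.+1, n)) (y : 'rV[R]_k) : E :=
  row ord0 K + y *m edges K.

Definition jac k (K : 'M[R]_(k.+1, n)) : R :=
  Num.sqrt (\det (edges K *m (edges K)^T)).

Definition surf_int k (G : seq 'M[R]_(k.+1, n)) (g : E -> \bar R) : \bar R :=
  (\sum_(K <- G) (jac K)%:E *
     \int[lebesgue_rV R k]_(y in std_simplex k) g (param K y))%E.

Definition surf_int2 k (G : seq 'M[R]_(k.+1, n)) (g : E * E -> \bar R)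
    : \bar R :=
  (\sum_(K <- G) \sum_(L <- G) (jac K * jac L)%:E *
     \int[lebesgue_rV R k \x lebesgue_rV R k]_(z in
        std_simplex k `*` std_simplex k) g (param K z.1, param L z.2))%E.

Definition surf_ae k (G : seq 'M[R]_(k.+1, n)) (Q : E -> Prop) : Prop :=
  forall K, K \in G ->
    {ae lebesgue_rV R k, forall y, std_simplex k y -> Q (param K y)}.

End euclidean.

(* A vector space of representatives with a seminorm; functions that agree
   almost everywhere are at distance 0. Outside [dom] the value of [nrm] is
   meaningless. *)
Record seminormed (R : realType) (L : lmodType R) :=
  Seminormed { carrier : set L ; nrm : L -> R }.

Section abstract_spaces.
Variable R : realType.

Definition dual_space (L : lmodType R) (V : seminormed L)
    : seminormed (L -> R^o) :=
  Seminormed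
    [set l | (forall (c : R) u v, carrier V u -> carrier V v ->
               l (c *: u + v) = c * l u + l v) /\
             exists C : R, forall v, carrier V v -> `|l v| <= C * nrm V v]
    (fun l => sup [set `|l v| | v in [set v | carrier V v /\ nrm V v <= 1]]).

Definition closure_in (L : lmodType R) (V : seminormed L) (A : set L)
    : seminormed L :=
  Seminormed
    [set v | carrier V v /\ forall eps : R, 0 < eps ->
       exists w, [/\ A w, carrier V w & nrm V (v - w) < eps]]
    (nrm V).

Local Notation leb := (@lebesgue_measure R).

Definition simple_in (L : lmodType R) (V : seminormed L) (f : R -> L) : Prop :=
  exists (m : nat) (A : 'I_m -> set R) (x : 'I_m -> L),
    [/\ forall i, measurable (A i), forall i, carrier V (x i) &
        f = fun t => \sum_(i < m) (\1_(A i) t : R) *: x i].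

(* L^2(0,T;V), with Bochner measurability *)
Definition bochner_L2 (T : R) (L : lmodType R) (V : seminormed L)
    (u : R -> L) : Prop :=
  [/\ {ae leb, forall t, t \in `]0, T[ -> carrier V (u t)},
      exists2 u_ : nat -> R -> L, (forall j, simple_in V (u_ j)) &
        {ae leb, forall t, t \in `]0, T[ ->
          nrm V (u_ j t - u t) @[j --> \oo] --> (0 : R)} &
      (\int[leb]_(t in `]0%R, T[) ((nrm V (u t)) ^+ 2)%:E < +oo)%E].

Definition test_function (T : R) (phi : R -> R) : Prop :=
  (forall k t, derivable (derive1n k phi) t 1) /\
  exists a b : R, [/\ 0 < a, b < T & forall t, t \notin `[a, b] -> phi t = 0].

End abstract_spaces.

Section sobolev.
Variables (R : realType) (n : nat).
Local Notation E := 'rV[R]_n.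
Local Notation mu := (lebesgue_rV R n).

Definition L2_space (D : set E) : seminormed (E -> R^o) :=
  Seminormed
    [set v : E -> R | measurable_fun D v /\
      (\int[mu]_(x in D) ((v x) ^+ 2)%:E < +oo)%E]
    (fun v : E -> R => Num.sqrt (\int[mu]_(x in D) ((v x) ^+ 2))).

Definition dotL2 (D : set E) (u v : E -> R) : R :=
  \int[mu]_(x in D) (u x * v x).

Definition slobodeckij (D : set E) (s : R) (v : E -> R) : \bar R :=
  (\int[mu \x mu]_(z in D `*` D)
     ((v z.1 - v z.2) ^+ 2 / enorm (z.1 - z.2) `^ (n%:R + 2 * s))%:E)%E.

Definition Hs (D : set E) (s : R) : seminormed (E -> R^o) :=
  Seminormed
    [set v | carrier (L2_space D) v /\ (slobodeckij D s v < +oo)%E]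
    (fun v => nrm (L2_space D) v + Num.sqrt (fine (slobodeckij D s v))).

(* closure in H^s(Omega) of the smooth functions that vanish on A *)
Definition Hs_vanishing (Omega : set E) (s : R) (A : set E)
    : seminormed (E -> R^o) :=
  closure_in (Hs Omega s)
    [set v : E -> R | smooth_fun v /\ forall x, A x -> v x = 0].

Definition surf_slobodeckij k (G : seq 'M[R]_(k.+1, n)) (r : R) (v : E -> R)
    : \bar R :=
  surf_int2 G (fun z => ((v z.1 - v z.2) ^+ 2 /
                         enorm (z.1 - z.2) `^ (k%:R + 2 * r))%:E).

Definition Hs_surf k (G : seq 'M[R]_(k.+1, n)) (r : R)
    : seminormed (E -> R^o) :=
  Seminormed
    [set v : E -> R | [/\ measurable_fun (polyhedron G) v,
                 (surf_int G (fun x => ((v x) ^+ 2)%:E) < +oo)%E &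
                 (surf_slobodeckij G r v < +oo)%E]]
    (fun v : E -> R => Num.sqrt (fine (surf_int G (fun x => ((v x) ^+ 2)%:E)))
              + Num.sqrt (fine (surf_slobodeckij G r v))).

Definition gamma_fun (x : R) : R :=
  \int[@lebesgue_measure R]_(t in `]0, +oo[) (t `^ (x - 1) * expR (- t)).

Definition c_ns (s : R) : R :=
  (2 `^ (2 * s) * s * gamma_fun ((n%:R + 2 * s) / 2))
  / (pi `^ (n%:R / 2) * gamma_fun (1 - s)).

(* [v \_ Omega] is the extension by zero of the restriction of v to Omega. *)
Definition energy (Omega : set E) (s : R) (u v : E -> R) : R :=
  let u0 := u \_ Omega in let v0 := v \_ Omega in
  c_ns s / 2 *
  \int[(mu \x mu)%E]_(z in Omega `*` setT `|` setT `*` Omega)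
     ((u0 z.1 - u0 z.2) * (v0 z.1 - v0 z.2)
      / enorm (z.1 - z.2) `^ (n%:R + 2 * s)).

End sobolev.

Inductive contact := Obstacle | Signorini | InteriorFriction | Friction.

Definition on_surface (c : contact) : bool :=
  match c with Signorini | Friction => true | _ => false end.

(* [tGamma] lists the (n-1)-simplices whose union is the codimension-one set,
   [trace_op] is the operator v |-> v|_Gamma; both only matter when
   [on_surface case_of].  *)
Record problem (R : realType) := Problem {
  sdim : nat;
  frac_order : R;
  domain : set 'rV[R]_sdim;
  case_of : contact;
  tGamma : seq 'M[R]_(sdim.-1.+1, sdim);
  trace_op : ('rV[R]_sdim -> R^o) -> ('rV[R]_sdim -> R^o);
  final_time : R
}.
Arguments domain {R} p _.
Arguments trace_op {R} p _ _.

Section continuous_problem.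
Variables (R : realType) (P : problem R).
Local Notation E := 'rV[R]_(sdim P).
Local Notation fn := (E -> R^o).
Local Notation functional := (fn -> R^o).
Local Notation mu := (lebesgue_rV R (sdim P)).
Local Notation leb := (@lebesgue_measure R).
Local Notation T := (final_time P).

Definition aform (u v : fn) : R := energy (domain P) (frac_order P) u v.

Definition L2Omega : seminormed fn := L2_space (domain P).

Definition Hspace : seminormed fn :=
  Hs_vanishing (domain P) (frac_order P)
    (if on_surface (case_of P)
     then boundary (domain P) `\` polyhedron (tGamma P)
     else boundary (domain P)).

(* the space whose dual contains the multipliers *)
Definition Yspace : seminormed fn :=
  if on_surface (case_of P) then Hs_surf (tGamma P) (frac_order P - 1 / 2)
  else Hspace.

Definition trace_of (v : fn) : fn :=
  if on_surface (case_of P) then trace_op P v else v.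

Definition bform (l : functional) (v : fn) : R := l (trace_of v).

Definition dotY (g v : fn) : R :=
  if on_surface (case_of P)
  then fine (surf_int (tGamma P) (fun x => (g x * v x)%:E))
  else dotL2 (domain P) g v.

(* The continuous linear extension of the restriction of smooth functions; it is
   unique up to null sets. *)
Definition trace_operator : Prop :=
  [/\ forall v, carrier Hspace v -> carrier Yspace (trace_op P v),
      forall (c : R) u v, carrier Hspace u -> carrier Hspace v ->
        nrm Yspace (trace_op P (c *: u + v) -
                    (c *: trace_op P u + trace_op P v)) = 0,
      exists C : R, forall v, carrier Hspace v ->
        nrm Yspace (trace_op P v) <= C * nrm Hspace v &
      forall v : fn, smooth_fun v ->
        (forall x, (boundary (domain P) `\` polyhedron (tGamma P)) x ->
                   v x = 0) ->
        nrm Yspace (trace_op P v - v) = 0].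

Definition well_posed : Prop :=
  [/\ (0 < sdim P)%N, 0 < frac_order P < 1, 0 < T,
      lipschitz_domain (domain P) /\ polygonal_boundary (domain P) &
      on_surface (case_of P) ->
        [/\ 1 / 2 < frac_order P, conforming (tGamma P),
            polyhedron (tGamma P) `<=` closure (domain P) & trace_operator]].

Definition a_continuous (C : R) : Prop :=
  forall u v, carrier Hspace u -> carrier Hspace v ->
    aform u v <= C * nrm Hspace u * nrm Hspace v.

Definition a_coercive (alpha : R) : Prop :=
  forall u, carrier Hspace u -> alpha * nrm Hspace u ^+ 2 <= aform u u.

Definition ae_time (Q : R -> Prop) : Prop :=
  {ae leb, forall t, t \in `]0, T[ -> Q t}.

Definition ae_contact (Q : E -> Prop) : Prop :=
  if on_surface (case_of P) then surf_ae (tGamma P) Q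
  else {ae mu, forall x, domain P x -> Q x}.

Definition weak_derivative (u : R -> fn) (du : R -> functional) : Prop :=
  forall v phi, carrier Hspace v -> test_function T phi ->
    \int[leb]_(t in `]0, T[) (dotL2 (domain P) (u t) v * derive1 phi t) =
    - \int[leb]_(t in `]0, T[) (du t v * phi t).

Definition Wspace_with (u : R -> fn) (du : R -> functional) : Prop :=
  [/\ bochner_L2 T Hspace u, bochner_L2 T (dual_space Hspace) du &
      weak_derivative u du].

Definition Wspace (u : R -> fn) : Prop := exists du, Wspace_with u du.

Definition C0L2 (u : R -> fn) : Prop :=
  (forall t, t \in `[0, T] -> carrier L2Omega (u t)) /\
  forall t, t \in `[0, T] -> forall eps : R, 0 < eps ->
    exists2 delta : R, 0 < delta & forall t', t' \in `[0, T] ->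
      `|t' - t| < delta -> nrm L2Omega (u t' - u t) < eps.

(* The friction bound lives on S in the interior case and on the surface
   otherwise. *)
Definition friction_region (S : set E) : set E :=
  if on_surface (case_of P) then polyhedron (tGamma P) else S.

Definition friction_bound (S : set E) (F : fn) : fn := F \_ (friction_region S).

Definition contact_data (S : set E) (F w : fn) : Prop :=
  match case_of P with
  | Obstacle | Signorini => carrier Yspace w
  | InteriorFriction | Friction =>
      [/\ ~~ on_surface (case_of P) -> open S /\ S `<=` domain P,
          measurable_fun (friction_region S) (F : E -> R),
          forall x, friction_region S x -> 0 <= F x,
          exists B : R, forall x, friction_region S x -> F x <= B &
          w = 0]
  end.

Definition multiplier_test (v : R -> fn) : Prop :=
  if on_surface (case_of P) then bochner_L2 T Yspace v else Wspace v.

Definition Lambda (S : set E) (F : fn) (lam : R -> functional) : Prop :=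
  bochner_L2 T (dual_space Yspace) lam /\
  match case_of P with
  | Obstacle | Signorini =>
      forall v, multiplier_test v ->
        ae_time (fun t => ae_contact (fun x => v t x <= 0)) ->
        ae_time (fun t => 0 <= lam t (v t))
  | InteriorFriction | Friction =>
      forall v, multiplier_test v ->
        ae_time (fun t =>
          lam t (v t) <= dotY (friction_bound S F) (fun x => `|v t x|))
  end.

Definition continuous_solution (S : set E) (F w : fn) (f : R -> functional)
    (u0 : fn) (u : R -> fn) (du lam : R -> functional) : Prop :=
  [/\ Wspace_with u du /\ C0L2 u,
      Lambda S F lam,
      {ae mu, forall x, domain P x -> u 0 x = u0 x},
      forall v, Wspace v ->
        \int[leb]_(t in `]0, T[)
          (du t (v t) + aform (u t) (v t) + bform (lam t) (v t))
        = \int[leb]_(t in `]0, T[) f t (v t) &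
      forall m, Lambda S F m ->
        \int[leb]_(t in `]0, T[) bform (m t - lam t) (u t)
        <= \int[leb]_(t in `]0, T[) (m t - lam t) w].

End continuous_problem.

Arguments aform {R} P u v.
Arguments Hspace {R} P.
Arguments Yspace {R} P.
Arguments L2Omega {R} P.
Arguments trace_of {R} P v _.
Arguments bform {R} P l v.
Arguments dotY {R} P g v.
Arguments a_continuous {R} P C.
Arguments a_coercive {R} P alpha.
Arguments ae_time {R} P Q.
Arguments ae_contact {R} P Q.
Arguments Wspace_with {R} P u du.
Arguments Wspace {R} P u.
Arguments C0L2 {R} P u.
Arguments friction_bound {R} P S F _.
Arguments contact_data {R} P S F w.
Arguments Lambda {R} P S F lam.
Arguments continuous_solution {R} P S F w f u0 u du lam.

(* [TV] carries the piecewise linear functions; the multipliers live on [TM],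
   or on [TS] if they are supported on the surface. *)
Record discretization (R : realType) (P : problem R) := Discretization {
  nsteps : nat;
  tpoint : nat -> R;
  TV : seq 'M[R]_((sdim P).+1, sdim P);
  TM : seq 'M[R]_((sdim P).+1, sdim P);
  TS : seq 'M[R]_((sdim P).-1.+1, sdim P)
}.
Arguments tpoint {R P} d _.

Section discrete_problem.
Variables (R : realType) (P : problem R) (D : discretization P) (q : nat).
Local Notation E := 'rV[R]_(sdim P).
Local Notation fn := (E -> R^o).
Local Notation functional := (fn -> R^o).
Local Notation leb := (@lebesgue_measure R).
Local Notation T := (final_time P).
Local Notation M := (nsteps D).

Definition admissible (kappa : R) : Prop :=
  [/\ [/\ tpoint D 0 = 0, tpoint D M = T &
          forall k, (k < M)%N -> tpoint D k < tpoint D k.+1],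
      triangulates (TV D) (closure (domain P)),
      shape_regular kappa (TV D) &
      if on_surface (case_of P)
      then triangulates (TS D) (polyhedron (tGamma P))
      else triangulates (TM D) (closure (domain P))].

(* the interval I_{k+1} = [t_k, t_{k+1}) *)
Definition tslab (k : nat) : set R := `[tpoint D k, tpoint D k.+1[.

Definition Vh : set fn :=
  [set v : fn | [/\ carrier (Hspace P) v,
             {within closure (domain P), continuous (v : E -> R)} &
             forall K, K \in TV D -> affine_on (simplex K) v]].

Definition Mh : set fn :=
  if on_surface (case_of P) then piecewise_constant (TS D)
  else piecewise_constant (TM D).

Definition tensor_time (X : set fn) (v : R -> fn) : Prop :=
  forall k, (k < M)%N -> exists2 c : 'I_q.+1 -> fn, (forall j, X (c j)) &
    forall t, tslab k t -> v t = \sum_(j < q.+1) t ^+ j *: c j.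

Definition Wh (v : R -> fn) : Prop := tensor_time Vh v.

Definition Lambdah (S : set E) (F : fn) (lam : R -> fn) : Prop :=
  tensor_time Mh lam /\
  match case_of P with
  | Obstacle | Signorini =>
      ae_time P (fun t => ae_contact P (fun x => lam t x <= 0))
  | InteriorFriction | Friction =>
      ae_time P (fun t =>
        ae_contact P (fun x => `|lam t x| <= friction_bound P S F x))
  end.

(* A function as a functional, through the L^2 inner product of the set carrying
   the multipliers. *)
Definition emb (g : fn) : functional := dotY P g.

Definition lim_left (v : R -> fn) (t : R) : fn :=
  fun x => lim ((v s x : R) @[s --> t^'-]).

Definition lim_right (v : R -> fn) (t : R) : fn :=
  fun x => lim ((v s x : R) @[s --> t^'+]).

(* v^k_-, with the prescribed value for k = 0 *)
Definition minus_value (v0 : fn) (v : R -> fn) (k : nat) : fn :=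
  if k is 0 then v0 else lim_left v (tpoint D k).

Definition tjump (v0 : fn) (v : R -> fn) (k : nat) : fn :=
  lim_right v (tpoint D k) - minus_value v0 v k.

Definition time_deriv (v : R -> fn) (t : R) : fn :=
  fun x => derive1 (fun s => v s x : R) t.

Definition B_DG (u v : R -> fn) : R :=
  \sum_(k < M) \int[leb]_(t in tslab k)
    (dotL2 (domain P) (time_deriv u t) (v t) + aform P (u t) (v t)).

Definition discrete_solution (S : set E) (F w : fn) (f : R -> functional)
    (uh0 : fn) (uh lamh : R -> fn) : Prop :=
  [/\ Wh uh,
      Lambdah S F lamh,
      forall vh, Wh vh ->
        B_DG uh vh
        + \sum_(k < M) \int[leb]_(t in tslab k) bform P (emb (lamh t)) (vh t)
        + \sum_(k < M)
            dotL2 (domain P) (tjump uh0 uh k) (lim_right vh (tpoint D k))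
        = \sum_(k < M) \int[leb]_(t in tslab k) f t (vh t) &
      forall mh, Lambdah S F mh ->
        \sum_(k < M) \int[leb]_(t in tslab k)
          bform P (emb (mh t - lamh t)) (uh t)
        <= \sum_(k < M) \int[leb]_(t in tslab k) emb (mh t - lamh t) w].

(* The right Radau points of (0, 1]: 1 for q = 0; 1/3 and 1 for q = 1. *)
Definition radau (j : 'I_q.+1) : R := if j == ord_max then 1 else 1 / 3.

Definition radau_node (k : nat) (j : 'I_q.+1) : R :=
  tpoint D k + radau j * (tpoint D k.+1 - tpoint D k).

Definition interpolant (uh0 : fn) (uh U : R -> fn) : Prop :=
  forall k, (k < M)%N ->
    [/\ exists c : 'I_q.+2 -> fn,
          forall t, t \in `[tpoint D k, tpoint D k.+1] ->
            U t = \sum_(j < q.+2) t ^+ j *: c j,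
        U (tpoint D k) = minus_value uh0 uh k &
        forall j : 'I_q.+1, U (radau_node k j) = lim_left uh (radau_node k j)].

End discrete_problem.

Arguments tslab {R P} D k _.
Arguments Vh {R P} D _.
Arguments emb {R P} g _.
Arguments discrete_solution {R P} D q S F w f uh0 uh lamh.
Arguments interpolant {R P} D q uh0 uh U.

(* Main.v *)
Require Import Defs.
From mathcomp Require Import all_boot all_order all_algebra.
From mathcomp Require Import all_classical all_reals all_analysis.
From mathcomp Require Import measurable_realfun ring lra.
Import Order.TTheory GRing.Theory Num.Theory.
Import numFieldNormedType.Exports.
Local Open Scope classical_set_scope.
Local Open Scope ring_scope.
Set Implicit Arguments.
Unset Strict Implicit.

(** The proof is an energy argument for the error e = u - U.

    At almost every time the variational equation localizes to an identity of
    functionals on H (equation_ae): products of scalar test functions and fixed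
    vectors are admissible test functions, the fundamental lemma of the
    calculus of variations removes the integral for each vector, and countably
    many vectors norm the values of a Bochner measurable functional
    (ae_functional_eq0). Subtracting the definition of the residual r gives the
    error equation: the derivative of e plus lambda - lambda_H equals
    r - lambda_H minus the functional a(u - u_h, .).

    Tested with e, and with u - u_h = e + (U - u_h), coercivity and Young's
    inequality bound |e|_H^2 by the difference of the multiplier pairing
    b(lambda_H - lambda, e) and of the pairing of the derivative of e with e, up
    to squares of the residual and of u_h - U. The triangle inequality then
    bounds u - u_h, and the error equation itself bounds the dual norm of its
    left-hand side (pointwise_estimate).

    Integration over the slabs leaves the integral of the pairing of the
    derivative of e with e, which is half the increment of the squared L2 norm
    (energy_identity). Since it occurs with a factor K >= 2, the error at the
    final time is absorbed on the left.

    The interpolant is given by the values of a polynomial in each slab, whose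
    coefficients belong to H because they are combinations of the values at
    finitely many good times (polynomial_coef_carrier). The energy form is
    finite and bilinear on H by coercivity (coercive_finite_energy). The norms
    of the error are measurable up to null sets only, so all integrals are moved
    to one set of times of full measure (integral_conull), and the integrands of
    the two sides are compared without appeal to their measurability
    (le_integral_dominated). *)

(** * Integrals *)

Section integrals.
Context d (T : measurableType d) (R : realType).
Variable mu : {measure set T -> \bar R}.
Implicit Types (D A : set T).
Local Open Scope ereal_scope.
Import HBNNSimple.

(** The integral of any nonnegative function is by definition a supremum over
    simple functions; only those that vanish outside of D matter. This gives
    access to the integrals of norms whose measurability is unknown. *)
Lemma ge0_integral_le_simple D (f : T -> \bar R) z :
  (forall x, D x -> 0 <= f x) ->
  (forall h : {nnsfun T >-> R}, (forall x, D x -> (h x)%:E <= f x) ->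
     (forall x, ~ D x -> h x = 0%R) -> \int[mu]_(x in D) (h x)%:E <= z) ->
  \int[mu]_(x in D) f x <= z.
Proof.
move=> f0 H; rewrite ge0_integralE//.
apply/ge_ereal_sup => /= _ [h/= hf <-].
have h0 x : ~ D x -> h x = 0%R.
  move=> Dx; have := hf x; rewrite patchE memNset// lee_fin => hx.
  by apply/eqP; rewrite eq_le hx fun_ge0.
rewrite -integralT_nnsfun.
have -> : \int[mu]_x (h x)%:E = \int[mu]_(x in D) (h x)%:E.
  rewrite [RHS]integral_mkcond; congr integral; apply/funext => x.
  by rewrite patchE; case: ifPn => // /negP; rewrite inE => /h0 ->.
by apply: H => // x Dx; have := hf x; rewrite patchE mem_set.
Qed.

Lemma ge0_le_integral_any D A (f g : T -> \bar R) :
  D `<=` A -> (forall x, D x -> 0 <= f x) -> (forall x, A x -> 0 <= g x) ->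
  (forall x, D x -> f x <= g x) ->
  \int[mu]_(x in D) f x <= \int[mu]_(x in A) g x.
Proof.
move=> DA f0 g0 fg; rewrite ge0_integralE// [leRHS]ge0_integralE//.
apply: le_ereal_sup => /= _ [h/= hf <-]; exists h => //= x.
apply: (le_trans (hf x)); rewrite !patchE; case: ifPn => [|_].
  by rewrite inE => Dx; rewrite mem_set ?fg//; exact: DA.
by case: ifPn => //; rewrite inE => /g0.
Qed.

(** Integrals do not see null sets, even for a nonmeasurable integrand: this is
    what allows all the functions of time, which are measurable only up to a
    null set, to be handled on one common set of full measure. *)
Lemma integral_conull D A (f : T -> \bar R) :
  measurable D -> measurable A -> D `<=` A -> mu (A `\` D) = 0 ->
  \int[mu]_(x in A) f x = \int[mu]_(x in D) f x.
Proof.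
move=> mD mA DA AD0.
suff H (g : T -> \bar R) : (forall x, 0 <= g x) ->
    \int[mu]_(x in A) g x = \int[mu]_(x in D) g x.
  by rewrite integralE [RHS]integralE !H// => x; rewrite ?funepos_ge0 ?funeneg_ge0.
move=> g0; apply/eqP; rewrite eq_le; apply/andP; split; last first.
  exact: ge0_le_integral_any.
apply: ge0_integral_le_simple => // h hg h0.
rewrite (@ge0_negligible_integral _ _ _ mu A (A `\` D))//=; last 3 first.
  - exact: measurableD.
  - exact/measurable_EFinP/measurable_funTS.
  - by move=> x Ax; rewrite lee_fin.
rewrite setDD setIidr//.
by apply: ge0_le_integral_any => // x Dx; [rewrite lee_fin|apply: hg; apply: DA].
Qed.

(** For arbitrary G and rho: a simple function h below G yields the measurable
    function (h - b)^+ / c below rho, and this bounds the integral of h. *)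
Lemma le_integral_dominated D (G b rho : T -> R) (c : R) : measurable D ->
  (0 < c)%R -> (forall x, D x -> 0 <= G x)%R -> (forall x, D x -> 0 <= rho x)%R ->
  mu.-integrable D (EFin \o b) ->
  (forall x, D x -> G x <= b x + c * rho x)%R ->
  \int[mu]_(x in D) (G x)%:E <=
  (\int[mu]_(x in D) b x)%R%:E + c%:E * \int[mu]_(x in D) (rho x)%:E.
Proof.
move=> mD c0 G0 rho0 ib Gle.
have [roo|] := eqVneq (\int[mu]_(x in D) (rho x)%:E) +oo.
  by rewrite roo gt0_muley ?lte_fin// addeC leey.
rewrite -ltey => rfin.
apply: ge0_integral_le_simple => [x Dx|h hG h0]; first by rewrite lee_fin G0.
pose k x : R := (Num.max 0 ((h x - b x) / c))%R.
have mb : measurable_fun D b by exact/measurable_EFinP/(measurable_int mu).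
have mh : measurable_fun D h by exact: measurable_funTS.
have mk : measurable_fun D k.
  apply: measurable_maxr => //; apply: measurable_funM => //.
  exact: measurable_funB.
have k0 x : (0 <= k x)%R by rewrite le_max lexx.
have krho x : D x -> (k x <= rho x)%R.
  move=> Dx; rewrite ge_max rho0//= ler_pdivrMr// mulrC lerBlDl.
  by apply: le_trans (Gle _ Dx); rewrite -lee_fin hG.
have kle : \int[mu]_(x in D) (k x)%:E <= \int[mu]_(x in D) (rho x)%:E.
  by apply: ge0_le_integral_any => // x Dx; rewrite lee_fin ?rho0 ?krho.
have ik : mu.-integrable D (EFin \o k).
  apply/integrableP; split; first exact/measurable_EFinP.
  under eq_integral do rewrite /= ger0_norm//.
  exact: le_lt_trans rfin.
have ick : mu.-integrable D (EFin \o (fun x => c * k x)%R).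
  by under [_ \o _]eq_fun do rewrite /= EFinM; exact: integrableZl.
have hle x : (h x <= b x + c * k x)%R.
  rewrite -lerBlDl -ler_pdivrMl// mulrC /k le_max.
  by rewrite lexx orbT.
have ih : mu.-integrable D (EFin \o h).
  apply: (@le_integrable _ _ _ mu D mD _ (EFin \o (fun x => b x + c * k x)%R)).
  - exact/measurable_EFinP.
  - move=> x Dx /=; rewrite lee_fin ger0_norm//.
    by rewrite (le_trans (hle x))// ler_norm.
  - by under [_ \o _]eq_fun do rewrite /= EFinD; exact: integrableD.
apply: (@le_trans _ _ (\int[mu]_(x in D) (b x + c * k x)%:E)).
  apply: le_integral => //.
    by under [X in _.-integrable _ X]eq_fun do rewrite /= EFinD; exact: integrableD.
  by move=> x _; rewrite /= lee_fin.
under eq_integral do rewrite EFinD EFinM.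
rewrite (integralD mD ib (integrableZl mD c ik)).
rewrite (integralZl mD ik) /Rintegral fineK ?integrable_fin_num// leeD2l//.
by rewrite lee_pmul2l ?lte_fin// .
Qed.

End integrals.

Section real_integrable.
Context d (T : measurableType d) (R : realType).
Variable mu : {measure set T -> \bar R}.
Variables (D : set T) (mD : measurable D).
Implicit Types f g : T -> R.
Local Notation integrableR f := (mu.-integrable D (EFin \o f)).

Lemma RintegrableD f g : integrableR f -> integrableR g ->
  integrableR (fun x => f x + g x).
Proof. exact: (integrableD mD). Qed.

Lemma RintegrableB f g : integrableR f -> integrableR g ->
  integrableR (fun x => f x - g x).
Proof. exact: (integrableB mD). Qed.

Lemma RintegrableZ c f : integrableR f -> integrableR (fun x => c * f x).
Proof. exact: (integrableZl mD). Qed.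

Lemma Rintegrable_sum I (r : seq I) (h : I -> T -> R) :
  (forall i, integrableR (h i)) -> integrableR (fun x => \sum_(i <- r) h i x).
Proof.
move=> ih; elim: r => [|i r ihr].
  by under [X in EFin \o X]eq_fun do rewrite big_nil; exact: integrable0.
by under [X in EFin \o X]eq_fun do rewrite big_cons; exact: RintegrableD.
Qed.

Lemma le_Rintegrable f g : measurable_fun D f -> integrableR g ->
  (forall x, D x -> `|f x| <= g x) -> integrableR f.
Proof.
move=> mf ig fg; apply: (le_integrable mD _ _ ig); first exact/measurable_EFinP.
by move=> x Dx /=; rewrite lee_fin (le_trans (fg _ Dx))// ler_norm.
Qed.

Lemma eq_Rintegrable f g : (forall x, D x -> f x = g x) -> integrableR f ->
  integrableR g.
Proof.
move=> fg; apply: (eq_integrable mD) => x; rewrite inE => Dx.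
by rewrite /= fg.
Qed.

Lemma Rintegrable_measurable f : integrableR f -> measurable_fun D f.
Proof. by move=> h; exact/measurable_EFinP/(measurable_int mu). Qed.

Lemma Rintegral_EFin f : integrableR f ->
  ((\int[mu]_(x in D) f x)%:E = \int[mu]_(x in D) (f x)%:E)%E.
Proof. by move=> h; rewrite /Rintegral fineK// integrable_fin_num. Qed.

Lemma Rintegral_sum I (r : seq I) (h : I -> T -> R) :
  (forall i, integrableR (h i)) ->
  \int[mu]_(x in D) (\sum_(i <- r) h i x) = \sum_(i <- r) \int[mu]_(x in D) h i x.
Proof.
move=> ih; elim: r => [|i r IH].
  by under eq_Rintegral do rewrite big_nil; rewrite Rintegral_cst// mul0r big_nil.
under eq_Rintegral do rewrite big_cons.
by rewrite RintegralD// ?IH ?big_cons//; exact: Rintegrable_sum.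
Qed.

Lemma Rintegrable_bounded f (K : R) : (mu D < +oo)%E -> measurable_fun D f ->
  (forall x, D x -> `|f x| <= K) -> integrableR f.
Proof.
move=> Dfin mf fK; apply: (le_Rintegrable mf _ fK).
apply/integrableP; split; first exact: measurable_cst.
by rewrite /= integral_cst// lte_mul_pinfty// lee_fin.
Qed.

End real_integrable.

Section dominated.
Context d (T : measurableType d) (R : realType).
Variable mu : {measure set T -> \bar R}.
Variables (D : set T) (mD : measurable D).

Lemma Rdominated_cvg (f_ : (T -> R)^nat) (f b : T -> R) :
  (forall n, measurable_fun D (f_ n)) ->
  (forall x, D x -> f_ n x @[n --> \oo] --> f x) ->
  mu.-integrable D (EFin \o b) ->
  (forall n x, D x -> `|f_ n x| <= b x) ->
  \int[mu]_(x in D) f_ n x @[n --> \oo] --> \int[mu]_(x in D) f x.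
Proof.
move=> mf ff ib fb.
have mf' : measurable_fun D f by exact: measurable_fun_cvg ff.
have [] := @dominated_convergence _ _ _ mu D mD (fun n => EFin \o f_ n) (EFin \o f)
  (EFin \o b).
- by move=> n; exact/measurable_EFinP.
- exact/measurable_EFinP.
- by apply: aeW => x Dx; apply: cvg_EFin; [exact: nearW|exact: ff].
- exact: ib.
- by apply: aeW => x n Dx /=; rewrite lee_fin fb.
move=> fi _ H.
rewrite /Rintegral; apply: fine_cvg.
by rewrite fineK; [exact: H|exact: integrable_fin_num].
Qed.

Lemma Rintegral_conull A (f : T -> R) :
  measurable A -> D `<=` A -> mu (A `\` D) = 0%E ->
  \int[mu]_(x in A) f x = \int[mu]_(x in D) f x.
Proof. by move=> mA DA AD; rewrite /Rintegral (integral_conull _ mD). Qed.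

End dominated.

(** * Seminormed spaces and their duals *)

(** The axioms speak of the carrier alone: outside of it the values of the
    seminorm are junk, and the sum of two such vectors may fall back inside. *)
Record is_seminorm (R : realType) (L : lmodType R) (V : seminormed L) : Prop :=
  IsSeminorm {
  carrier0 : carrier V 0;
  carrierL : forall (c : R) u v, carrier V u -> carrier V v ->
    carrier V (c *: u + v);
  nrm_ge0 : forall v, carrier V v -> 0 <= nrm V v;
  nrmZ : forall (c : R) v, carrier V v -> nrm V (c *: v) = `|c| * nrm V v;
  nrmD : forall u v, carrier V u -> carrier V v ->
    nrm V (u + v) <= nrm V u + nrm V v }.

Section seminormed_theory.
Variables (R : realType) (L : lmodType R) (V : seminormed L).
Hypothesis sV : is_seminorm V.

Lemma carrierD u v : carrier V u -> carrier V v -> carrier V (u + v).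
Proof. by move=> hu hv; rewrite -[u]scale1r; exact: carrierL. Qed.

Lemma carrierZ c u : carrier V u -> carrier V (c *: u).
Proof. by move=> hu; rewrite -[X in carrier V X]addr0; apply: carrierL => //; exact: carrier0. Qed.

Lemma carrierN u : carrier V u -> carrier V (- u).
Proof. by move=> hu; rewrite -scaleN1r; exact: carrierZ. Qed.

Lemma carrierB u v : carrier V u -> carrier V v -> carrier V (u - v).
Proof. by move=> hu hv; apply: carrierD => //; exact: carrierN. Qed.

Lemma carrier_sum I (r : seq I) (Q : pred I) (F : I -> L) :
  (forall i, Q i -> carrier V (F i)) -> carrier V (\sum_(i <- r | Q i) F i).
Proof.
by move=> hF; elim/big_ind : _ => //; [exact: carrier0|exact: carrierD].
Qed.

Lemma nrm0 : nrm V 0 = 0.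
Proof. by rewrite -(scale0r 0) nrmZ ?normr0 ?mul0r//; exact: carrier0. Qed.

Lemma nrmN u : carrier V u -> nrm V (- u) = nrm V u.
Proof. by move=> hu; rewrite -scaleN1r nrmZ// normrN1 mul1r. Qed.

Lemma nrmB u v : carrier V u -> carrier V v -> nrm V (u - v) <= nrm V u + nrm V v.
Proof. by move=> hu hv; rewrite -(nrmN hv); apply: (nrmD sV) => //; exact: carrierN. Qed.

Lemma nrm_distC u v : carrier V u -> carrier V v -> nrm V (u - v) = nrm V (v - u).
Proof. by move=> hu hv; rewrite -opprB nrmN//; exact: carrierB. Qed.

Lemma nrm_triangle w u v : carrier V u -> carrier V v -> carrier V w ->
  nrm V (u - v) <= nrm V (u - w) + nrm V (w - v).
Proof.
move=> hu hv hw.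
by rewrite -[u - v](subrKA w); apply: (nrmD sV); exact: carrierB.
Qed.

Lemma nrm_dist u v : carrier V u -> carrier V v ->
  `|nrm V u - nrm V v| <= nrm V (u - v).
Proof.
move=> hu hv; rewrite ler_norml; apply/andP; split.
  have := nrmD sV (carrierB hv hu) hu; rewrite subrK nrm_distC// => h; lra.
have := nrmD sV (carrierB hu hv) hv; rewrite subrK => h; lra.
Qed.

Lemma nrm_sum I (r : seq I) (Q : pred I) (F : I -> L) :
  (forall i, Q i -> carrier V (F i)) ->
  nrm V (\sum_(i <- r | Q i) F i) <= \sum_(i <- r | Q i) nrm V (F i).
Proof.
move=> hF.
suff : carrier V (\sum_(i <- r | Q i) F i) /\
  nrm V (\sum_(i <- r | Q i) F i) <= \sum_(i <- r | Q i) nrm V (F i) by case.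
elim/big_ind2 : _ => [|x a y b [cx xa] [cy yb]|i Qi].
- by split; [exact: carrier0|rewrite nrm0].
- split; first exact: carrierD.
  by rewrite (le_trans (nrmD sV cx cy))// lerD.
- by split; [exact: hF|].
Qed.

Lemma nrmB_sq u v : carrier V u -> carrier V v ->
  nrm V (u - v) ^+ 2 <= 2 * nrm V u ^+ 2 + 2 * nrm V v ^+ 2.
Proof.
move=> hu hv; have h1 := nrmB hu hv.
have h2 := nrm_ge0 sV (carrierB hu hv).
have : nrm V (u - v) ^+ 2 <= (nrm V u + nrm V v) ^+ 2.
  by rewrite ler_sqr ?nnegrE//; exact: le_trans h1.
have := sqr_ge0 (nrm V u - nrm V v); lra.
Qed.

Lemma dual_lin (l : L -> R^o) (c : R) u v : carrier (dual_space V) l ->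
  carrier V u -> carrier V v -> l (c *: u + v) = c * l u + l v.
Proof. by case=> h _; exact: h. Qed.

Lemma dual0 (l : L -> R^o) : carrier (dual_space V) l -> l 0 = 0.
Proof.
move=> hl; have := dual_lin 1 hl (carrier0 sV) (carrier0 sV).
by rewrite scaler0 addr0 mul1r => /esym/eqP; rewrite -subr_eq0 addrK => /eqP.
Qed.

Lemma dualZ (l : L -> R^o) (c : R) u : carrier (dual_space V) l ->
  carrier V u -> l (c *: u) = c * l u.
Proof.
move=> hl hu; rewrite -[X in l X]addr0 (dual_lin c hl hu (carrier0 sV)).
by rewrite dual0// addr0.
Qed.

Lemma dualD (l : L -> R^o) u v : carrier (dual_space V) l ->
  carrier V u -> carrier V v -> l (u + v) = l u + l v.
Proof.
by move=> hl hu hv; rewrite -[u]scale1r (dual_lin 1 hl hu hv) scale1r mul1r.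
Qed.

Lemma dualB (l : L -> R^o) u v : carrier (dual_space V) l ->
  carrier V u -> carrier V v -> l (u - v) = l u - l v.
Proof.
move=> hl hu hv; rewrite dualD//; last exact: carrierN.
by rewrite -scaleN1r (dualZ _ hl hv) mulN1r.
Qed.

Let ball (l : L -> R^o) : set R :=
  [set `|l v| | v in [set v | carrier V v /\ nrm V v <= 1]].

Let ball_neq0 (l : L -> R^o) : ball l !=set0.
Proof. by exists `|l 0|; exists 0 => //=; split; [exact: carrier0|rewrite nrm0]. Qed.

Let ball_has_sup (l : L -> R^o) : carrier (dual_space V) l -> has_sup (ball l).
Proof.
move=> [_ [C hC]]; split; first exact: ball_neq0.
exists `|C| => _ [v [cv v1] <-].
rewrite (le_trans (hC _ cv))// (@le_trans _ _ (`|C| * nrm V v))//.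
  by rewrite ler_wpM2r ?ler_norm// nrm_ge0.
by rewrite ler_piMr.
Qed.

Lemma dual_nrm_ge0 (l : L -> R^o) : 0 <= nrm (dual_space V) l.
Proof.
have [hs|hs] := pselect (has_sup (ball l)); last by rewrite /= sup_out.
have [x [v cv lv]] := ball_neq0 l.
apply: (le_trans (normr_ge0 (l v))).
by apply: ub_le_sup; [case: hs|exists v].
Qed.

Lemma le0_mul_all (a b : R) : 0 <= b -> (forall k : nat, k%:R * a <= b) -> a <= 0.
Proof.
move=> b0 h; rewrite leNgt; apply/negP => a0.
have [k hk] : exists k : nat, b / a < k%:R.
  by exists (Num.bound (b / a)); rewrite archi_boundP// divr_ge0// ltW.
by have := h k; rewrite leNgt -ltr_pdivrMr// hk.
Qed.

(** A vector of norm 0 cannot be normalized, but a continuous functional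
    vanishes on it. *)
Lemma dual_le (l : L -> R^o) v : carrier (dual_space V) l -> carrier V v ->
  `|l v| <= nrm (dual_space V) l * nrm V v.
Proof.
move=> hl hv; have := nrm_ge0 sV hv; rewrite le_eqVlt => /predU1P[v0|v0].
  rewrite -v0 mulr0; have [_ [C hC]] := hl.
  by rewrite (le_trans (hC _ hv))// -v0 mulr0.
rewrite -ler_pdivrMr// -[X in _ / X]ger0_norm ?(ltW v0)// -normrV ?unitfE ?gt_eqF//.
rewrite -normrM mulrC -(dualZ _ hl hv).
apply: ub_le_sup; first by case: (ball_has_sup hl).
exists ((nrm V v)^-1 *: v) => //; split; first exact: carrierZ.
by rewrite nrmZ// ger0_norm ?invr_ge0 ?(ltW v0)// mulVf// gt_eqF.
Qed.

Lemma dual_nrm_le (l : L -> R^o) (K : R) : 0 <= K ->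
  (forall v, carrier V v -> `|l v| <= K * nrm V v) -> nrm (dual_space V) l <= K.
Proof.
move=> K0 h; apply: ge_sup; first exact: ball_neq0.
move=> _ [v [cv v1] <-]; rewrite (le_trans (h _ cv))// ler_piMr//.
Qed.

Lemma eq_dual_nrm (l l' : L -> R^o) :
  (forall v, carrier V v -> l v = l' v) ->
  nrm (dual_space V) l = nrm (dual_space V) l'.
Proof.
move=> h; congr sup; apply/seteqP; split=> _ [v [cv v1] <-].
  by exists v => //; rewrite h.
by exists v => //; rewrite h.
Qed.

Lemma dual_norming (l : L -> R^o) (eps : R) : carrier (dual_space V) l -> 0 < eps ->
  exists v, [/\ carrier V v, nrm V v <= 1 & nrm (dual_space V) l - eps <= `|l v|].
Proof.
move=> hl e0; have [_ [v [cv v1] <-] h] := sup_adherent e0 (ball_has_sup hl).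
by exists v; split => //; exact: ltW.
Qed.

(** By homogeneity, any polynomial bound of degree two gives continuity. *)
Lemma dual_intro (l : L -> R^o) (K : R) :
  (forall (c : R) u v, carrier V u -> carrier V v -> l (c *: u + v) = c * l u + l v) ->
  (forall v, carrier V v -> `|l v| <= K * (1 + nrm V v ^+ 2)) ->
  carrier (dual_space V) l.
Proof.
move=> ll lK; split => //; exists (2 * K) => v cv.
have K0 : 0 <= K.
  have := lK _ (carrier0 sV); rewrite nrm0 expr0n addr0 mulr1.
  exact: le_trans.
have l0 : l 0 = 0.
  have := ll 1 0 0 (carrier0 sV) (carrier0 sV).
  by rewrite scaler0 addr0 mul1r => /esym/eqP; rewrite -subr_eq0 addrK => /eqP.
have lZ c u : carrier V u -> l (c *: u) = c * l u.
  by move=> cu; have := ll c u 0 cu (carrier0 sV); rewrite l0 !addr0.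
have := nrm_ge0 sV cv; rewrite le_eqVlt => /predU1P[v0|v0].
  rewrite -v0 mulr0; apply: (le0_mul_all K0) => k.
  have := lK _ (carrierZ k%:R cv); rewrite lZ// nrmZ// -v0 mulr0 expr0n addr0.
  by rewrite mulr1 normrM ger0_norm.
have := lK _ (carrierZ (nrm V v)^-1 cv); rewrite lZ// nrmZ//.
rewrite normrM ger0_norm ?invr_ge0 ?(ltW v0)// mulVf ?gt_eqF// expr1n.
by rewrite ler_pdivrMl// (_ : nrm V v * (K * (1 + 1)) = 2 * K * nrm V v); last ring.
Qed.

Lemma dual_seminorm : is_seminorm (dual_space V).
Proof.
split.
- split=> [c u v _ _|]; first by rewrite /= mulr0 addr0.
  by exists 0 => v cv; rewrite /= normr0 mul0r.
- move=> c u v [hu [A hA]] [hv [B hB]]; split=> [a x y cx cy|].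
    have E z : (c *: u + v) z = c * u z + v z by [].
    by rewrite !E hu// hv//; ring.
  exists (`|c| * A + B) => x cx.
  have -> : (c *: u + v) x = c * u x + v x by [].
  rewrite (le_trans (ler_normD _ _))// mulrDl lerD ?hB//.
  by rewrite normrM -mulrA ler_wpM2l ?hA.
- by move=> v _; exact: dual_nrm_ge0.
- move=> c l hl; have [->|c0] := eqVneq c 0.
    rewrite normr0 mul0r; apply/eqP; rewrite eq_le dual_nrm_ge0 andbT.
    apply: dual_nrm_le => // v cv.
    by rewrite scale0r /= normr0 mul0r.
  have hle (a : R) l' : carrier (dual_space V) l' ->
      nrm (dual_space V) (a *: l') <= `|a| * nrm (dual_space V) l'.
    move=> hl'; apply: dual_nrm_le => [|v cv]; first by rewrite mulr_ge0 ?dual_nrm_ge0.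
    have -> : (a *: l') v = a * l' v by [].
    by rewrite normrM -mulrA ler_wpM2l// dual_le.
  have cl : carrier (dual_space V) (c *: l).
    case: hl => h [A hA]; split=> [a x y cx cy|].
      have E z : (c *: l) z = c * l z by [].
      by rewrite !E h//; ring.
    exists (`|c| * A) => x cx.
    have -> : (c *: l) x = c * l x by [].
    by rewrite normrM -mulrA ler_wpM2l ?hA.
  apply/eqP; rewrite eq_le hle//=.
  have := hle c^-1 _ cl; rewrite scalerK// normfV.
  by rewrite ler_pdivlMl ?normr_gt0.
- move=> u v hu hv; apply: dual_nrm_le => [|x cx].
    by rewrite addr_ge0 ?dual_nrm_ge0.
  have -> : (u + v) x = u x + v x by [].
  by rewrite (le_trans (ler_normD _ _))// mulrDl lerD ?dual_le.
Qed.

End seminormed_theory.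

(** * Bochner measurable functions *)

(** A function which factors through finitely many measurable sets; unlike an
    explicit sum over indicators this is stable under composition. *)
Definition finitely_based d (T : measurableType d) (X : Type) (s : T -> X) :=
  exists (I : finType) (A : I -> set T) (g : {ffun I -> bool} -> X),
    (forall i, measurable (A i)) /\ forall t, s t = g [ffun i => t \in A i].

Section finitely_based.
Context d (T : measurableType d).

Lemma finitely_based_comp X Y (f : X -> Y) (s : T -> X) :
  finitely_based s -> finitely_based (f \o s).
Proof.
move=> [I [A [g [mA sE]]]]; exists I, A, (f \o g); split => // t.
by rewrite /= sE.
Qed.

Lemma finitely_based_pair X Y Z (f : X -> Y -> Z) (s : T -> X) (r : T -> Y) :
  finitely_based s -> finitely_based r -> finitely_based (fun t => f (s t) (r t)).
Proof.
move=> [I [A [g [mA sE]]]] [J [B [h [mB rE]]]].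
pose C (k : I + J) : set T := match k with inl i => A i | inr j => B j end.
exists (I + J)%type, C, (fun b => f (g [ffun i => b (inl i)]) (h [ffun j => b (inr j)])).
split=> [[]//|t]; rewrite sE rE; congr (f (g _) (h _)).
  by apply/ffunP => i; rewrite !ffunE.
by apply/ffunP => i; rewrite !ffunE.
Qed.

Lemma finitely_based_if X (B : set T) (x0 : X) (s : T -> X) : measurable B ->
  finitely_based s -> finitely_based (fun t => if t \in B then s t else x0).
Proof.
move=> mB sE; have bB : finitely_based (fun t => t \in B).
  exists unit, (fun=> B), (fun b : {ffun unit -> bool} => b tt); split => // t.
  by rewrite ffunE.
exact: (finitely_based_pair (fun (b : bool) x => if b then x else x0) bB sE).
Qed.

Lemma measurable_atom (I : finType) (A : I -> set T) (b : {ffun I -> bool}) :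
  (forall i, measurable (A i)) ->
  measurable [set t | [ffun i => t \in A i] = b].
Proof.
move=> mA; rewrite [X in measurable X](_ : _ =
    \bigcap_(i in [set: I]) (if b i then A i else ~` A i)).
  apply: fin_bigcap_measurable => // i _.
  by case: ifP => // _; exact: measurableC.
apply/seteqP; split=> t /=.
  move=> <- i _; rewrite ffunE; case: ifPn; first by rewrite inE.
  by rewrite notin_setE.
move=> h; apply/ffunP => i; have := h i Logic.I; rewrite ffunE {h}.
by case: ifP => _ h; [rewrite mem_set|rewrite memNset].
Qed.

Lemma measurable_finitely_based (R : realType) (D : set T) (s : T -> R) :
  finitely_based s -> measurable_fun D s.
Proof.
move=> [I [A [g [mA sE]]]]; apply: measurable_funTS => _ Y mY; rewrite setTI.
rewrite [X in measurable X](_ : _ =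
  \bigcup_(b in [set b | Y (g b)]) [set t | [ffun i => t \in A i] = b]).
  by apply: fin_bigcup_measurable => // b _; exact: measurable_atom.
apply/seteqP; split=> t /=; rewrite sE => h; first by exists [ffun i => t \in A i].
by move: h => [b Yb /= ->].
Qed.

End finitely_based.

Section scalar_limits.
Variable R : realType.

Lemma cvg_dist_le (a b : R^nat) (l : R) : (forall j, `|a j - l| <= b j) ->
  b @ \oo --> (0 : R) -> a @ \oo --> l.
Proof.
move=> ab b0; apply/cvgrPdist_le => e e0.
move/cvgrPdist_le : b0 => /(_ _ e0); apply: filterS => j.
rewrite sub0r normrN distrC => h; apply: le_trans (ab j) (le_trans (ler_norm _) h).
Qed.

End scalar_limits.

Section bochner.
Context d (T : measurableType d) (R : realType).
Variable mu : {measure set T -> \bar R}.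

(** The approximants take values in the carrier at all times, while x is
    constrained on D only; D will be a set of full measure on which all a.e.
    properties hold. *)
Definition bochner_measurable (D : set T) (L : lmodType R) (V : seminormed L)
    (x : T -> L) :=
  (forall t, D t -> carrier V (x t)) /\
  exists2 x_ : nat -> T -> L,
    forall j, finitely_based (x_ j) /\ forall t, carrier V (x_ j t) &
    forall t, D t -> nrm V (x_ j t - x t) @[j --> \oo] --> (0 : R).

Definition bochner_sq_integrable (D : set T) (L : lmodType R) (V : seminormed L)
    (x : T -> L) :=
  bochner_measurable D V x /\
  mu.-integrable D (EFin \o (fun t => nrm V (x t) ^+ 2)).

Section one_space.
Variables (D : set T) (mD : measurable D).
Variables (L : lmodType R) (V : seminormed L).
Hypothesis sV : is_seminorm V.
Implicit Types x y : T -> L.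

Lemma bochner_measurable_sub (D' : set T) x : D' `<=` D ->
  bochner_measurable D V x -> bochner_measurable D' V x.
Proof.
move=> DD [cx [x_ sx xx]]; split=> [t /DD|]; first exact: cx.
by exists x_ => // t /DD; exact: xx.
Qed.

Lemma bochner_sq_integrable_sub (D' : set T) x : measurable D' -> D' `<=` D ->
  bochner_sq_integrable D V x -> bochner_sq_integrable D' V x.
Proof.
move=> mD' DD [mx ix]; split; first exact: bochner_measurable_sub mx.
exact: integrableS ix.
Qed.

Lemma bochner_measurable_nrm x : bochner_measurable D V x ->
  measurable_fun D (fun t => nrm V (x t)).
Proof.
move=> [cx [x_ sx xx]].
apply: (@measurable_fun_cvg _ _ _ _ (fun j t => nrm V (x_ j t))).
  by move=> j; apply: measurable_finitely_based; apply: finitely_based_comp; case: (sx j).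
move=> t Dt; apply: cvg_dist_le (xx _ Dt) => j.
by apply: nrm_dist => //; [case: (sx j)|exact: cx].
Qed.

Lemma bochner_measurable_lin (c : R) x y : bochner_measurable D V x ->
  bochner_measurable D V y -> bochner_measurable D V (fun t => c *: x t + y t).
Proof.
move=> [cx [x_ sx xx]] [cy [y_ sy yy]]; split=> [t Dt|].
  by apply: carrierL => //; [exact: cx|exact: cy].
exists (fun j t => c *: x_ j t + y_ j t).
  move=> j; have [fx ccx] := sx j; have [fy ccy] := sy j; split.
    exact: (finitely_based_pair (fun u v => c *: u + v)).
  by move=> t; exact: carrierL.
move=> t Dt.
apply: (@cvg_dist_le _ _ (fun j => `|c| * nrm V (x_ j t - x t) + nrm V (y_ j t - y t))).
  move=> j; have [_ ccx] := sx j; have [_ ccy] := sy j.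
  have h1 : carrier V (x_ j t - x t) by apply: carrierB => //; exact: cx.
  have h2 : carrier V (y_ j t - y t) by apply: carrierB => //; exact: cy.
  rewrite subr0 (_ : _ - _ = c *: (x_ j t - x t) + (y_ j t - y t)); last first.
    by rewrite scalerBr opprD addrACA.
  rewrite ger0_norm; last by apply: nrm_ge0 => //; exact: carrierL.
  rewrite -nrmZ//; apply: (nrmD sV) => //; exact: carrierZ.
rewrite -[X in _ --> X](addr0 0) -[X in _ --> X + _](mulr0 `|c|).
apply: cvgD; last exact: yy.
by apply: cvgM; [exact: cvg_cst|exact: xx].
Qed.

Lemma bochner_sq_integrable_intro x (b : T -> R) : bochner_measurable D V x ->
  mu.-integrable D (EFin \o b) ->
  (forall t, D t -> nrm V (x t) ^+ 2 <= b t) -> bochner_sq_integrable D V x.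
Proof.
move=> mx ib xb; split => //; apply: (le_Rintegrable mD _ ib).
  by apply: measurable_funX; exact: bochner_measurable_nrm.
by move=> t Dt; rewrite ger0_norm ?sqr_ge0// xb.
Qed.

Lemma bochner_sq_integrable_lin (c : R) x y : bochner_sq_integrable D V x ->
  bochner_sq_integrable D V y -> bochner_sq_integrable D V (fun t => c *: x t + y t).
Proof.
move=> [mx ix] [my iy].
apply: (@bochner_sq_integrable_intro _ (fun t =>
    (2 * c ^+ 2) * nrm V (x t) ^+ 2 + 2 * nrm V (y t) ^+ 2)).
- exact: bochner_measurable_lin.
- by apply: (RintegrableD mD); exact: RintegrableZ.
- move=> t Dt; have [cx _] := mx; have [cy _] := my.
  have ccx : carrier V (c *: x t) by apply: carrierZ => //; exact: cx.
  have := nrmB_sq sV ccx (carrierN sV (cy _ Dt)).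
  rewrite opprK (nrmN sV (cy _ Dt)) (nrmZ sV _ (cx _ Dt)) exprMn.
  by rewrite real_normK ?num_real// mulrA.
Qed.

(** The pairing is the pointwise limit of the pairings of the approximants, which
    take finitely many values. *)
Lemma bochner_measurable_pairing (l : T -> L -> R^o) x :
  bochner_measurable D (dual_space V) l -> bochner_measurable D V x ->
  measurable_fun D (fun t => l t (x t) : R).
Proof.
move=> [cl [l_ sl ll]] [cx [x_ sx xx]].
apply: (@measurable_fun_cvg _ _ _ _ (fun j t => l_ j t (x_ j t))).
  move=> j; apply: measurable_finitely_based.
  by apply: (finitely_based_pair (fun (u : L -> R^o) v => u v : R)); [case: (sl j)|case: (sx j)].
move=> t Dt.
pose n := nrm (dual_space V).
apply: (@cvg_dist_le _ _ (fun j => n (l_ j t - l t) * (nrm V (x_ j t - x t) + nrm V (x t)) +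
   n (l t) * nrm V (x_ j t - x t))).
  move=> j; have [_ /(_ t) cxj] := sx j; have [_ /(_ t) clj] := sl j.
  have cxt := cx _ Dt; have clt := cl _ Dt.
  have cB := carrierB sV cxj cxt.
  have dB := carrierB (dual_seminorm sV) clj clt.
  have -> : l_ j t (x_ j t) - l t (x t) =
      (l_ j t - l t) (x_ j t) + l t (x_ j t - x t).
    rewrite (dualB sV clt cxj cxt).
    have -> : (l_ j t - l t) (x_ j t) = l_ j t (x_ j t) - l t (x_ j t) by [].
    ring.
  rewrite (le_trans (ler_normD _ _))// lerD//; last exact: dual_le.
  rewrite (le_trans (dual_le sV dB cxj))// ler_wpM2l ?dual_nrm_ge0//.
  by rewrite -[X in nrm _ X <= _](subrK (x t)); apply: (nrmD sV).
rewrite [X in _ --> X](_ : 0 = 0 * (0 + nrm V (x t)) + n (l t) * 0); last by ring.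
apply: cvgD; apply: cvgM; [exact: ll| |exact: cvg_cst|exact: xx].
by apply: cvgD; [exact: xx|exact: cvg_cst].
Qed.

Lemma integrable_pairing (l : T -> L -> R^o) x :
  bochner_sq_integrable D (dual_space V) l -> bochner_sq_integrable D V x ->
  mu.-integrable D (EFin \o (fun t => l t (x t) : R)).
Proof.
move=> [ml il] [mx ix].
have ib : mu.-integrable D (EFin \o
   (fun t => nrm (dual_space V) (l t) ^+ 2 + nrm V (x t) ^+ 2)).
  exact: RintegrableD.
apply: (le_Rintegrable mD _ ib); first exact: bochner_measurable_pairing.
move=> t Dt; have [cl _] := ml; have [cx _] := mx.
apply: (le_trans (dual_le sV (cl _ Dt) (cx _ Dt))).
move: (nrm (dual_space V) (l t)) (nrm V (x t)) => a b.
have := sqr_ge0 (a - b); have := sqr_ge0 a; have := sqr_ge0 b; lra.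
Qed.

Lemma bochner_measurable_cst v : carrier V v -> bochner_measurable D V (fun=> v).
Proof.
move=> cv; split => //; exists (fun _ _ => v).
  move=> j; split => //; exists void, (fun=> set0), (fun=> v); split => // -[].
by move=> t _; rewrite subrr nrm0//; exact: cvg_cst.
Qed.

End one_space.

(** A Lipschitz map transports the approximants. *)
Lemma bochner_measurable_map (D : set T) (L1 L2 : lmodType R) (V1 : seminormed L1)
    (V2 : seminormed L2) (B : L1 -> L2) (K : R) x :
  (forall u, carrier V1 u -> carrier V2 (B u)) ->
  (forall u v, carrier V1 u -> carrier V1 v ->
     0 <= nrm V2 (B u - B v) <= K * nrm V1 (u - v)) ->
  bochner_measurable D V1 x -> bochner_measurable D V2 (B \o x).
Proof.
move=> cB nB [cx [x_ sx xx]]; split=> [t Dt|]; first by apply: cB; exact: cx.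
exists (fun j => B \o x_ j).
  move=> j; have [fx ccx] := sx j; split; first exact: finitely_based_comp.
  by move=> t; apply: cB.
move=> t Dt; apply: (@cvg_dist_le _ _ (fun j => K * nrm V1 (x_ j t - x t))).
  move=> j; have [_ ccx] := sx j.
  have /andP[h0 h1] := nB _ _ (ccx t) (cx _ Dt).
  by rewrite subr0 ger0_norm.
by rewrite -[X in _ --> X](mulr0 K); apply: cvgM; [exact: cvg_cst|exact: xx].
Qed.

End bochner.

Lemma simple_in_finitely_based (R : realType) (L : lmodType R) (V : seminormed L)
    (x : R -> L) : is_seminorm V -> simple_in V x ->
  finitely_based (x : measurableTypeR R -> L) /\ forall t, carrier V (x t).
Proof.
move=> sV [m [A [z [mA cz ->]]]]; split=> [|t]; last first.
  by apply: (carrier_sum sV) => // i _; apply: carrierZ.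
exists 'I_m, A, (fun b : {ffun 'I_m -> bool} => \sum_(i < m) ((b i)%:R : R) *: z i); split => // t.
by apply: eq_bigr => i _; rewrite ffunE indicE.
Qed.

(** * Smooth cutoff functions *)

Section smooth_step.
Variable R : realType.
Implicit Types (f g df : R -> R) (k n : nat) (t : R).

(** Differentiability to finite order, in the recursive form in which the sum,
    product and inverse rules are proved by induction on the order. *)
Fixpoint diff_class k f : Prop :=
  (forall t, derivable f t 1) /\
  if k is k'.+1 then diff_class k' (f^`()%classic) else True.

Definition smooth f := forall k, diff_class k f.

Lemma diff_class_derivable k f t : diff_class k f -> derivable f t 1.
Proof. by case: k => [|k] [h _]; exact: h. Qed.

Arguments diff_class_derivable [k f] t _.

Lemma diff_classW k f : diff_class k.+1 f -> diff_class k f.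
Proof.
elim: k f => [|k IH] f; first by case=> h _; split.
by case=> h hf; split => //; exact: IH.
Qed.

Lemma smooth_derivable f : smooth f -> forall t, derivable f t 1.
Proof. by move=> /(_ 0%N) [h _]. Qed.

Lemma smooth_derive1 f : smooth f -> smooth (f^`()%classic).
Proof. by move=> h k; case: (h k.+1). Qed.

Lemma smooth_derive1n f n t : smooth f -> derivable (derive1n n f) t 1.
Proof.
elim: n f => [|n IH] f sf; first exact: smooth_derivable.
by rewrite derive1Sn; apply: IH; exact: smooth_derive1.
Qed.

Lemma smooth_continuous f : smooth f -> continuous f.
Proof.
move=> sf x; apply: differentiable_continuous.
exact/derivable1_diffP/smooth_derivable.
Qed.

Lemma diff_class_step k f df : (forall t, is_derive t 1 f (df t)) ->
  diff_class k df -> diff_class k.+1 f.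
Proof.
move=> fdf h; split; first by move=> t; case: (fdf t).
rewrite (_ : f^`()%classic = df)//; apply/funext => t.
by rewrite derive1E; exact: derive_val.
Qed.

Lemma diff_class_is_derive k f t : diff_class k f -> is_derive t 1 f (f^`()%classic t).
Proof.
move=> h; apply: DeriveDef; first exact: diff_class_derivable h.
by rewrite derive1E.
Qed.

Arguments diff_class_is_derive [k f] t _.

Lemma diff_class_cst k c : diff_class k (fun=> c).
Proof.
elim: k c => [|k IH] c; first by split.
by apply: (@diff_class_step _ _ (fun=> 0)) => // t; exact: is_derive_cst.
Qed.

Lemma diff_classD k f g : diff_class k f -> diff_class k g ->
  diff_class k (fun x => f x + g x).
Proof.
elim: k f g => [|k IH] f g hf hg.
  by split => // t; exact: (derivableD (diff_class_derivable t hf) (diff_class_derivable t hg)).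
apply: (@diff_class_step _ _ (fun t => f^`()%classic t + g^`()%classic t)).
  by move=> t; exact: (is_deriveD (diff_class_is_derive t hf) (diff_class_is_derive t hg)).
by apply: IH; [case: hf|case: hg].
Qed.

Lemma diff_classM k f g : diff_class k f -> diff_class k g ->
  diff_class k (fun x => f x * g x).
Proof.
elim: k f g => [|k IH] f g hf hg.
  by split => // t; exact: (derivableM (diff_class_derivable t hf) (diff_class_derivable t hg)).
apply: (@diff_class_step _ _ (fun t => f t * g^`()%classic t + g t * f^`()%classic t)).
  by move=> t; exact: (is_deriveM (diff_class_is_derive t hf) (diff_class_is_derive t hg)).
apply: diff_classD; apply: IH; first exact: diff_classW.
- by case: hg.
- exact: diff_classW.
- by case: hf.
Qed.

Lemma diff_classV k f : (forall x, f x != 0) -> diff_class k f ->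
  diff_class k (fun x => (f x)^-1).
Proof.
move=> f0; elim: k => [|k IH] hf.
  by split => // t; exact: (derivableV (f0 t) (diff_class_derivable t hf)).
apply: (@diff_class_step _ _
  (fun t => -1 * ((f t)^-1 * (f t)^-1 * f^`()%classic t))).
  move=> t; apply: (is_derive_eq (is_deriveV (f0 t) (diff_class_is_derive t hf))).
  by rewrite -[LHS]/(_ * _) expr2 invfM; ring.
apply: diff_classM; first exact: diff_class_cst.
apply: diff_classM; last by case: hf.
by apply: diff_classM; apply: IH; exact: diff_classW.
Qed.

Lemma is_derive_affine (a b t : R) : is_derive t 1 (fun x : R => a * x + b) a.
Proof.
have -> : (fun x : R => a * x + b) = (a \*: id) \+ cst b by [].
by apply: is_derive_eq; rewrite addr0 -[RHS]mulr1.
Qed.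

Lemma diff_class_affine k f a b : diff_class k f ->
  diff_class k (fun x => f (a * x + b)).
Proof.
have aff t : is_derive t 1 (fun x : R => a * x + b) a by exact: is_derive_affine.
elim: k f => [|k IH] f hf.
  split => // t.
  by have [] := @is_derive1_comp _ f (fun x : R => a * x + b) t _ _ (diff_class_is_derive (a * t + b) hf) (aff t).
apply: (@diff_class_step k (fun x => f (a * x + b)) (fun t => f^`()%classic (a * t + b) * a)).
  by move=> t; exact: (@is_derive1_comp _ f (fun x : R => a * x + b) t _ _ (diff_class_is_derive (a * t + b) hf) (aff t)).
apply: diff_classM; last exact: diff_class_cst.
by apply: IH; case: hf.
Qed.

(** The family is closed under differentiation, up to linear combinations;
    the polynomial factor comes from differentiating 1/x. *)
Definition flat n (x : R) : R := if x <= 0 then 0 else x^-1 ^+ n * expR (- x^-1).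

Lemma flat_ge0 n x : 0 <= flat n x.
Proof.
rewrite /flat; case: ifPn => //; rewrite -ltNge => x0.
by rewrite mulr_ge0 ?expR_ge0// exprn_ge0// invr_ge0 ltW.
Qed.

Lemma flat_gt0 n x : 0 < x -> 0 < flat n x.
Proof.
by move=> x0; rewrite /flat leNgt x0 mulr_gt0 ?expR_gt0// exprn_gt0// invr_gt0.
Qed.

Lemma flat_le0 n x : x <= 0 -> flat n x = 0.
Proof. by rewrite /flat => ->. Qed.

Lemma flatE n x : 0 < x -> flat n x = x^-1 ^+ n * expR (- x^-1).
Proof. by move=> x0; rewrite /flat leNgt x0. Qed.

(** A quadratic bound at 0, which gives the derivative there. *)
Lemma flat_le n x : 0 < x -> flat n x <= n.+2`!%:R * x ^+ 2.
Proof.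
move=> x0; have y0 : 0 < x^-1 by rewrite invr_gt0.
rewrite flatE// expRN ler_pdivrMr ?expR_gt0//.
have K0 : 0 < (n.+2`!%:R : R) by rewrite ltr0n fact_gt0.
have h : x^-1 ^+ n.+2 <= n.+2`!%:R * expR x^-1.
  rewrite -ler_pdivrMl// mulrC.
  by apply: le_trans (expR_ge1Dxn n.+1 (ltW y0)); rewrite lerDr.
have -> : x^-1 ^+ n = x ^+ 2 * x^-1 ^+ n.+2.
  rewrite -[in RHS](addn2 n) exprD mulrCA -exprMn mulfV ?gt_eqF//.
  by rewrite expr1n mulr1.
by rewrite mulrC [leRHS]mulrAC ler_wpM2r// sqr_ge0.
Qed.

Lemma is_derive_flat n (x : R) :
  is_derive x 1 (flat n) (- n%:R * flat n.+1 x + flat n.+2 x).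
Proof.
have [x0|x0|->] := ltgtP x 0.
- rewrite !flat_le0 ?(ltW x0)// mulr0 addr0.
  apply: (@near_eq_is_derive _ _ _ (fun=> 0 : R) (flat n) x 1 0).
  near=> y; rewrite flat_le0//.
  by near: y; apply: lt_le_nbhsl.
- have xn0 : x != 0 by rewrite gt_eqF.
  apply: (@near_eq_is_derive _ _ _ (fun y : R => y^-1 ^+ n * expR (- y^-1)) (flat n)).
    near=> y; rewrite flatE//.
    by near: y; apply: lt_nbhsr.
  have dV : is_derive x 1 (fun y : R => y^-1) (- x ^- 2).
    by apply: (is_derive_eq (is_deriveV xn0 (is_derive_id x 1))); rewrite scaler1.
  have dE : is_derive x 1 (expR \o (fun y : R => - y^-1)) (expR (- x^-1) * x ^- 2).
    apply: (is_derive1_comp (is_derive_expR _)).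
    by apply: (is_derive_eq (is_deriveN dV)); rewrite opprK.
  have dX m : is_derive x 1 (fun y : R => y^-1 ^+ m) (- m%:R * x^-1 ^+ m.+1).
    elim: m => [|m IH]; first by rewrite mulr0n oppr0 mul0r; exact: is_derive_cst.
    have -> : (fun y : R => y^-1 ^+ m.+1) = (fun y => y^-1 * y^-1 ^+ m).
      by apply/funext => y; rewrite exprS.
    apply: (is_derive_eq (is_deriveM dV IH)).
    rewrite -[X in X + _]/(_ * _) -[X in _ + X]/(_ * _) -exprVn -[in RHS]natr1.
    by rewrite !exprS; ring.
  apply: (is_derive_eq (is_deriveM (dX n) dE)).
  rewrite -[X in X + _]/(_ * _) -[X in _ + X]/(_ * _) -exprVn !flatE// !exprS /= expr0.
  by ring.
- rewrite !flat_le0// mulr0 addr0.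
  pose K : R := n.+2`!%:R.
  have K0 : 0 < K by rewrite ltr0n fact_gt0.
  have H : (fun h : R => h^-1 *: ((flat n \o shift 0) (h *: 1) - flat n 0)) @ 0^' --> (0 : R).
    apply/cvgrPdist_le => e e0; near=> h.
    have hn0 : h != 0 by near: h; exact: nbhs_dnbhs_neq.
    rewrite sub0r normrN /= addr0 [flat n 0]flat_le0// subr0 -[h *: 1]/(h * 1) mulr1.
    rewrite -[_ *: _]/(_ * _) normrM normfV ler_pdivrMl ?normr_gt0//.
    have [h0|h0] := lerP h 0.
      by rewrite flat_le0// normr0 mulr_ge0// ltW.
    rewrite (ger0_norm (flat_ge0 _ _)) (gtr0_norm h0).
    apply: (le_trans (flat_le n h0)); rewrite expr2 mulrCA ler_wpM2l ?(ltW h0)//.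
    rewrite -ler_pdivlMl// -[h]gtr0_norm//.
    near: h; apply: dnbhs0_le; first by rewrite mulr_gt0 ?invr_gt0.
  by apply: DeriveDef; [apply/cvg_ex; exists 0|exact/cvg_lim].
Unshelve. all: by end_near. Qed.

Lemma smooth_flat n : smooth (flat n).
Proof.
move=> k; elim: k n => [|k IH] n.
  by split => // t; case: (is_derive_flat n t).
apply: (diff_class_step (is_derive_flat n)).
apply: diff_classD => //; apply: diff_classM => //; exact: diff_class_cst.
Qed.

(** The quotient f(x) / (f(x) + f(1 - x)) with f(x) = exp(-1/x). *)
Definition smooth_step (x : R) : R := flat 0 x / (flat 0 x + flat 0 (- 1 * x + 1)).

Let den_gt0 (x : R) : 0 < flat 0 x + flat 0 (- 1 * x + 1).
Proof.
have [x0|x0] := ltP 0 x; first by rewrite ltr_wpDr ?flat_ge0// flat_gt0.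
by rewrite ltr_wpDl ?flat_ge0// flat_gt0// mulN1r; lra.
Qed.

Lemma smooth_smooth_step : smooth smooth_step.
Proof.
move=> k; apply: diff_classM; first exact: smooth_flat.
apply: diff_classV; first by move=> x; rewrite gt_eqF.
apply: diff_classD; first exact: smooth_flat.
by apply: diff_class_affine; exact: smooth_flat.
Qed.

Lemma smooth_step_le0 (x : R) : x <= 0 -> smooth_step x = 0.
Proof. by move=> x0; rewrite /smooth_step flat_le0// mul0r. Qed.

Lemma smooth_step_ge1 (x : R) : 1 <= x -> smooth_step x = 1.
Proof.
move=> x1; rewrite /smooth_step [flat 0 (_ + _)]flat_le0; last by lra.
by rewrite addr0 divff// gt_eqF// flat_gt0//; lra.
Qed.

Lemma smooth_step_itv (x : R) : 0 <= smooth_step x <= 1.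
Proof.
apply/andP; split; first by rewrite divr_ge0 ?flat_ge0// ltW.
by rewrite ler_pdivrMr// mul1r lerDl flat_ge0.
Qed.

(** Monotonicity makes the derivatives of steep steps an approximate identity. *)
Lemma smooth_step_derive_ge0 (x : R) : 0 <= smooth_step^`()%classic x.
Proof.
have d1 := is_derive_flat 0 x.
have d2 : is_derive x 1 (fun x => flat 0 (- 1 * x + 1)) (- flat 2 (- 1 * x + 1)).
  have aff := is_derive_affine (- 1) 1 x.
  apply: (is_derive_eq (@is_derive1_comp _ (flat 0) _ x _ _ (is_derive_flat 0 _) aff)).
  by rewrite mulr0n oppr0 mul0r add0r mulrN1.
pose den (y : R) := flat 0 y + flat 0 (- 1 * y + 1).
have d3 : is_derive x 1 den _ := is_deriveD d1 d2.
have d : is_derive x 1 smooth_step _ :=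
  is_deriveM d1 (@is_deriveV _ den x _ 1 (lt0r_neq0 (den_gt0 x)) d3).
rewrite derive1E (@derive_val _ _ _ _ _ _ _ d).
rewrite /den; set a := flat 0 x; set b := flat 0 _; set a' := flat 2 x; set b' := flat 2 _.
rewrite mulr0n oppr0 mul0r add0r.
rewrite -[X in 0 <= X + _]/(_ * _) -[X in 0 <= _ + X]/(_ * _) -[X in a * X]/(_ * _).
have ab : a + b != 0 by exact: lt0r_neq0 (den_gt0 x).
have -> : a * (- (a + b) ^- 2 * (a' + - b')) + (a + b)^-1 * a' =
   (a' * b + a * b') * (a + b) ^- 2 by field.
by rewrite mulr_ge0 ?invr_ge0 ?sqr_ge0// addr_ge0// mulr_ge0 ?flat_ge0.
Qed.

Lemma smooth_step_derive0 (x : R) : x < 0 \/ 1 < x -> smooth_step^`()%classic x = 0.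
Proof.
move=> h; rewrite derive1E; case: h => h.
  rewrite (@near_eq_derive _ _ _ _ (cst 0)); first exact: derive_cst.
  by near=> y; rewrite smooth_step_le0//; near: y; exact: lt_le_nbhsl.
rewrite (@near_eq_derive _ _ _ _ (cst (1 : R))); first exact: derive_cst.
by near=> y; rewrite smooth_step_ge1// ltW//; near: y; exact: lt_nbhsr.
Unshelve. all: by end_near. Qed.

End smooth_step.

Section cutoff.
Variables (R : realType) (T a b N : R).
Hypotheses (a0 : 0 < a) (ab : a <= b) (N0 : 0 < N) (bT : b + N^-1 < T).

(** A smooth version of the indicator of ]a, b]. *)
Definition cutoff (t : R) : R :=
  smooth_step (N * t + - (N * a)) - smooth_step (N * t + - (N * b)).

Lemma cutoff_test : test_function T cutoff.
Proof.
split=> [k t|].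
  apply: smooth_derive1n => j; apply: diff_classD.
    by apply: diff_class_affine; exact: smooth_smooth_step.
  have -> : (fun x : R => - smooth_step (N * x + - (N * b))) =
     (fun x => - 1 * smooth_step (N * x + - (N * b))).
    by apply/funext => x; rewrite mulN1r.
  apply: diff_classM; first exact: diff_class_cst.
  by apply: diff_class_affine; exact: smooth_smooth_step.
exists a, (b + N^-1); split => // t; rewrite in_itv/= negb_and -!ltNge => /orP[ta|tb].
  rewrite /cutoff !smooth_step_le0 ?subrr//.
    by rewrite -mulrBr mulr_ge0_le0 ?subr_le0 ?(ltW N0)// (le_trans (ltW ta)).
  by rewrite -mulrBr mulr_ge0_le0 ?subr_le0 ?(ltW N0)// ltW.
have h : 1 <= N * t + - (N * b).
  by rewrite -mulrBr -ler_pdivrMl// mulr1 lerBrDl ltW.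
rewrite /cutoff !smooth_step_ge1 ?subrr//; apply: le_trans h _.
by rewrite lerD2l lerN2 ler_wpM2l// ltW.
Qed.

Lemma cutoff_abs_le1 (t : R) : `|cutoff t| <= 1.
Proof.
have := smooth_step_itv (N * t + - (N * a)).
have := smooth_step_itv (N * t + - (N * b)).
rewrite /cutoff ler_norml; move=> /andP[h1 h2] /andP[h3 h4].
by apply/andP; split; lra.
Qed.

Lemma is_derive_step (c t : R) : is_derive t 1 (fun t : R => smooth_step (N * t + - (N * c)))
  ((@smooth_step R)^`()%classic (N * t + - (N * c)) * N).
Proof.
have aff := is_derive_affine N (- (N * c)) t.
apply: (@is_derive1_comp _ (@smooth_step R) (fun x : R => N * x + - (N * c)) t _ _ _ aff).
exact: (diff_class_is_derive _ (@smooth_smooth_step R 0%N)).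
Qed.

Lemma cutoff_derive (t : R) : cutoff^`()%classic t =
  (@smooth_step R)^`()%classic (N * t + - (N * a)) * N -
  (@smooth_step R)^`()%classic (N * t + - (N * b)) * N.
Proof.
rewrite derive1E.
exact: (@derive_val _ _ _ _ _ _ _ (is_deriveB (is_derive_step a t) (is_derive_step b t))).
Qed.

End cutoff.

(** * Weak derivatives on an interval *)

Lemma lebesgue_measure_endpoints (R : realType) (a b : R) :
  @lebesgue_measure R (`[a, b] `\` `]a, b[) = 0%E.
Proof.
apply: (@subset_measure0 _ _ _ (@lebesgue_measure R) _ ([set a] `|` [set b])).
- exact: measurableD.
- exact: measurableU.
- move=> x /= [] /[!in_itv]/= /andP[ax xb] /negP; rewrite negb_and -!leNgt => /orP[xa|bx].
    by left; apply/eqP; rewrite eq_le ax xa.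
  by right; apply/eqP; rewrite eq_le bx xb.
- by apply: null_set_setU => //; exact: lebesgue_measure_set1.
Qed.

Section weak_derivative_in_time.
Variable R : realType.
Local Notation leb := (@lebesgue_measure R).
Variables (T : R) (D : set (measurableTypeR R)).
Hypotheses (T0 : 0 < T) (mD : measurable D) (DT : D `<=` `]0, T[)
  (D0 : leb (`]0, T[ `\` D) = 0%E).

(* the slope of the cutoffs: it tends to infinity, and is already so large for
   k = 0 that the step at b is complete before T *)
Let N (b : R) (k : nat) : R := 2 / (T - b) + k%:R.

Let N_gt0 b k : b < T -> 0 < N b k.
Proof. by move=> bT; rewrite ltr_pwDl// divr_gt0// subr_gt0. Qed.

Let N_lt b k : b < T -> b + (N b k)^-1 < T.
Proof.
move=> bT; have d0 : 0 < T - b by rewrite subr_gt0.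
rewrite -ltrBrDl -[ltRHS]invrK ltf_pV2 ?posrE ?invr_gt0 ?N_gt0//.
apply: (@lt_le_trans _ _ (2 / (T - b))); last by rewrite lerDl.
by rewrite ltr_pMl ?invr_gt0// ltr1n.
Qed.

Let phi a b k := cutoff a b (N b k).

Let phi_test a b k : 0 < a -> a <= b -> b < T -> test_function T (phi a b k).
Proof. by move=> a0 ab bT; apply: cutoff_test => //; [exact: N_gt0|exact: N_lt]. Qed.

Let step_cvg (b c t : R) : c < t -> b < T ->
  \forall k \near \oo, smooth_step (N b k * t + - (N b k * c)) = 1.
Proof.
move=> ct bT; near=> k; rewrite smooth_step_ge1//.
rewrite -mulrBr -ler_pdivrMr ?subr_gt0// mul1r /N.
have d0 : 0 <= 2 / (T - b) by rewrite divr_ge0// ltW// subr_gt0.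
apply: (@le_trans _ _ k%:R); last by rewrite lerDr.
by near: k; apply: nbhs_infty_ger.
Unshelve. all: by end_near. Qed.

Let step0 b c t k : t <= c -> b < T ->
  smooth_step (N b k * t + - (N b k * c)) = 0.
Proof.
move=> tc bT; rewrite smooth_step_le0// -mulrBr mulr_ge0_le0 ?subr_le0//.
by rewrite ltW// N_gt0.
Qed.

Let phi_cvg (a b t : R) : a <= b -> b < T ->
  phi a b k t @[k --> \oo] --> (\1_(`]a, b]) t : R).
Proof.
move=> ab bT; apply: cvg_near_cst; rewrite /phi /cutoff indicE mem_setE in_itv/=.
have [ta|at_] := leP t a.
  by apply: nearW => k; rewrite !step0 ?subrr// (le_trans ta).
have h := step_cvg at_ bT.
have [tb|bt] := leP t b.
  by move: h; apply: filterS => k ->; rewrite step0// subr0.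
have h2 := step_cvg bt bT.
by move: h h2; apply: filterS2 => k -> ->; rewrite subrr.
Qed.

Let mphi a b k : 0 < a -> a <= b -> b < T -> measurable_fun D (phi a b k).
Proof.
move=> a0 ab bT; have [h _] := phi_test k a0 ab bT.
apply: measurable_funTS; apply: continuous_measurable_fun => x.
exact/differentiable_continuous/derivable1_diffP/(h 0%N).
Qed.

Let integral_phi_cvg (g : R -> R) (a b : R) : 0 < a -> a <= b -> b < T ->
  leb.-integrable D (EFin \o g) ->
  \int[leb]_(t in D) (g t * phi a b k t) @[k --> \oo] -->
  \int[leb]_(t in D) (g t * \1_(`]a, b]) t).
Proof.
move=> a0 ab bT ig.
apply: (Rdominated_cvg (mu := leb) mD (b := fun t => `|g t|)).
- move=> k; apply: measurable_funM; last exact: mphi.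
  exact: Rintegrable_measurable ig.
- by move=> t Dt; apply: cvgM; [exact: cvg_cst|exact: phi_cvg].
- exact: integrable_norm.
- by move=> k t Dt; rewrite normrM ler_piMr// cutoff_abs_le1.
Qed.

(** The cutoffs converge to the indicators of intervals, so that the integrals of
    g over all intervals vanish; then so does g, by Lebesgue differentiation. *)
Lemma test_function_eq0_ae (g : R -> R) : leb.-integrable D (EFin \o g) ->
  (forall psi, test_function T psi -> \int[leb]_(t in D) (g t * psi t) = 0) ->
  {ae leb, forall t, D t -> g t = 0}.
Proof.
move=> ig g0.
pose f : R -> R := g \_ D.
have if_ : leb.-integrable setT (EFin \o f).
  by rewrite /f -restrict_EFin; apply/integrable_restrict => //; rewrite setTI.
have int0 a b : 0 < a -> a <= b -> b < T -> \int[leb]_(t in `]a, b]) f t = 0.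
  move=> a0 ab bT.
  have := integral_phi_cvg a0 ab bT ig.
  have -> : (fun k => \int[leb]_(t in D) (g t * phi a b k t)) = (fun=> 0).
    by apply/funext => k; apply: g0; exact: phi_test.
  move=> c; rewrite -[RHS](cvg_unique (@Rhausdorff R) c (cvg_cst _)).
  rewrite [LHS]Rintegral_mkcond [RHS]Rintegral_mkcond; apply: eq_Rintegral => t _.
  rewrite /f /patch indicE.
  by case: (t \in D); case: (t \in `]a, b]%classic); rewrite /= ?mulr1 ?mulr0.
have inty y : leb.-integrable `]-oo, y] (EFin \o f) by exact: integrableS if_.
have loc : locally_integrable setT f by apply: open_integrable_locally => //; exact: openT.
pose F x := \int[leb]_(t in `]-oo, x]) f t.
have Fcst x y : x \in `]0, T[ -> y \in `]0, T[ -> F x = F y.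
  wlog xy : x y / x <= y => [h xT yT|].
    by have [xy|/ltW yx] := leP x y; [exact: h|apply/esym; exact: h].
  rewrite !in_itv/= => /andP[x0 _] /andP[_ yT].
  apply/eqP; rewrite eq_sym -subr_eq0 /F (@Rintegral_itvB _ _ _ (BRight y)) ?bnd_simp//.
  by rewrite int0.
have := FTC1Ny inty loc.
apply: filterS; first exact: (ae_filter_ringOfSetsType leb).
move=> x [_ dF] Dx.
have xT : x \in `]0, T[ by have := DT Dx.
have <- : f x = g x by rewrite /f patchE mem_set.
rewrite -dF derive1E (@near_eq_derive _ _ _ _ (cst (F x))); first exact: derive_cst.
near=> y; apply: Fcst => //; near: y.
by have := near_in_itvoo xT; apply: filterS => y.
Unshelve. all: by end_near. Qed.

Let rho b c k (t : R) : R :=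
  (@smooth_step R)^`()%classic (N b k * t + - (N b k * c)) * N b k.

Let rho_ge0 b c k t : b < T -> 0 <= rho b c k t.
Proof. by move=> bT; rewrite mulr_ge0 ?smooth_step_derive_ge0// ltW// N_gt0. Qed.

Let rho_eq0 b c k t : b < T -> t < c \/ c + (N b k)^-1 < t -> rho b c k t = 0.
Proof.
move=> bT h; have N0 := N_gt0 k bT; rewrite /rho smooth_step_derive0 ?mul0r//.
rewrite -mulrBr; case: h => h; [left|right].
  by rewrite pmulr_rlt0// subr_lt0.
by rewrite -ltr_pdivrMl// mulr1 ltrBrDl.
Qed.

Let rho_continuous b c k : continuous (rho b c k).
Proof.
apply: smooth_continuous => j; apply: diff_classM; last exact: diff_class_cst.
exact/diff_class_affine/smooth_derive1/smooth_smooth_step.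
Qed.

Let integral_rho b c k : 0 < c -> c <= b -> b < T ->
  \int[leb]_(t in `[0, T]) rho b c k t = 1.
Proof.
move=> c0 cb bT; have N0 := N_gt0 k bT.
pose S t := smooth_step (N b k * t + - (N b k * c)).
have dS (t : R) : is_derive t 1 S (rho b c k t) := is_derive_step _ _ _.
have cS : continuous S.
  by move=> t; apply/differentiable_continuous/derivable1_diffP; case: (dS t).
rewrite /Rintegral (@continuous_FTC2 _ _ S)//.
- rewrite /S smooth_step_ge1 ?smooth_step_le0 ?sube0//.
    by rewrite mulr0 add0r oppr_le0 mulr_ge0 ?ltW// (lt_le_trans c0).
  rewrite -mulrBr -ler_pdivrMl// mulr1 lerBrDl ltW//.
  by rewrite (le_lt_trans _ (N_lt k bT))// lerD2r.
- by apply: continuous_subspaceT => t; exact: rho_continuous.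
- split; first by move=> t _; case: (dS t).
  + exact/cvg_at_right_filter/cS.
  + exact/cvg_at_left_filter/cS.
- by move=> t _; rewrite derive1E; exact: derive_val.
Qed.

Let within_continuous_integrable (f : R -> R) : {within `[0, T], continuous f} ->
  leb.-integrable `[0, T] (EFin \o f).
Proof. by apply: continuous_compact_integrable; exact: segment_compact. Qed.

(* the derivatives of the steps are an approximate identity *)
Let rho_cvg (m : R -> R) b c : {within `[0, T], continuous m} ->
  0 < c -> c <= b -> b < T ->
  \int[leb]_(t in `[0, T]) (m t * rho b c k t) @[k --> \oo] --> m c.
Proof.
move=> cm c0 cb bT; apply/cvgrPdist_le => e e0.
have cT : `[0, T]%classic c by rewrite /= in_itv/= !ltW// (le_lt_trans cb).
have /subspace_continuousP/(_ _ cT)/cvgrPdist_le/(_ _ e0) := cm.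
rewrite near_withinE => /nbhs_ballP[r /= r0 hr].
near=> k; have N0 := N_gt0 k bT.
have Nr : (N b k)^-1 < r.
  rewrite invf_plt ?posrE//; apply: (@lt_le_trans _ _ k%:R).
    by near: k; exact: nbhs_infty_gtr.
  by rewrite /N lerDr divr_ge0// ltW// subr_gt0.
have irho : leb.-integrable `[0, T] (EFin \o rho b c k).
  by apply: within_continuous_integrable; apply: continuous_subspaceT => t; exact: rho_continuous.
have imrho : leb.-integrable `[0, T] (EFin \o (fun t => m t * rho b c k t)).
  apply: within_continuous_integrable => t; apply: cvgM; first exact: cm.
  by apply: continuous_subspaceT => x; exact: rho_continuous.
have icrho : leb.-integrable `[0, T] (EFin \o (fun t => m c * rho b c k t)).
  exact: (RintegrableZ (mu := leb)).
have -> : m c = \int[leb]_(t in `[0, T]) (m c * rho b c k t).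
  by rewrite RintegralZl// integral_rho// mulr1.
rewrite -RintegralB//.
have ibrho : leb.-integrable `[0, T] (EFin \o (fun t => m c * rho b c k t - m t * rho b c k t)).
  exact: (RintegrableB (mu := leb)).
apply: le_trans (le_normr_Rintegral _ ibrho) _ => //.
have -> : e = \int[leb]_(t in `[0, T]) (e * rho b c k t).
  by rewrite RintegralZl// integral_rho// mulr1.
apply: le_Rintegral => //.
- exact: integrable_norm.
- exact: (RintegrableZ (mu := leb)).
- move=> t tT; rewrite -mulrBl normrM (ger0_norm (rho_ge0 _ _ _ bT)).
  have [tc|ct] := ltP t c; first by rewrite rho_eq0 ?mulr0//; left.
  have [tc|tc] := ltP (c + (N b k)^-1) t; first by rewrite rho_eq0 ?mulr0//; right.
  rewrite ler_wpM2r ?rho_ge0//; apply: hr => //.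
  rewrite /ball /= distrC ger0_norm ?subr_ge0//.
  by rewrite ltrBlDl (le_lt_trans tc)// ltrD2l.
Unshelve. all: by end_near. Qed.

(** With the cutoffs for test functions, the left-hand side of the weak equation
    averages m over shrinking neighbourhoods of a and b. *)
Lemma weak_derivative_increment (m g : R -> R) (a b : R) :
  {within `[0, T], continuous m} -> leb.-integrable D (EFin \o g) ->
  (forall psi, test_function T psi ->
    \int[leb]_(t in `]0, T[) (m t * derive1 psi t) =
    - \int[leb]_(t in `]0, T[) (g t * psi t)) ->
  0 < a -> a <= b -> b < T ->
  m b - m a = \int[leb]_(t in D) (g t * \1_(`]a, b]) t).
Proof.
move=> cm ig mg a0 ab bT; have b0 := lt_le_trans a0 ab.
have ha := rho_cvg cm a0 ab bT.
have hb := rho_cvg cm b0 (lexx b) bT.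
have hg := integral_phi_cvg a0 ab bT ig.
apply: (cvg_unique (@Rhausdorff R) _ hg).
have -> : (fun k => \int[leb]_(t in D) (g t * phi a b k t)) =
  (fun k => \int[leb]_(t in `[0, T]) (m t * rho b b k t) -
            \int[leb]_(t in `[0, T]) (m t * rho b a k t)).
  apply/funext => k.
  have im c : leb.-integrable `[0, T] (EFin \o (fun t => m t * rho b c k t)).
    apply: within_continuous_integrable => t; apply: cvgM; first exact: cm.
    by apply: continuous_subspaceT => x; exact: rho_continuous.
  rewrite -(Rintegral_conull (mu := leb) mD _ _ DT D0)//.
  apply: oppr_inj; rewrite -mg; last exact: phi_test.
  have -> : \int[leb]_(t in `]0, T[) (m t * (phi a b k)^`()%classic t) =
      \int[leb]_(t in `[0, T]) (m t * (phi a b k)^`()%classic t).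
    apply/esym/(Rintegral_conull (mu := leb)) => //; first exact: subset_itv_oo_cc.
    exact: lebesgue_measure_endpoints.
  rewrite opprB -RintegralB//; apply/eq_Rintegral => t _.
  by rewrite cutoff_derive// mulrBr.
exact: cvgB.
Qed.

End weak_derivative_in_time.

(** * Approximation of Bochner square integrable functions *)

Section scalar_times_vector.
Context d (T : measurableType d) (R : realType).
Variables (D : set T) (mD : measurable D).
Variables (L : lmodType R) (V : seminormed L).
Hypothesis sV : is_seminorm V.
Import HBSimple.

Lemma sfun_sum (f : {sfun T >-> R}) : exists (m : nat) (A : 'I_m -> set T) (c : 'I_m -> R),
  (forall i, measurable (A i)) /\ forall t, f t = \sum_(i < m) \1_(A i) t * c i.
Proof.
pose r : seq R := finmap.enum_fset (fset_set (range f)).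
exists (size r), (fun i => f @^-1` [set nth 0 r i]), (fun i => nth 0 r i); split=> [i|t].
  by rewrite -[X in measurable X]setTI; exact: measurable_funP.
rewrite fimfunE fsbig_finite//= (big_nth 0) big_mkord.
by apply: eq_bigr => i _; rewrite mulrC.
Qed.

Lemma measurable_sfun_approx (phi : T -> R) : measurable_fun D phi ->
  exists (m : nat -> nat) (A : forall j, 'I_(m j) -> set T) (c : forall j, 'I_(m j) -> R),
  (forall j i, measurable (A j i)) /\
  forall t, D t -> \sum_(i < m j) \1_(A j i) t * c j i @[j --> \oo] --> phi t.
Proof.
move=> /measurable_EFinP mphi.
have [g hg] := approximation_sfun mD mphi.
have H j : {M : {m : nat & (('I_m -> set T) * ('I_m -> R))%type} |
   (forall i, measurable ((projT2 M).1 i)) /\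
   forall t, g j t = \sum_(i < projT1 M) \1_((projT2 M).1 i) t * (projT2 M).2 i}.
  apply: cid; have [m [A [c h]]] := sfun_sum (g j).
  by exists (existT _ m (A, c)).
exists (fun j => projT1 (sval (H j))), (fun j => (projT2 (sval (H j))).1),
  (fun j => (projT2 (sval (H j))).2); split=> [j|t Dt].
  by case: (svalP (H j)).
have h j : \sum_(i < projT1 (sval (H j))) \1_((projT2 (sval (H j))).1 i) t *
     (projT2 (sval (H j))).2 i = g j t by case: (svalP (H j)) => _ ->.
under eq_fun do rewrite h.
by have /fine_cvgP[_] := hg t Dt.
Qed.

Lemma bochner_measurable_scale (phi : T -> R) z : measurable_fun D phi -> carrier V z ->
  bochner_measurable D V (fun t => phi t *: z).
Proof.
move=> mphi cz; split=> [t _|]; first exact: carrierZ.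
have [m [A [c [mA Ac]]]] := measurable_sfun_approx mphi.
exists (fun j t => (\sum_(i < m j) \1_(A j i) t * c j i) *: z).
  move=> j; split=> [|t]; last exact: carrierZ.
  exists 'I_(m j), (A j), (fun b : {ffun 'I_(m j) -> bool} =>
    (\sum_(i < m j) (b i)%:R * c j i) *: z); split => // t.
  by congr (_ *: _); apply: eq_bigr => i _; rewrite ffunE indicE.
move=> t Dt; under eq_fun do rewrite -scalerBl nrmZ//.
have h : \sum_(i < m j) \1_(A j i) t * c j i - phi t @[j --> \oo] --> phi t - phi t.
  by apply: cvgB; [exact: Ac|exact: cvg_cst].
have := cvgM (cvg_norm h) (cvg_cst (nrm V z)).
by rewrite [X in `|X| * _]subrr normr0 mul0r; apply.
Qed.

Lemma bochner_measurable_sum (I : Type) (r : seq I) (x : I -> T -> L) :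
  (forall i, bochner_measurable D V (x i)) ->
  bochner_measurable D V (fun t => \sum_(i <- r) x i t).
Proof.
move=> hx; elim: r => [|i r IH].
  under eq_fun do rewrite big_nil; exact: bochner_measurable_cst (carrier0 sV).
under eq_fun do rewrite big_cons -[x i _]scale1r.
exact: bochner_measurable_lin.
Qed.

End scalar_times_vector.

Section bochner_density.
Context d (T : measurableType d) (R : realType).
Variable mu : {measure set T -> \bar R}.
Variables (D : set T) (mD : measurable D).
Variables (L : lmodType R) (V : seminormed L).
Hypothesis sV : is_seminorm V.

(** The approximants are set to 0 where their norm exceeds twice that of x; this
    does not spoil convergence, and makes them dominated by x. *)
Lemma bochner_sq_integrable_approx (x : T -> L) : bochner_sq_integrable mu D V x ->
  exists2 s : nat -> T -> L,
    forall j, finitely_based (s j) /\ forall t, carrier V (s j t) &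
    (forall j, mu.-integrable D (EFin \o (fun t => nrm V (s j t - x t) ^+ 2))) /\
    \int[mu]_(t in D) (nrm V (s j t - x t) ^+ 2) @[j --> \oo] --> (0 : R).
Proof.
move=> [mx ix]; have [cx [x_ sx xx]] := mx.
have mnx := bochner_measurable_nrm sV mx.
pose B j := D `&` [set t | nrm V (x_ j t) <= 2 * nrm V (x t)].
have mB j : measurable (B j).
  rewrite /B (_ : [set t | _] = (fun t => nrm V (x_ j t) <= 2 * nrm V (x t)) @^-1` [set true])//.
  apply: measurable_fun_ler => //.
    by apply: measurable_finitely_based; apply: finitely_based_comp; case: (sx j).
  by apply: measurable_funM => //; exact: measurable_cst.
pose s j t := if t \in B j then x_ j t else 0.
have fs j : finitely_based (s j) by apply: finitely_based_if => //; case: (sx j).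
have cs j t : carrier V (s j t).
  by rewrite /s; case: ifP => _; [case: (sx j)|exact: carrier0].
have sle j t : D t -> nrm V (s j t) <= 2 * nrm V (x t).
  move=> Dt; rewrite /s; case: ifPn; first by rewrite inE => -[].
  by rewrite nrm0// mulr_ge0// nrm_ge0//; exact: cx.
have ms j : bochner_measurable D V (fun t => - 1 *: x t + s j t).
  apply: bochner_measurable_lin => //; split => //; exists (fun=> s j) => //.
  by move=> t _; rewrite subrr nrm0//; exact: cvg_cst.
have E j t : - 1 *: x t + s j t = s j t - x t by rewrite scaleN1r addrC.
have mns j : measurable_fun D (fun t => nrm V (s j t - x t) ^+ 2).
  apply: measurable_funX; have := bochner_measurable_nrm sV (ms j).
  by under eq_fun do rewrite E.
have dom j t : D t -> `|nrm V (s j t - x t) ^+ 2| <= 9 * nrm V (x t) ^+ 2.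
  move=> Dt; have cxt := cx _ Dt.
  rewrite ger0_norm ?sqr_ge0// (_ : 9 * _ = (3 * nrm V (x t)) ^+ 2); last by rewrite exprMn; congr (_ * _); ring.
  have h0 := nrm_ge0 sV cxt.
  rewrite ler_sqr ?nnegrE ?mulr_ge0//; last by apply: nrm_ge0 => //; exact: carrierB.
  rewrite (le_trans (nrmB sV (cs j t) cxt))//.
  by have := sle j _ Dt; lra.
have i9 : mu.-integrable D (EFin \o (fun t => 9 * nrm V (x t) ^+ 2)) by exact: RintegrableZ.
exists s => //; split; first by move=> j; exact: (le_Rintegrable mD (mns j) i9 (dom j)).
have -> : (0 : R) = \int[mu]_(t in D) (cst 0 t).
  by rewrite Rintegral_cst// mul0r.
apply: (Rdominated_cvg mD mns _ i9 dom) => t Dt /=; have cxt := cx _ Dt.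
have : 0 <= nrm V (x t) by exact: nrm_ge0.
rewrite le_eqVlt => /predU1P[x0|x0].
  apply: cvg_near_cst; apply: nearW => j.
  have h := sle j _ Dt; rewrite -x0 mulr0 in h.
  have h2 := nrmB sV (cs j t) cxt; have h3 := nrm_ge0 sV (carrierB sV (cs j t) cxt).
  rewrite -x0 addr0 in h2.
  have -> : nrm V (s j t - x t) = 0 by apply/eqP; rewrite eq_le h3 (le_trans h2).
  by rewrite expr0n.
have h := xx _ Dt.
have hs : nrm V (s j t - x t) @[j --> \oo] --> (0 : R).
  apply: (cvg_trans _ (xx _ Dt)); apply: near_eq_cvg.
  have /cvgrPdist_le/(_ _ x0) := h; apply: filterS => j.
  rewrite sub0r normrN ger0_norm; last first.
    by apply: nrm_ge0 => //; apply: carrierB => //; case: (sx j).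
  move=> hj; rewrite /s mem_set//; split => //=.
  have cxj : carrier V (x_ j t) by case: (sx j).
  have := nrm_dist sV cxj cxt; rewrite ler_norml => /andP[_ h1]; lra.
rewrite -(mulr0 (0 : R)); under eq_fun do rewrite expr2.
exact: cvgM.
Qed.

End bochner_density.

Section continuous_approximation.
Variable R : realType.
Local Notation leb := (@lebesgue_measure R).

Lemma clamp_dist (b y : R) : b = 0 \/ b = 1 ->
  `|b - Num.max 0 (Num.min y 1)| <= `|b - y|.
Proof.
have h1 := ler_norm (b - y); have h2 := ler_norm (y - b).
rewrite distrC in h2; move: h1 h2; set z := `|b - y|.
move=> h1 h2 hb; rewrite ler_norml; case: hb h1 h2 => -> h1 h2;
  case: (leP y 1) => h3; [case: (leP 0 y) => h4|case: (leP 0 1) => h4|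
  case: (leP 0 y) => h4|case: (leP 0 1) => h4]; apply/andP; split; lra.
Qed.

Lemma indicator_continuous_approx (D B : set (measurableTypeR R)) (eps : R) :
  measurable D -> measurable B -> (leb D < +oo)%E -> 0 < eps ->
  exists phi : R -> R, [/\ continuous phi, forall t, 0 <= phi t <= 1 &
    \int[leb]_(t in D) `|\1_B t - phi t| <= eps].
Proof.
move=> mD mB Dfin e0.
have iB : leb.-integrable D (EFin \o (\1_B : R -> R)).
  apply: (@Rintegrable_bounded _ _ _ leb _ mD _ 1) => //.
  by move=> t _; rewrite indicE ger0_norm// lern1 leq_b1.
have [g [cg ig gB]] := approximation_continuous_integrable mD Dfin iB.
have [k hk] : exists k, (\int[leb]_(t in D) `|\1_B t - g k t|%:E <= eps%:E)%E.
  have /fine_cvgP[fin /cvgrPdist_le/(_ _ e0) h] := gB.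
  have [k _ /(_ k (leqnn k))[f1 f2]] := filterI fin h.
  exists k; rewrite -(fineK f1) lee_fin; move: f2.
  by rewrite sub0r normrN; apply: le_trans; exact: ler_norm.
pose phi (t : R) : R := Num.max 0 (Num.min (g k t) 1).
have cphi : continuous phi.
  move=> t; apply: (@continuous_max _ _ (cst 0) (g k \min cst 1) t); first exact: cvg_cst.
  by apply: (@continuous_min _ _ (g k) (cst 1) t); [exact: cg|exact: cvg_cst].
have phi01 t : 0 <= phi t <= 1.
  by rewrite le_max lexx/= ge_max ler01 ge_min lexx orbT.
exists phi; split => //.
have iphi : leb.-integrable D (EFin \o phi).
  apply: (@Rintegrable_bounded _ _ _ leb _ mD _ 1) => //.
    by apply: measurable_funTS; exact: continuous_measurable_fun.
  by move=> t _; have /andP[h1 h2] := phi01 t; rewrite ger0_norm.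
have id : leb.-integrable D (EFin \o (fun t => `|\1_B t - phi t|)).
  by apply: integrable_norm; exact: (RintegrableB (mu := leb)).
rewrite -lee_fin Rintegral_EFin//; apply: le_trans hk.
apply: ge0_le_integral_any => // t _; rewrite lee_fin.
have : (\1_B t : R) = 0 \/ (\1_B t : R) = 1.
  by rewrite indicE; case: (t \in B); [right|left].
exact: clamp_dist.
Qed.

Lemma continuous_itv_uniform (T e : R) (f : R -> R) : continuous f -> 0 < e ->
  \forall del \near 0^'+, forall x y, x \in `[0, T] -> `|x - y| <= del ->
    `|f x - f y| <= e.
Proof.
move=> cf e0.
have /compact_near_coveringP cT := @segment_compact R 0 T.
pose P (del x : R) := forall y, `|x - y| <= del -> `|f x - f y| <= e.
have H : \forall del \near 0^'+, `[0, T]%classic `<=` P del.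
  apply: cT => x _.
  have /cvgrPdist_le/(_ (e / 2)) := cf x; rewrite divr_gt0// => /(_ isT).
  move=> /nbhs_ballP[r /= r0 hr].
  have r2 : 0 < r / 2 by rewrite divr_gt0.
  near=> x' del => y /= hy.
  have h1 : ball x (r / 2) x' by near: x'; apply: nbhsx_ballx.
  rewrite /ball /= in h1.
  have h2 : del < r / 2 by near: del; exact: nbhs_right_lt.
  have hx' : `|f x - f x'| <= e / 2 by apply: hr; rewrite /ball/=; lra.
  have hy' : `|f x - f y| <= e / 2.
    by apply: hr; rewrite /ball/= (le_lt_trans (ler_distD x' _ _))//; lra.
  by rewrite (le_trans (ler_distD (f x) _ _))// [e]splitr lerD// distrC.
by apply: filterS H => del h x y xT; exact: h.
Unshelve. all: by end_near. Qed.

End continuous_approximation.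

Section continuous_bochner_approximation.
Variable R : realType.
Local Notation leb := (@lebesgue_measure R).
Variables (D : set (measurableTypeR R)) (mD : measurable D) (Dfin : (leb D < +oo)%E).
Variables (L : lmodType R) (V : seminormed L).
Hypothesis sV : is_seminorm V.

(** The indicators in a simple approximation s of x are replaced by continuous
    functions with values in [0, 1]. The resulting error is small in L1 and
    bounded by C, hence small in L2. *)
Lemma bochner_continuous_approx (x : R -> L) (eps : R) :
  bochner_sq_integrable leb D V x -> 0 < eps ->
  exists (I : finType) (phi : I -> R -> R) (z : I -> L),
    [/\ forall i, continuous (phi i), forall i, carrier V (z i),
        leb.-integrable D (EFin \o (fun t => nrm V (x t - \sum_i phi i t *: z i) ^+ 2)) &
        \int[leb]_(t in D) (nrm V (x t - \sum_i phi i t *: z i) ^+ 2) <= eps].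
Proof.
move=> bx e0; have [[cx mx] ix] := bx.
have [s_ fs_ [is_ /cvgrPdist_le/(_ (eps / 4))]] := bochner_sq_integrable_approx mD sV bx.
rewrite divr_gt0// => /(_ isT)[k _ /(_ k (leqnn k))].
rewrite sub0r normrN => /(le_trans (ler_norm _)).
have := is_ k; have [fs cs] := fs_ k; move: (s_ k) fs cs => {s_ fs_ is_ k} s fs cs ixs hxs.
have [I [A [g [mA sE]]]] := fs.
pose B (b : {ffun I -> bool}) : set (measurableTypeR R) := [set t | [ffun i => t \in A i] = b].
have mB b : measurable (B b) by exact: measurable_atom.
(* the value on an empty atom is arbitrary and may lie outside of the carrier *)
pose z b := if `[< exists t, B b t >] then g b else 0.
have cz b : carrier V (z b).
  rewrite /z; case: asboolP => [[t Bt]|_]; last exact: carrier0.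
  by rewrite -Bt -sE; exact: cs.
have sB t : s t = \sum_b (\1_(B b) t : R) *: z b.
  rewrite (bigD1 [ffun i => t \in A i])//= big1 ?addr0; last first.
    move=> b /eqP hb; rewrite indicE memNset ?scale0r//.
    by move=> h; apply: hb.
  rewrite indicE mem_set// scale1r /z asboolT; [exact: sE|by exists t].
pose C := \sum_b nrm V (z b).
have C0 : 0 <= C by apply: sumr_ge0 => b _; exact: nrm_ge0.
pose del := eps / (4 * (C ^+ 2 + 1)).
have del0 : 0 < del by rewrite divr_gt0// mulr_gt0// ltr_wpDl// sqr_ge0.
have /choice[phi hphi] : forall b, exists phi : R -> R, [/\ continuous phi,
    forall t, 0 <= phi t <= 1 & \int[leb]_(t in D) `|\1_(B b) t - phi t| <= del].
  by move=> b; exact: indicator_continuous_approx.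
have cphi b : continuous (phi b) by case: (hphi b).
exists {ffun I -> bool}, phi, z.
pose w t := \sum_b phi b t *: z b.
have cw t : carrier V (w t) by apply: (carrier_sum sV) => b _; exact: carrierZ.
have mphi b (E : set (measurableTypeR R)) : measurable_fun E (phi b).
  by apply: measurable_funTS; exact: continuous_measurable_fun.
have mw : bochner_measurable D V w.
  by apply: bochner_measurable_sum => // b; exact: bochner_measurable_scale.
pose a b t : R := `|\1_(B b) t - phi b t|.
have a01 b t : 0 <= a b t <= 1.
  rewrite /a normr_ge0/=; have [_ /(_ t)/andP[h1 h2] _] := hphi b.
  by rewrite indicE; case: (t \in B b); rewrite ler_norml; apply/andP; split => /=; lra.
have ia b : leb.-integrable D (EFin \o a b).
  apply: (@Rintegrable_bounded _ _ _ leb _ mD _ 1) => //; last first.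
    by move=> t _; have /andP[h1 h2] := a01 b t; rewrite ger0_norm.
  by apply: measurableT_comp => //; apply: measurable_funB => //.
pose Asum t := \sum_b nrm V (z b) * a b t.
have iA : leb.-integrable D (EFin \o Asum).
  by apply: (Rintegrable_sum (mu := leb) mD) => b; exact: (RintegrableZ (mu := leb)).
have sw t : nrm V (s t - w t) <= Asum t.
  rewrite sB /w -sumrB; under eq_bigr do rewrite -scalerBl.
  apply: (le_trans (nrm_sum sV _ _)) => [b _|]; first exact: carrierZ.
  by apply: ler_sum => b _; rewrite nrmZ// mulrC.
have Age0 t : 0 <= Asum t.
  by apply: sumr_ge0 => b _; rewrite mulr_ge0 ?nrm_ge0//; case/andP: (a01 b t).
have AC t : Asum t <= C.
  by apply: ler_sum => b _; rewrite ler_piMr ?nrm_ge0//; case/andP: (a01 b t).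
have bound t : D t -> nrm V (x t - w t) ^+ 2 <=
    2 * nrm V (s t - x t) ^+ 2 + 2 * (C * Asum t).
  move=> Dt; have cxt := cx _ Dt; have cst := cs t; have cwt := cw t.
  have := nrmB_sq sV (carrierB sV cst cwt) (carrierB sV cst cxt).
  rewrite opprB addrC addrA subrK => h; apply: (le_trans h).
  rewrite addrC lerD2l ler_wpM2l// expr2.
  have n0 := nrm_ge0 sV (carrierB sV cst cwt).
  by apply: ler_pM => //; rewrite (le_trans (sw t)).
have ib : leb.-integrable D (EFin \o (fun t => 2 * nrm V (s t - x t) ^+ 2 + 2 * (C * Asum t))).
  apply: (RintegrableD (mu := leb)) => //; first exact: (RintegrableZ (mu := leb)).
  by do 2 apply: (RintegrableZ (mu := leb)) => //.
have mxw : measurable_fun D (fun t => nrm V (x t - w t) ^+ 2).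
  apply: measurable_funX.
  have := bochner_measurable_nrm sV (bochner_measurable_lin sV (- 1) mw (conj cx mx)).
  by under eq_fun do rewrite scaleN1r addrC.
have ixw : leb.-integrable D (EFin \o (fun t => nrm V (x t - w t) ^+ 2)).
  by apply: (le_Rintegrable mD mxw ib) => t Dt; rewrite ger0_norm ?sqr_ge0// bound.
split => //.
apply: le_trans (le_Rintegral mD ixw ib bound) _.
rewrite RintegralD//; last 2 first.
  exact: (RintegrableZ (mu := leb)).
  by do 2 apply: (RintegrableZ (mu := leb)) => //.
rewrite !RintegralZl//; last by apply: (RintegrableZ (mu := leb)).
have hA : \int[leb]_(t in D) Asum t <= C * del.
  rewrite /Asum /C mulr_suml (Rintegral_sum (mu := leb))//; last first.
    by move=> b; exact: (RintegrableZ (mu := leb)).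
  apply: ler_sum => b _; rewrite RintegralZl// ler_wpM2l ?nrm_ge0//.
  by case: (hphi b).
have : C * (C * del) <= eps / 4.
  have -> : C * (C * del) = (eps / 4) * (C ^+ 2 / (C ^+ 2 + 1)).
    by rewrite /del; field; rewrite gt_eqF// ltr_wpDl// sqr_ge0.
  rewrite ler_piMr ?divr_ge0 ?(ltW e0)// ler_pdivrMr ?mul1r ?lerDl//.
  by rewrite ltr_wpDl// sqr_ge0.
have : C * \int[leb]_(t in D) Asum t <= C * (C * del) by exact: ler_wpM2l.
lra.
Qed.

End continuous_bochner_approximation.

(** * The energy identity *)

(** The scalar product of the pivot space, on the representatives that belong
    to it. *)
Record is_inner_product (R : realType) (L : lmodType R) (W : seminormed L)
    (dot : L -> L -> R) : Prop := IsInnerProduct {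
  dot_lin : forall (c : R) u v w, carrier W u -> carrier W v -> carrier W w ->
    dot (c *: u + v) w = c * dot u w + dot v w;
  dot_sym : forall u v, dot u v = dot v u;
  dot_nrm : forall u, carrier W u -> dot u u = nrm W u ^+ 2;
  dot_cs : forall u v, carrier W u -> carrier W v ->
    `|dot u v| <= nrm W u * nrm W v }.

Section energy_identity.
Variable R : realType.
Local Notation leb := (@lebesgue_measure R).
Variables (T : R) (D : set (measurableTypeR R)).
Hypotheses (T0 : 0 < T) (mD : measurable D) (DT : D `<=` `]0, T[)
  (D0 : leb (`]0, T[ `\` D) = 0%E).

Let itv_int (f : R -> R) (a b : R) := \int[leb]_(t in D) (f t * \1_(`]a, b]) t).

Let Dfin : (leb D < +oo)%E.
Proof.
apply: (@le_lt_trans _ _ (leb `]0, T[)); first by apply: le_measure; rewrite ?inE.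
by rewrite lebesgue_measure_itv/= lte_fin T0 -EFinB ltry.
Qed.

Let ind01 (a b t : R) : 0 <= (\1_(`]a, b]) t : R) <= 1.
Proof. by rewrite indicE; case: (_ \in _); rewrite /= ?lexx ler01. Qed.

Let integrable_ind (f : R -> R) a b : leb.-integrable D (EFin \o f) ->
  leb.-integrable D (EFin \o (fun t => f t * \1_(`]a, b]) t)).
Proof.
move=> i_f; apply: (@le_Rintegrable _ _ _ leb D mD _ (fun t => `|f t|)).
- apply: measurable_funM; first exact: Rintegrable_measurable i_f.
  exact: measurable_indic.
- exact: integrable_norm.
- move=> t _; have /andP[h0 h1] := ind01 a b t.
  by rewrite normrM (ger0_norm h0) ler_piMr.
Qed.

Let itv_int_add f a b c : leb.-integrable D (EFin \o f) -> a <= b -> b <= c ->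
  itv_int f a c = itv_int f a b + itv_int f b c.
Proof.
move=> i_f ab bc; rewrite /itv_int -RintegralD//; [|exact: integrable_ind..].
apply: eq_Rintegral => t _; rewrite -mulrDr; congr (_ * _).
rewrite !indicE !mem_setE !in_itv/=.
case: (ltP a t) => at_ /=; last first.
  by rewrite [b < t]ltNge (le_trans at_ ab)/= addr0.
case: (leP t b) => tb /=; first by rewrite (le_trans tb bc) addr0.
by rewrite add0r.
Qed.

Let itv_int_le f g a b : leb.-integrable D (EFin \o f) ->
  leb.-integrable D (EFin \o g) ->
  (forall t, D t -> t \in `]a, b] -> f t <= g t) -> itv_int f a b <= itv_int g a b.
Proof.
move=> i_f ig fg; apply: le_Rintegral => //; [exact: integrable_ind..|].
move=> t Dt; rewrite indicE mem_setE; case: (boolP (t \in _)) => h.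
  by rewrite !mulr1 fg.
by rewrite !mulr0.
Qed.

Let itv_int_le_total f a b : leb.-integrable D (EFin \o f) ->
  (forall t, D t -> 0 <= f t) -> itv_int f a b <= \int[leb]_(t in D) f t.
Proof.
move=> i_f f0; apply: le_Rintegral => //; first exact: integrable_ind.
move=> t Dt; have /andP[h0 h1] := ind01 a b t.
by rewrite ler_piMr// f0.
Qed.

Let integrable_cst (k : R) : leb.-integrable D (EFin \o (fun=> k)).
Proof. by apply: (@Rintegrable_bounded _ _ _ leb _ mD _ `|k|) => //. Qed.

Let itv_int_cst k a b : 0 <= a -> a <= b -> b <= T ->
  itv_int (fun=> k) a b = k * (b - a).
Proof.
move=> a0 ab bT; rewrite /itv_int RintegralZl//; last first.
  have := integrable_ind a b (integrable_cst 1).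
  by apply: eq_Rintegrable => // t _; rewrite mul1r.
congr (_ * _); rewrite /Rintegral integral_indic//.
have H : leb (`]a, b] `&` D) = (b - a)%:E.
  apply/eqP; rewrite eq_le; apply/andP; split.
    apply: (@le_trans _ _ (leb `]a, b])).
      by apply: le_measure; rewrite ?inE//; exact: measurableI.
    rewrite lebesgue_measure_itv/= lte_fin; case: ltP => h; rewrite -?EFinB//.
    by rewrite lee_fin subr_ge0.
  have -> : (b - a)%:E = leb `]a, b[.
    rewrite lebesgue_measure_itv/= lte_fin; case: ltP => h; rewrite -?EFinB//.
    by rewrite (le_anti (introT andP (conj ab h))) subrr.
  have mTD : measurable (`]0, T[%classic `\` D : set (measurableTypeR R)) by exact: measurableD.
  have mX : measurable (`]a, b]%classic `&` D : set (measurableTypeR R)) by exact: measurableI.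
  apply: (@le_trans _ _ (leb ((`]a, b] `&` D) `|` (`]0, T[ `\` D)))).
    apply: le_measure; rewrite ?inE//; first exact: measurableU.
    move=> t /=; rewrite in_itv/= => /andP[at_ tb].
    have [Dt|Dt] := pselect (D t); [left|right]; split => //.
      by rewrite in_itv/= at_ ltW.
    by rewrite /= in_itv/= (le_lt_trans a0 at_) (lt_le_trans tb bT).
  apply: (le_trans (measureU2 leb mX mTD)); rewrite -[leRHS]adde0 leeD2l//.
  by rewrite le_eqVlt; apply/orP; left; apply/eqP; exact: D0.
by transitivity (fine (b - a)%:E) => //; congr fine; exact: H.
Qed.

(* the margin c makes the contradiction strict *)
Let exists_le_average (eta2 : R -> R) (ieta : leb.-integrable D (EFin \o eta2)) (a b c : R) : 0 <= a -> a < b -> b <= T -> 0 < c ->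
  exists t : R, [/\ D t, t \in `]a, b] & (b - a) * eta2 t <= itv_int eta2 a b + c].
Proof.
move=> a0 ab bT c0; apply: contrapT => /forallNP h.
have ba : 0 < b - a by rewrite subr_gt0.
have : itv_int (fun=> itv_int eta2 a b + c) a b <= itv_int (fun t => (b - a) * eta2 t) a b.
  apply: itv_int_le => //; first exact: (RintegrableZ (mu := leb)).
  move=> t Dt tab; rewrite leNgt; apply/negP => h1; apply: (h t); split => //.
  exact: ltW.
rewrite itv_int_cst ?(ltW ab)//.
have -> : itv_int (fun t => (b - a) * eta2 t) a b = (b - a) * itv_int eta2 a b.
  rewrite /itv_int -RintegralZl//; last exact: integrable_ind.
  by apply: eq_Rintegral => t _; rewrite mulrA.
by rewrite mulrC ler_pM2l// gerDl leNgt c0.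
Qed.

Let within_eps_delta (f : R -> R) :
  (forall t, t \in `[0, T] -> forall eps : R, 0 < eps ->
     exists2 delta : R, 0 < delta & forall t', t' \in `[0, T] ->
       `|t' - t| < delta -> `|f t' - f t| <= eps) ->
  {within `[0, T], continuous f}.
Proof.
move=> h; apply/subspace_continuousP => t tT; apply/cvgrPdist_le => e0 he.
have [del d0 hd] := h _ tT _ he.
rewrite near_withinE; apply/nbhs_ballP; exists del => // t' /= tt' t'T.
by rewrite distrC; apply: hd => //; rewrite distrC.
Qed.

Let within_seq (f : R -> R) (c : R) (a : R^nat) : {within `[0, T], continuous f} ->
  c \in `[0, T] -> (forall j, a j \in `[0, T]) -> a @ \oo --> c ->
  f (a j) @[j --> \oo] --> f c.
Proof.
move=> cf cT aT ac; apply/cvgrPdist_le => e0 he.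
have /subspace_continuousP/(_ _ cT)/cvgrPdist_le/(_ _ he) := cf.
rewrite near_withinE => /nbhs_ballP[r /= r0 hr].
have /cvgrPdist_lt/(_ _ r0) := ac; apply: filterS => j hj.
by apply: hr => //; exact: aT.
Qed.

Section triple.
Variables (L : lmodType R) (V W : seminormed L) (dot : L -> L -> R).
Hypotheses (sV : is_seminorm V) (sW : is_seminorm W).
Hypotheses (hdot : is_inner_product W dot) (VW : forall v, carrier V v -> carrier W v).
Variables (e : R -> L) (de : R -> L -> R^o).
Hypotheses (be : bochner_sq_integrable leb D V e)
  (bde : bochner_sq_integrable leb D (dual_space V) de).
Hypothesis weak : forall v psi, carrier V v -> test_function T psi ->
  \int[leb]_(t in `]0, T[) (dot (e t) v * derive1 psi t) =
  - \int[leb]_(t in `]0, T[) (de t v * psi t).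
Hypothesis eW : forall t, t \in `[0, T] -> carrier W (e t).
Hypothesis eC : forall t, t \in `[0, T] -> forall eps : R, 0 < eps ->
  exists2 delta : R, 0 < delta & forall t', t' \in `[0, T] ->
    `|t' - t| < delta -> nrm W (e t' - e t) < eps.

Let DT' t : D t -> t \in `[0, T].
Proof. by move=> /DT /=; rewrite !in_itv/= => /andP[/ltW-> /ltW->]. Qed.

Let dotB u v w : carrier W u -> carrier W v -> carrier W w ->
  dot (u - v) w = dot u w - dot v w.
Proof.
move=> hu hv hw; rewrite -[u - v]addrC -scaleN1r (dot_lin hdot)//.
by rewrite mulN1r addrC.
Qed.

Let dot_continuous v : carrier V v -> {within `[0, T], continuous (fun t => dot (e t) v)}.
Proof.
move=> cv; apply: within_eps_delta => t tT eps eps0.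
have n0 := nrm_ge0 sW (VW cv).
have d0 : 0 < eps / (nrm W v + 1) by rewrite divr_gt0// ltr_wpDl.
have [del del0 hdel] := eC tT d0; exists del => // t' t'T tt'.
rewrite -dotB; [|exact: eW|exact: eW|exact: VW].
have cB := carrierB sW (eW t'T) (eW tT).
rewrite (le_trans (dot_cs hdot cB (VW cv)))//.
apply: (@le_trans _ _ (eps / (nrm W v + 1) * nrm W v)).
  by rewrite ler_wpM2r// ltW// hdel.
rewrite mulrAC ler_pdivrMr ?ltr_wpDl//.
by rewrite ler_wpM2l ?(ltW eps0)// lerDl.
Qed.

Let psi t := nrm W (e t) ^+ 2.

Let psi_continuous : {within `[0, T], continuous psi}.
Proof.
have cn : {within `[0, T], continuous (fun t => nrm W (e t))}.
  apply: within_eps_delta => t tT eps eps0.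
  have [del del0 hdel] := eC tT eps0; exists del => // t' t'T tt'.
  rewrite (le_trans (nrm_dist sW (eW t'T) (eW tT)))// ltW//.
  exact: hdel.
by move=> t; apply: cvgM; exact: cn.
Qed.

Let ide v : carrier V v -> leb.-integrable D (EFin \o (fun t => de t v : R)).
Proof.
move=> cv; apply: (integrable_pairing mD sV bde (x := fun=> v)); split.
  exact: bochner_measurable_cst.
exact: integrable_cst.
Qed.

Let p t : R := de t (e t).

Let ip : leb.-integrable D (EFin \o p).
Proof. exact: (integrable_pairing mD sV bde be). Qed.

Let dot_increment v a b : carrier V v -> D a -> D b -> a <= b ->
  dot (e b) v - dot (e a) v = itv_int (fun t => de t v) a b.
Proof.
move=> cv Da Db ab.
have /andP[a0 _] : 0 < a < T by have := DT Da; rewrite /= in_itv.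
have /andP[_ bT] : 0 < b < T by have := DT Db; rewrite /= in_itv.
have H := @weak_derivative_increment R T D T0 mD DT D0
  (fun t => dot (e t) v) (fun t => de t v) a b (dot_continuous cv) (ide cv).
by apply: H => // ps tps; exact: weak.
Qed.

Let eV t : D t -> carrier V (e t). Proof. by case: be => -[h _] _; exact: h. Qed.

(* |e(b)|^2 - |e(a)|^2 = <e(b) - e(a), e(b)> + <e(b) - e(a), e(a)>, and both
   scalar products are integrals of de against a fixed vector *)
Let psi_increment a b : D a -> D b -> a <= b ->
  psi b - psi a - 2 * itv_int p a b =
  itv_int (fun t => de t (e b - e t) + de t (e a - e t)) a b.
Proof.
move=> Da Db ab.
have ca := eV Da; have cb := eV Db; have wa := VW ca; have wb := VW cb.
have -> : psi b - psi a = itv_int (fun t => de t (e b)) a b + itv_int (fun t => de t (e a)) a b.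
  rewrite -!dot_increment// /psi -!(dot_nrm hdot)//.
  by rewrite (dot_sym hdot (e a) (e b)); ring.
have i1 := integrable_ind a b (ide cb); have i2 := integrable_ind a b (ide ca).
have i3 := integrable_ind a b ip.
rewrite /itv_int -RintegralD// -RintegralZl// -RintegralB//; last 2 first.
  exact: (RintegrableD (mu := leb)).
  exact: (RintegrableZ (mu := leb)).
apply: eq_Rintegral => t; rewrite inE => Dt.
have [[cde _] _] := bde; have ct := eV Dt.
rewrite !(dualB sV (cde _ Dt))// /p; ring.
Qed.

(** An approximation w of e in L2(0,T;V) that is uniformly continuous with
    modulus omega at distance del. *)
Section one_scale.
Variables (w : R -> L) (kappa omega del : R).
Hypothesis kappa0 : 0 < kappa.
Hypothesis wV : forall t, carrier V (w t).
Hypothesis w_unif : forall r t, r \in `[0, T] -> t \in `[0, T] -> `|r - t| <= del ->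
  nrm V (w r - w t) <= omega.
Let eta2 t := nrm V (e t - w t) ^+ 2.
Hypothesis ieta : leb.-integrable D (EFin \o eta2).

Let alpha2 t := nrm (dual_space V) (de t) ^+ 2.
Let ialpha : leb.-integrable D (EFin \o alpha2). Proof. by case: bde. Qed.

Let eta2_ge0 t : 0 <= eta2 t. Proof. exact: sqr_ge0. Qed.

Let dom t := kappa * alpha2 t + (3 / kappa) * (eta2 t + omega ^+ 2).

Let idom : leb.-integrable D (EFin \o dom).
Proof.
apply: (RintegrableD (mu := leb)) => //; apply: (RintegrableZ (mu := leb)) => //.
by apply: (RintegrableD (mu := leb)) => //; exact: integrable_cst.
Qed.

Let pairing_bound t a : D t -> D a -> `|t - a| <= del ->
  `|de t (e a - e t)| <= kappa / 2 * alpha2 t + (3 / (2 * kappa)) * (eta2 t + omega ^+ 2 + eta2 a).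
Proof.
move=> Dt Da ta; have ct := eV Dt; have ca := eV Da.
have [[cde _] _] := bde.
apply: (le_trans (dual_le sV (cde _ Dt) (carrierB sV ca ct))).
have cwt := wV t; have cwa := wV a.
have h1 : nrm V (e a - e t) <= nrm V (e a - w a) + omega + nrm V (e t - w t).
  apply: (le_trans (nrm_triangle sV ca ct cwa)).
  rewrite -addrA lerD2l; apply: (le_trans (nrm_triangle sV cwa ct cwt)).
  rewrite (nrm_distC sV cwt ct) lerD2r; apply: w_unif; [exact: DT'|exact: DT'|].
  by rewrite distrC.
rewrite /alpha2 /eta2; move: h1.
have := nrm_ge0 sV (carrierB sV ca ct).
have := nrm_ge0 sV (carrierB sV ca cwa).
have := nrm_ge0 sV (carrierB sV ct cwt).
have := dual_nrm_ge0 sV (de t).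
move: (nrm (dual_space V) (de t)) (nrm V (e a - e t)) (nrm V (e a - w a))
  (nrm V (e t - w t)) => A N x y A0 y0 x0 N0 h1.
have N2 : N ^+ 2 <= 3 * (y ^+ 2 + omega ^+ 2 + x ^+ 2).
  have : N ^+ 2 <= (x + omega + y) ^+ 2 by rewrite ler_sqr ?nnegrE// (le_trans N0).
  have := sqr_ge0 (x - omega); have := sqr_ge0 (y - omega); have := sqr_ge0 (x - y); lra.
have AN : A * N <= kappa / 2 * A ^+ 2 + N ^+ 2 / (2 * kappa).
  rewrite -subr_ge0.
  have -> : kappa / 2 * A ^+ 2 + N ^+ 2 / (2 * kappa) - A * N =
     (kappa * A - N) ^+ 2 / (2 * kappa) by field; rewrite gt_eqF.
  by rewrite divr_ge0 ?sqr_ge0// mulr_ge0// ltW.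
apply: (le_trans AN); rewrite lerD2l.
have -> : 3 / (2 * kappa) * (y ^+ 2 + omega ^+ 2 + x ^+ 2) =
   3 * (y ^+ 2 + omega ^+ 2 + x ^+ 2) / (2 * kappa) by field; rewrite gt_eqF.
by rewrite ler_wpM2r// invr_ge0 mulr_ge0// ltW.
Qed.

Let psi_increment_le a b : D a -> D b -> a <= b -> b - a <= del ->
  `|psi b - psi a - 2 * itv_int p a b| <=
  itv_int dom a b + (3 / (2 * kappa)) * (eta2 a + eta2 b) * (b - a).
Proof.
move=> Da Db ab abd.
have [ca cb] := (eV Da, eV Db).
have /andP[a0 _] : 0 < a < T by have := DT Da; rewrite /= in_itv.
have /andP[_ bT] : 0 < b < T by have := DT Db; rewrite /= in_itv.
rewrite psi_increment//; set c := _ * (eta2 a + eta2 b).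
rewrite -(itv_int_cst c (ltW a0) ab (ltW bT)).
have i1 v : carrier V v -> leb.-integrable D (EFin \o (fun t => de t (v - e t) : R)).
  move=> cv; apply: (@eq_Rintegrable _ _ _ leb D mD (fun t => de t v - p t)).
    move=> t Dt; have [[cde _] _] := bde; have ct := eV Dt.
    by rewrite (dualB sV (cde _ Dt)).
  by apply: (RintegrableB (mu := leb)) => //; exact: ide.
have i2 : leb.-integrable D (EFin \o (fun t => de t (e b - e t) + de t (e a - e t) : R)).
  by apply: (RintegrableD (mu := leb)) => //; exact: i1.
have -> : itv_int dom a b + itv_int (fun=> c) a b = itv_int (fun t => dom t + c) a b.
  rewrite /itv_int -RintegralD//; [|exact: integrable_ind|exact/integrable_ind/integrable_cst].
  by apply: eq_Rintegral => t _; rewrite [RHS]mulrDl.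
apply: (le_trans (le_normr_Rintegral mD (integrable_ind a b i2))).
apply: le_Rintegral => //.
- by apply: integrable_norm => //; exact: integrable_ind.
- apply: integrable_ind; apply: (RintegrableD (mu := leb)) => //; exact: integrable_cst.
- move=> t Dt; rewrite indicE mem_setE; case: (boolP (t \in _)) => h; last first.
    by rewrite !mulr0 normr0.
  move: h; rewrite in_itv/= => /andP[at_ tb]; rewrite !mulr1.
  have hb : `|t - b| <= del by rewrite distrC ger0_norm ?subr_ge0//; lra.
  have ha : `|t - a| <= del by rewrite ger0_norm ?subr_ge0 ?(ltW at_)//; lra.
  apply: (le_trans (ler_normD _ _)).
  have := lerD (pairing_bound Dt Db hb) (pairing_bound Dt Da ha).
  move=> h; apply: (le_trans h); rewrite /dom /c le_eqVlt; apply/orP; left; apply/eqP.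
  by field; rewrite gt_eqF.
Qed.

(** Each cell of a uniform partition contains a node where the squared distance
    of e to w is at most its average over the cell, so that the sum over the
    nodes is controlled by the integral of the squared distance, up to a margin
    c. *)
Lemma partition_increment (n : nat) (c : R) : (0 < n)%N -> 0 < c -> 2 * (T / n%:R) <= del ->
  exists a b : R, [/\ D a, D b, a <= T / n%:R, T - T / n%:R <= b & a <= b /\
  `|psi b - psi a - 2 * itv_int p a b| <=
   \int[leb]_(t in D) dom t + 6 / kappa * (\int[leb]_(t in D) eta2 t + c)].
Proof.
move=> n0 c0 hdel; pose h := T / n%:R.
have nR0 : 0 < (n%:R : R) by rewrite ltr0n.
have h0 : 0 < h by rewrite divr_gt0.
have nh : n%:R * h = T by rewrite /h mulrC divfK// gt_eqF.
have ihT i : (i < n)%N -> i%:R * h + h <= T.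
  move=> ilt; have : i.+1%:R * h <= n%:R * h by rewrite ler_wpM2r ?(ltW h0)// ler_nat.
  by rewrite -natr1 mulrDl mul1r nh.
have /choice[tau htau] : forall i : nat, exists t : R, (i < n)%N ->
   [/\ D t, t \in `](i%:R * h), (i%:R * h + h)] &
    h * eta2 t <= itv_int eta2 (i%:R * h) (i%:R * h + h) + c / n%:R].
  move=> i; have [ilt|] := ltnP i n; last by exists 0.
  have [||||t ht] := @exists_le_average eta2 ieta (i%:R * h) (i%:R * h + h) (c / n%:R).
  - by rewrite mulr_ge0// ltW.
  - by rewrite ltrDl.
  - exact: ihT.
  - by rewrite divr_gt0.
  by exists t; rewrite addrAC subrr add0r in ht.
have tauD i : (i < n)%N -> D (tau i) by move=> /htau[].
have tau_itv i : (i < n)%N -> i%:R * h < tau i <= i%:R * h + h.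
  by move=> /htau[_ + _]; rewrite in_itv.
have i1h i : i.+1%:R * h = i%:R * h + h by rewrite -natr1 mulrDl mul1r.
pose Q i := itv_int eta2 0 (i%:R * h + h) + i.+1%:R * (c / n%:R).
(* the last term pays for the next cell, which uses the node i once more *)
have claim i : (i < n)%N -> tau 0%N <= tau i /\
  `|psi (tau i) - psi (tau 0%N) - 2 * itv_int p (tau 0%N) (tau i)| <=
  itv_int dom (tau 0%N) (tau i) + 6 / kappa * Q i - 3 / kappa * (h * eta2 (tau i)).
  elim: i => [_|i IH ilt].
    split=> //; rewrite subrr sub0r.
    have z f : itv_int f (tau 0%N) (tau 0%N) = 0.
      rewrite /itv_int set_itvoc0; under eq_Rintegral do rewrite indic0 mulr0.
      by rewrite Rintegral_cst// mul0r.
    rewrite !z mulr0 oppr0 normr0 add0r.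
    have [_ _] := htau 0%N n0; rewrite mul0r add0r => hq.
    have q0 : h * eta2 (tau 0%N) <= Q 0%N by rewrite /Q mul0r add0r mul1r.
    have e0 : 0 <= h * eta2 (tau 0%N) by rewrite mulr_ge0// ltW.
    have k0 : 0 < kappa^-1 by rewrite invr_gt0.
    have : kappa^-1 * (h * eta2 (tau 0%N)) <= kappa^-1 * Q 0%N by rewrite ler_wpM2l// ltW.
    have : 0 <= kappa^-1 * (h * eta2 (tau 0%N)) by rewrite mulr_ge0// ltW.
    by rewrite -!mulrA; lra.
  have ilt' := ltnW ilt; have [t0i hi] := IH ilt'.
  have /andP[ti1 ti2] := tau_itv _ ilt'; have /andP[tj1 tj2] := tau_itv _ ilt.
  rewrite i1h in tj1 tj2.
  have tij : tau i <= tau i.+1 by rewrite ltW// (le_lt_trans ti2).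
  have tijd : tau i.+1 - tau i <= 2 * h by lra.
  split; first exact: le_trans tij.
  have hinc := psi_increment_le (tauD _ ilt') (tauD _ ilt) tij (le_trans tijd hdel).
  have e1 := itv_int_add ip t0i tij; have e2 := itv_int_add idom t0i tij.
  have [_ _ hq] := htau _ ilt; rewrite i1h in hq.
  have Qi : Q i.+1 = Q i + (itv_int eta2 (i%:R * h + h) (i%:R * h + h + h) + c / n%:R).
    rewrite /Q i1h [itv_int eta2 0 (_ + _ + h)](itv_int_add ieta (b := i%:R * h + h)); last 2 first.
      by rewrite addr_ge0 ?mulr_ge0// ltW.
      by rewrite lerDl ltW.
    by rewrite -[i.+2%:R]natr1; ring.
  rewrite {}e1 {}e2 {}Qi.
  have -> : psi (tau i.+1) - psi (tau 0%N) -
     2 * (itv_int p (tau 0%N) (tau i) + itv_int p (tau i) (tau i.+1)) =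
     (psi (tau i) - psi (tau 0%N) - 2 * itv_int p (tau 0%N) (tau i)) +
     (psi (tau i.+1) - psi (tau i) - 2 * itv_int p (tau i) (tau i.+1)) by ring.
  apply: (le_trans (ler_normD _ _)).
  have k0 : 0 < kappa^-1 by rewrite invr_gt0.
  have hinc2 : `|psi (tau i.+1) - psi (tau i) - 2 * itv_int p (tau i) (tau i.+1)| <=
     itv_int dom (tau i) (tau i.+1) + 3 / kappa * (h * eta2 (tau i) + h * eta2 (tau i.+1)).
    apply: (le_trans hinc); rewrite lerD2l.
    have -> : 3 / kappa * (h * eta2 (tau i) + h * eta2 (tau i.+1)) =
      3 / (2 * kappa) * (eta2 (tau i) + eta2 (tau i.+1)) * (2 * h) by field; rewrite gt_eqF.
    rewrite ler_wpM2l// mulr_ge0 ?addr_ge0// divr_ge0// mulr_ge0// ltW//.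
  have := lerD hi hinc2.
  have : kappa^-1 * (h * eta2 (tau i.+1)) <=
     kappa^-1 * (itv_int eta2 (i%:R * h + h) (i%:R * h + h + h) + c / n%:R).
    by rewrite ler_wpM2l// ltW.
  rewrite -!mulrA !mulrDr; lra.
have n1 : (n.-1 < n)%N by rewrite prednK.
have [t0n hn] := claim _ n1.
have /andP[_ t0h] := tau_itv _ n0; rewrite mul0r add0r in t0h.
have /andP[tn _] := tau_itv _ n1.
exists (tau 0%N), (tau n.-1); split; [exact: tauD|exact: tauD|exact: t0h| |split => //].
  apply: le_trans (ltW tn); rewrite -/h -nh -{1}(prednK n0) i1h; lra.
apply: (le_trans hn).
have dom0 t : 0 <= dom t.
  have a1 : 0 <= kappa * alpha2 t by rewrite mulr_ge0 ?sqr_ge0// ltW.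
  have a2 : 0 <= 3 / kappa * (eta2 t + omega ^+ 2).
    by rewrite mulr_ge0 ?divr_ge0 ?addr_ge0 ?sqr_ge0// ltW.
  exact: addr_ge0.
have h1 := itv_int_le_total (tau 0%N) (tau n.-1) idom (fun t _ => dom0 t).
have h2 : Q n.-1 <= \int[leb]_(t in D) eta2 t + c.
  rewrite /Q prednK// (_ : n%:R * (c / n%:R) = c) ?lerD2r; last by field; rewrite gt_eqF.
  exact: itv_int_le_total.
have k0 : 0 < kappa^-1 by rewrite invr_gt0.
have : kappa^-1 * Q n.-1 <= kappa^-1 * (\int[leb]_(t in D) eta2 t + c).
  by rewrite ler_wpM2l// ltW.
have : 0 <= kappa^-1 * (h * eta2 (tau n.-1)).
  by rewrite mulr_ge0 ?(ltW k0)// mulr_ge0 ?(ltW h0)// eta2_ge0.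
rewrite -!mulrA; lra.
Qed.

End one_scale.

Let A := \int[leb]_(t in D) (nrm (dual_space V) (de t) ^+ 2).

Let A0 : 0 <= A. Proof. by apply: Rintegral_ge0 => t _; exact: sqr_ge0. Qed.

Let psi_increment_small (eps : R) : 0 < eps ->
  exists a b : R, [/\ D a, D b, a <= eps, T - eps <= b & a <= b /\
  `|psi b - psi a - 2 * itv_int p a b| <= eps].
Proof.
move=> eps0; pose kappa := eps / (4 * (A + 1)).
have A1 : 0 < A + 1 by rewrite ltr_wpDl.
have kappa0 : 0 < kappa by rewrite divr_gt0// mulr_gt0.
pose eps2 := kappa * eps / 48.
have eps20 : 0 < eps2 by rewrite divr_gt0// mulr_gt0.
have [I [phi [z [cphi cz ieta heta]]]] := bochner_continuous_approx mD Dfin sV be eps20.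
pose w t := \sum_i phi i t *: z i.
have wV t : carrier V (w t) by apply: (carrier_sum sV) => i _; exact: carrierZ.
pose omega := Num.sqrt (eps2 / T).
have omega0 : 0 < omega by rewrite sqrtr_gt0 divr_gt0.
pose Z := \sum_i nrm V (z i).
have Z0 : 0 <= Z by apply: sumr_ge0 => i _; exact: nrm_ge0.
pose om1 := omega / (Z + 1).
have om10 : 0 < om1 by rewrite divr_gt0// ltr_wpDl.
have unif : \forall del \near 0^'+, forall i x y, x \in `[0, T] -> `|x - y| <= del ->
    `|phi i x - phi i y| <= om1.
  apply: filter_forall => i; exact: continuous_itv_uniform.
have [del [del0 hdel]] : exists del : R, 0 < del /\ forall i x y, x \in `[0, T] ->
    `|x - y| <= del -> `|phi i x - phi i y| <= om1.
  near (0 : R)^'+ => del; exists del; split; first by near: del; exact: nbhs_right_gt.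
  by near: del.
have w_unif r t : r \in `[0, T] -> t \in `[0, T] -> `|r - t| <= del ->
    nrm V (w r - w t) <= omega.
  move=> rT tT rt; rewrite /w -sumrB; under eq_bigr do rewrite -scalerBl.
  apply: (le_trans (nrm_sum sV _ _)) => [i _|]; first exact: carrierZ.
  apply: (@le_trans _ _ (om1 * Z)).
    rewrite mulr_sumr; apply: ler_sum => i _; rewrite nrmZ// ler_wpM2r ?nrm_ge0//.
    exact: hdel.
  by rewrite /om1 mulrAC ler_pdivrMr ?ltr_wpDl// ler_wpM2l ?(ltW omega0)// lerDl.
have [n [n0 hn]] : exists n : nat, (0 < n)%N /\ 2 * (T / n%:R) <= del /\ T / n%:R <= eps.
  pose m := Num.min (del / 2) eps.
  have m0 : 0 < m by rewrite lt_min divr_gt0.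
  have [k hk] : exists k : nat, T / m < k%:R.
    by exists (Num.bound (T / m)); rewrite archi_boundP// ltW// divr_gt0.
  have k0 : (0 : R) < k%:R by apply: le_lt_trans hk; rewrite ltW// divr_gt0.
  exists k; split; first by rewrite -(ltr0n R).
  have : T / k%:R <= m by rewrite ler_pdivrMr// mulrC -ler_pdivrMr// ltW.
  rewrite le_min => /andP[h1 h2]; split => //; lra.
have [hn1 hn2] := hn.
have [a [b [Da Db ah bh [ab hab]]]] := partition_increment kappa0 wV w_unif ieta n0 eps20 hn1.
exists a, b; split => //; first exact: le_trans hn2.
  by apply: le_trans bh; rewrite lerD2l lerN2.
split => //; apply: (le_trans hab).
have ialpha : leb.-integrable D (EFin \o (fun t => nrm (dual_space V) (de t) ^+ 2)).
  by case: bde.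
have icst := integrable_cst (omega ^+ 2).
set E := \int[leb]_(t in D) _ in heta.
have -> : \int[leb]_(t in D) (kappa * nrm (dual_space V) (de t) ^+ 2 +
    (3 / kappa) * (nrm V (e t - w t) ^+ 2 + omega ^+ 2)) =
    kappa * A + (3 / kappa) * (E + omega ^+ 2 * fine (leb D)).
  rewrite RintegralD//; last 2 first.
    exact: (RintegrableZ (mu := leb)).
    by apply: (RintegrableZ (mu := leb)) => //; exact: (RintegrableD (mu := leb)).
  rewrite !RintegralZl//; last exact: (RintegrableD (mu := leb)).
  by rewrite RintegralD// Rintegral_cst.
have lebD : fine (leb D) <= T.
  have := itv_int_cst 1 (lexx 0) (ltW T0) (lexx T); rewrite subr0 mul1r /itv_int => hT.
  rewrite -[leRHS]hT -[leLHS]mul1r -Rintegral_cst//.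
  apply: (le_Rintegral mD (integrable_cst 1) (integrable_ind 0 T (integrable_cst 1))).
  by move=> t /DT/=; rewrite in_itv/= mul1r indicE => /andP[t0 tT]; rewrite mem_set//= in_itv/= t0 ltW.
have om2 : omega ^+ 2 * fine (leb D) <= eps2.
  have eT0 : 0 <= eps2 / T by exact: ltW (divr_gt0 eps20 T0).
  rewrite /omega sqr_sqrtr//.
  by rewrite mulrAC ler_pdivrMr// ler_wpM2l// ltW.
have kA : kappa * A <= eps / 4.
  rewrite /kappa; have -> : eps / (4 * (A + 1)) * A = eps / 4 * (A / (A + 1)).
    by field; rewrite gt_eqF.
  by rewrite ler_piMr ?divr_ge0 ?(ltW eps0)// ler_pdivrMr// mul1r lerDl.
have k1 : kappa^-1 * eps2 = eps / 48 by rewrite /eps2; field; rewrite gt_eqF.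
have ki : 0 < kappa^-1 by rewrite invr_gt0.
have h1 : kappa^-1 * E <= kappa^-1 * eps2 by rewrite ler_wpM2l// ltW.
have h2 : kappa^-1 * (omega ^+ 2 * fine (leb D)) <= kappa^-1 * eps2 by rewrite ler_wpM2l// ltW.
rewrite -[\int[leb]_(t in D) (nrm V (e t - w t) ^+ 2)]/E.
set F := omega ^+ 2 * _ in h2 *.
have -> : kappa * A + 3 / kappa * (E + F) + 6 / kappa * (E + eps2) =
    kappa * A + 9 * (kappa^-1 * E) + 3 * (kappa^-1 * F) + 6 * (kappa^-1 * eps2) by ring.
rewrite k1 in h1 h2 *; lra.
Unshelve. all: by end_near. Qed.

(** The integration by parts formula of Lions and Magenes. On the partitions above,
    whose nodes are chosen where e is close to a time-continuous approximation,
    the increments of the squared norm are pairings of the derivative with nodal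
    values. The first and last nodes tend to 0 and T, where continuity in the
    pivot space identifies the limit. *)
Lemma energy_identity :
  \int[leb]_(t in D) (de t (e t) : R) = (nrm W (e T) ^+ 2 - nrm W (e 0) ^+ 2) / 2.
Proof.
have /choice[a /choice[b hab]] : forall j : nat, exists a b : R, [/\ D a, D b,
    a <= j.+1%:R^-1, T - j.+1%:R^-1 <= b & a <= b /\
    `|psi b - psi a - 2 * itv_int p a b| <= j.+1%:R^-1].
  move=> j; have [] := @psi_increment_small j.+1%:R^-1; first by rewrite invr_gt0.
  by move=> a [b h]; exists a, b.
have Da j : D (a j) by case: (hab j).
have Db j : D (b j) by case: (hab j).
have inv0 : (fun j => j.+1%:R^-1 : R) @ \oo --> (0 : R) := cvg_harmonic.
have a0 : a @ \oo --> (0 : R).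
  apply: cvg_dist_le inv0 => j; have [/DT + _ + _ _] := hab j.
  by rewrite /= in_itv/= subr0 => /andP[h _] h2; rewrite ger0_norm// ltW.
have bT : b @ \oo --> T.
  apply: cvg_dist_le inv0 => j; have [_ /DT + _ + _] := hab j.
  rewrite /= in_itv/= distrC => /andP[_ h] h2; 
  by rewrite ger0_norm ?subr_ge0 ?(ltW h)// lerBlDr -lerBlDl.
have pa := within_seq psi_continuous _ (fun j => DT' (Da j)) a0.
have pb := within_seq psi_continuous _ (fun j => DT' (Db j)) bT.
have {}pa : psi (a j) @[j --> \oo] --> psi 0 by apply: pa; rewrite in_itv/= lexx ltW.
have {}pb : psi (b j) @[j --> \oo] --> psi T by apply: pb; rewrite in_itv/= lexx ltW.
have pi : itv_int p (a j) (b j) @[j --> \oo] --> \int[leb]_(t in D) p t.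
  apply: (@Rdominated_cvg _ _ _ leb D mD _ _ (fun t => `|p t|)).
  - by move=> j; apply: (Rintegrable_measurable (mu := leb)); exact: integrable_ind.
  - move=> t Dt; apply: cvg_near_cst.
    have /andP[t0 tT] : 0 < t < T by have := DT Dt; rewrite /= in_itv.
    have tT' : 0 < T - t by rewrite subr_gt0.
    near=> j; rewrite indicE mem_set ?mulr1//= in_itv/=; apply/andP; split.
      near: j; have /cvgrPdist_lt/(_ _ t0) := a0; apply: filterS => j.
      by rewrite sub0r normrN; apply: le_lt_trans; exact: ler_norm.
    near: j; have /cvgrPdist_lt/(_ _ tT') := bT; apply: filterS => j.
    by move=> /(le_lt_trans (ler_norm _)); lra.
  - exact: integrable_norm.
  - move=> j t _; have /andP[h0 h1] := ind01 (a j) (b j) t.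
    by rewrite normrM (ger0_norm h0) ler_piMr.
have lim0 : psi (b j) - psi (a j) - 2 * itv_int p (a j) (b j) @[j --> \oo] --> (0 : R).
  apply: cvg_dist_le inv0 => j; rewrite subr0.
  by have [_ _ _ _ []] := hab j.
have lim1 : psi (b j) - psi (a j) - 2 * itv_int p (a j) (b j) @[j --> \oo] -->
    psi T - psi 0 - 2 * \int[leb]_(t in D) p t.
  by apply: cvgB; [exact: cvgB|apply: cvgM; [exact: cvg_cst|exact: pi]].
pose X := \int[leb]_(t in D) p t.
have h : (0 : R) = psi T - psi 0 - 2 * X.
  by apply: (cvg_unique (@Rhausdorff R) lim0 lim1).
rewrite -[LHS]/X -[nrm W (e T) ^+ 2]/(psi T) -[nrm W (e 0) ^+ 2]/(psi 0).
by move: X (psi T) (psi 0) h => X x y h; lra.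
Unshelve. all: by end_near. Qed.

End triple.

End energy_identity.

(** * Functionals that vanish at almost all times *)

Section vanishing_functional.
Context d (T : measurableType d) (R : realType).
Variable mu : {measure set T -> \bar R}.
Variables (D : set T) (L : lmodType R) (V : seminormed L).
Hypothesis sV : is_seminorm V.

Let norming_selection (l : T -> L -> R^o) (eps : R) : 0 < eps ->
  finitely_based l -> (forall t, carrier (dual_space V) (l t)) ->
  exists v : T -> L, [/\ finitely_based v, forall t, carrier V (v t),
    forall t, nrm V (v t) <= 1 & forall t, nrm (dual_space V) (l t) - eps <= `|l t (v t)|].
Proof.
move=> e0 fl cl.
have /choice[N hN] : forall f : L -> R^o, exists v, carrier (dual_space V) f ->
    [/\ carrier V v, nrm V v <= 1 & nrm (dual_space V) f - eps <= `|f v|].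
  move=> f; have [cf|ncf] := pselect (carrier (dual_space V) f); last by exists 0.
  by have [v hv] := dual_norming sV cf e0; exists v.
exists (N \o l); split; first exact: finitely_based_comp.
- by move=> t; case: (hN _ (cl t)).
- by move=> t; case: (hN _ (cl t)).
- by move=> t; case: (hN _ (cl t)).
Qed.

(** The functions in the range of a Bochner measurable map are, up to a null set,
    normed by countably many vectors; hence the exceptional set can be chosen
    independently of the vector. *)
Lemma ae_functional_eq0 (g : T -> L -> R^o) : bochner_measurable D (dual_space V) g ->
  (forall v, carrier V v -> {ae mu, forall t, D t -> g t v = 0}) ->
  {ae mu, forall t, D t -> forall v, carrier V v -> g t v = 0}.
Proof.
move=> [cg [g_ fg gg]] g0.
have inv_gt0 j : 0 < (j.+1%:R^-1 : R) by rewrite invr_gt0.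
have /choice[w hw] : forall j : nat, exists v : T -> L, [/\ finitely_based v,
    forall t, carrier V (v t), forall t, nrm V (v t) <= 1 &
    forall t, nrm (dual_space V) (g_ j t) - j.+1%:R^-1 <= `|g_ j t (v t)|].
  by move=> j; have [f1 f2] := fg j; exact: norming_selection.
have ae0 : {ae mu, forall t, forall j, D t -> g t (w j t) = 0}.
  apply: ae_foralln => j; have [[I [A [h [mA wE]]]] cw _ _] := hw j.
  have : {ae mu, forall t, forall b, carrier V (h b) -> D t -> g t (h b) = 0}.
    apply: filter_forall => b.
    have [cb|ncb] := pselect (carrier V (h b)).
      by apply: filterS (g0 _ cb) => t H _; exact: H.
    by apply: aeW => t /ncb.
  by apply: filterS => t H Dt; rewrite wE; apply: H => //; rewrite -wE.
apply: filterS ae0 => t H Dt v cv; have cgt := cg _ Dt.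
have sD := dual_seminorm sV.
have n0 : nrm (dual_space V) (g t) = 0.
  pose dj j := nrm (dual_space V) (g_ j t - g t).
  have le j : `|nrm (dual_space V) (g t) - 0| <= 2 * dj j + j.+1%:R^-1.
    rewrite subr0 ger0_norm ?dual_nrm_ge0//.
    have [_ /(_ t) cgj] := fg j; have [_ /(_ t) cw /(_ t) w1 /(_ t) hn] := hw j.
    have cB := carrierB sD cgj cgt.
    have h1 : nrm (dual_space V) (g t) <= nrm (dual_space V) (g_ j t) + dj j.
      have := nrm_dist sD cgj cgt; rewrite ler_norml /dj => /andP[h _]; lra.
    have h2 : `|g_ j t (w j t)| <= dj j.
      have -> : g_ j t (w j t) = (g_ j t - g t) (w j t).
        have -> : (g_ j t - g t) (w j t) = g_ j t (w j t) - g t (w j t) by [].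
        by rewrite H// subr0.
      by rewrite (le_trans (dual_le sV cB cw))// ler_piMr// dual_nrm_ge0.
    by move: hn h1 h2; move: (j.+1%:R^-1) => x; lra.
  have c0 : 2 * dj j + j.+1%:R^-1 @[j --> \oo] --> 2 * (0 : R) + 0.
    apply: cvgD; last exact: cvg_harmonic.
    by apply: cvgM; [exact: cvg_cst|exact: gg].
  rewrite mulr0 addr0 in c0.
  have c1 := cvg_dist_le le c0.
  by apply: (cvg_unique (@Rhausdorff R) (cvg_cst _) c1).
apply/eqP; rewrite -normr_le0.
by rewrite (le_trans (dual_le sV cgt cv))// n0 mul0r.
Qed.

End vanishing_functional.

(** * Quadratic forms and square integrable functions *)

(** A quadratic form, finite or not, on the functions of M. The weighted form of
    subadditivity is what passes through integrals and sums; optimizing over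
    the weight gives the triangle inequality for the square root. *)
Record is_qform (R : realType) (L : lmodType R) (M : set L) (Q : L -> \bar R) : Prop :=
  IsQform {
  qform_ge0 : forall u, (0 <= Q u)%E;
  qformZ : forall (c : R) u, M u -> Q (c *: u) = ((c ^+ 2)%:E * Q u)%E;
  qformD : forall (e : R) u v, 0 < e -> M u -> M v ->
    (Q (u + v)%R <= (1 + e)%:E * Q u + (1 + e^-1)%:E * Q v)%E }.

Section qforms.
Variables (R : realType) (L : lmodType R) (M : set L).
Implicit Types Q : L -> \bar R.

Lemma qform_scale Q (k : R) : 0 <= k -> is_qform M Q ->
  is_qform M (fun u => k%:E * Q u)%E.
Proof.
move=> k0 [Q0 QZ QD]; split=> [u|c u Mu|e u v e0 Mu Mv].
- by rewrite mule_ge0.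
- by rewrite QZ// muleCA.
- apply: (@le_trans _ _ (k%:E * ((1 + e)%:E * Q u + (1 + e^-1)%:E * Q v))%E).
    by rewrite lee_wpmul2l ?lee_fin// QD.
  rewrite ge0_muleDr ?mule_ge0 ?lee_fin ?addr_ge0 ?invr_ge0 ?(ltW e0)//.
  by rewrite muleCA [X in (_ + X <= _)%E]muleCA.
Qed.

Lemma qform_sum (I : eqType) (r : seq I) (Q : I -> L -> \bar R) :
  (forall i, i \in r -> is_qform M (Q i)) -> is_qform M (fun u => \sum_(i <- r) Q i u)%E.
Proof.
move=> qQ; split=> [u|c u Mu|e u v e0 Mu Mv].
- by rewrite big_seq; apply: sume_ge0 => i /qQ[].
- rewrite big_seq [in RHS]big_seq ge0_sume_distrr; last by move=> i /qQ[].
  by apply: eq_bigr => i /qQ[_ ->].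
- rewrite big_seq [X in (_ * X + _)%E]big_seq [X in (_ + _ * X)%E]big_seq.
  rewrite !ge0_sume_distrr -?big_split/=; [|by move=> i /qQ[]..].
  by apply: lee_sum => i /qQ[_ _ ->].
Qed.

Lemma qform_integral d (X : measurableType d) (mu : {measure set X -> \bar R})
    (D : set X) (q : L -> X -> R) : measurable D ->
  (forall u, M u -> measurable_fun D (q u)) ->
  (forall u x, 0 <= q u x) ->
  (forall (c : R) u x, q (c *: u) x = c ^+ 2 * q u x) ->
  (forall (e : R) u v x, 0 < e -> q (u + v) x <= (1 + e) * q u x + (1 + e^-1) * q v x) ->
  is_qform M (fun u => \int[mu]_(x in D) (q u x)%:E)%E.
Proof.
move=> mD mq q0 qZ qD; split=> [u|c u Mu|e u v e0 Mu Mv].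
- by apply: integral_ge0 => x _; rewrite lee_fin.
- rewrite -ge0_integralZl//; last 3 first.
  + exact/measurable_EFinP/mq.
  + by move=> x _; rewrite lee_fin.
  + by rewrite lee_fin sqr_ge0.
  by apply: eq_integral => x _; rewrite qZ EFinM.
- have e1 : 0 <= 1 + e by rewrite addr_ge0// ltW.
  have e2 : 0 <= 1 + e^-1 by rewrite addr_ge0// invr_ge0 ltW.
  rewrite -!ge0_integralZl ?lee_fin//; last 4 first.
  + exact/measurable_EFinP/mq.
  + by move=> x _; rewrite lee_fin.
  + exact/measurable_EFinP/mq.
  + by move=> x _; rewrite lee_fin.
  rewrite -ge0_integralD//; last 4 first.
  + by move=> x _; rewrite -EFinM lee_fin mulr_ge0.
  + by apply/measurable_EFinP/measurable_funM => //; exact: mq.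
  + by move=> x _; rewrite -EFinM lee_fin mulr_ge0.
  + by apply/measurable_EFinP/measurable_funM => //; exact: mq.
  apply: ge0_le_integral_any => // x _; rewrite -?EFinM -?EFinD lee_fin//.
    by rewrite addr_ge0 ?mulr_ge0.
  exact: qD.
Qed.

Lemma sqr_wAMGM (e x y : R) : 0 < e ->
  (x + y) ^+ 2 <= (1 + e) * x ^+ 2 + (1 + e^-1) * y ^+ 2.
Proof.
move=> e0; rewrite -subr_ge0.
have -> : (1 + e) * x ^+ 2 + (1 + e^-1) * y ^+ 2 - (x + y) ^+ 2 = e^-1 * (e * x - y) ^+ 2.
  by field; rewrite gt_eqF.
by rewrite mulr_ge0 ?sqr_ge0// invr_ge0 ltW.
Qed.

(** Shifting both factors allows a weighted inequality to be optimized when one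
    of them is 0. *)
Lemma le_forall_shift (a s t : R) : 0 <= s -> 0 <= t ->
  (forall del, 0 < del -> a <= (s + del) * (t + del)) -> a <= s * t.
Proof.
move=> s0 t0 h; rewrite leNgt; apply/negP => ast.
have st1 : 0 < s + t + 1 by rewrite ltr_wpDl// addr_ge0.
pose del := Num.min 1 ((a - s * t) / (2 * (s + t + 1))).
have d0 : 0 < del by rewrite lt_min ltr01 divr_gt0 ?subr_gt0// mulr_gt0.
have d1 : del <= 1 by rewrite ge_min lexx.
have d2 : del * (s + t + 1) <= (a - s * t) / 2.
  rewrite -ler_pdivlMr//; apply: (@le_trans _ _ ((a - s * t) / (2 * (s + t + 1)))).
    by rewrite ge_min lexx orbT.
  by rewrite invfM mulrA.
have d3 : del * del <= del by rewrite ler_piMr// ltW.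
have := h _ d0; lra.
Qed.

Lemma sqrt_le_wAMGM (a A B : R) : 0 <= A -> 0 <= B ->
  (forall e, 0 < e -> a <= (1 + e) * A + (1 + e^-1) * B) ->
  Num.sqrt a <= Num.sqrt A + Num.sqrt B.
Proof.
move=> A0 B0 h; set s := Num.sqrt A; set t := Num.sqrt B.
have s0 : 0 <= s := sqrtr_ge0 _; have t0 : 0 <= t := sqrtr_ge0 _.
have AE : A = s ^+ 2 by rewrite sqr_sqrtr.
have BE : B = t ^+ 2 by rewrite sqr_sqrtr.
have st0 : 0 <= s + t by exact: addr_ge0.
rewrite -[leRHS]ger0_norm// -sqrtr_sqr ler_wsqrtr// expr2.
apply: le_forall_shift => // del d0.
pose x := s + del / 2; pose y := t + del / 2.
have d2 : 0 < del / 2 by rewrite divr_gt0.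
have x0 : 0 < x by rewrite ltr_wpDl.
have y0 : 0 < y by rewrite ltr_wpDl.
apply: (le_trans (h (y / x) (divr_gt0 y0 x0))).
have -> : (s + t + del) * (s + t + del) = (1 + y / x) * x ^+ 2 + (1 + (y / x)^-1) * y ^+ 2.
  have -> : s + t + del = x + y by rewrite /x /y; lra.
  by move: x y x0 y0 => x y x0 y0; field; rewrite !gt_eqF.
have xx : A <= x ^+ 2 by rewrite AE ler_sqr ?nnegrE ?(ltW x0)// lerDl ltW.
have yy : B <= y ^+ 2 by rewrite BE ler_sqr ?nnegrE ?(ltW y0)// lerDl ltW.
by apply: lerD; apply: ler_wpM2l => //; rewrite addr_ge0 ?invr_ge0 ?divr_ge0 ?(ltW x0) ?(ltW y0).
Qed.

Section seminorm_of_qform.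
Variable Q : L -> \bar R.
Hypothesis qQ : is_qform M Q.

Lemma qform_fin u : (Q u < +oo)%E -> Q u \is a fin_num.
Proof. by move=> h; rewrite ge0_fin_numE//; exact: (qform_ge0 qQ). Qed.

Lemma qform_lty (c : R) u v : M u -> M v -> M (c *: u) -> (Q u < +oo)%E -> (Q v < +oo)%E ->
  (Q (c *: u + v)%R < +oo)%E.
Proof.
move=> Mu Mv Mcu Qu Qv; apply: (le_lt_trans (qformD qQ ltr01 Mcu Mv)).
rewrite (qformZ qQ)//; apply: lte_add_pinfty; rewrite ?lte_mul_pinfty ?lee_fin ?mule_ge0 ?lee_fin ?sqr_ge0//; try exact: (qform_ge0 qQ).
Qed.

Lemma sqrt_qformZ (c : R) u : M u -> (Q u < +oo)%E ->
  Num.sqrt (fine (Q (c *: u))) = `|c| * Num.sqrt (fine (Q u)).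
Proof.
move=> Mu Qu; rewrite (qformZ qQ)// fineM ?qform_fin//=.
by rewrite sqrtrM ?sqr_ge0// sqrtr_sqr.
Qed.

Lemma sqrt_qformD u v : M u -> M v -> (Q u < +oo)%E -> (Q v < +oo)%E ->
  Num.sqrt (fine (Q (u + v))) <= Num.sqrt (fine (Q u)) + Num.sqrt (fine (Q v)).
Proof.
move=> Mu Mv Qu Qv; have fu := qform_fin Qu; have fv := qform_fin Qv.
apply: sqrt_le_wAMGM; [exact/fine_ge0/(qform_ge0 qQ)..|] => e e0.
rewrite -lee_fin EFinD !EFinM !fineK//; last first.
  apply: qform_fin; apply: (le_lt_trans (qformD qQ ltr01 Mu Mv)).
  by rewrite -(fineK fu) -(fineK fv) -!EFinM -EFinD ltry.
exact: (qformD qQ).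
Qed.

End seminorm_of_qform.

Hypotheses (M0 : M 0) (ML : forall (c : R) u v, M u -> M v -> M (c *: u + v)).

Let MZ (c : R) u : M u -> M (c *: u).
Proof. by move=> Mu; rewrite -[X in M X]addr0; exact: ML. Qed.

Let qform0 Q : is_qform M Q -> Q 0 = 0%E.
Proof. by move=> qQ; rewrite -(scale0r (0 : L)) (qformZ qQ)// expr0n mul0e. Qed.

Lemma qform_seminorm Q : is_qform M Q ->
  is_seminorm (Seminormed [set v | M v /\ (Q v < +oo)%E] (fun v => Num.sqrt (fine (Q v)))).
Proof.
move=> qQ; split => /=.
- by split=> //; rewrite qform0.
- by move=> c u v [Mu Qu] [Mv Qv]; split; [exact: ML|exact: (qform_lty qQ Mu Mv (MZ c Mu) Qu Qv)].
- by move=> v _; exact: sqrtr_ge0.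
- by move=> c v [Mv Qv]; rewrite (sqrt_qformZ qQ).
- by move=> u v [Mu Qu] [Mv Qv]; exact: (sqrt_qformD qQ).
Qed.

Lemma qform2_seminorm Q1 Q2 : is_qform M Q1 -> is_qform M Q2 ->
  is_seminorm (Seminormed [set v | [/\ M v, (Q1 v < +oo)%E & (Q2 v < +oo)%E]]
    (fun v => Num.sqrt (fine (Q1 v)) + Num.sqrt (fine (Q2 v)))).
Proof.
move=> q1 q2; split => /=.
- by split=> //; rewrite qform0.
- move=> c u v [Mu Q1u Q2u] [Mv Q1v Q2v].
  by split; [exact: ML|exact: (qform_lty q1 Mu Mv (MZ c Mu))|exact: (qform_lty q2 Mu Mv (MZ c Mu))].
- by move=> v _; rewrite addr_ge0 ?sqrtr_ge0.
- by move=> c v [Mv Q1v Q2v]; rewrite (sqrt_qformZ q1)// (sqrt_qformZ q2)// mulrDr.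
- move=> u v [Mu Q1u Q2u] [Mv Q1v Q2v].
  rewrite addrACA; apply: lerD; [exact: (sqrt_qformD q1)|exact: (sqrt_qformD q2)].
Qed.

End qforms.

Section square_integrable.
Context d (X : measurableType d) (R : realType).
Variable mu : {measure set X -> \bar R}.
Variables (D : set X) (mD : measurable D).
Implicit Types u v : X -> R.

Definition square_integrable v :=
  measurable_fun D v /\ (\int[mu]_(x in D) ((v x) ^+ 2)%:E < +oo)%E.

Lemma square_integrable_sq v : square_integrable v ->
  mu.-integrable D (EFin \o (fun x => v x ^+ 2)).
Proof.
move=> [mv fv]; apply/integrableP; split; first exact/measurable_EFinP/measurable_funX.
by under eq_integral do rewrite /= ger0_norm ?sqr_ge0//.
Qed.

Lemma square_integrableM u v : square_integrable u -> square_integrable v ->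
  mu.-integrable D (EFin \o (fun x => u x * v x)).
Proof.
move=> su sv.
apply: (le_Rintegrable mD _ (RintegrableD mD (square_integrable_sq su) (square_integrable_sq sv))).
  by apply: measurable_funM; [case: su|case: sv].
move=> x _; rewrite ler_norml; apply/andP.
by have := sqr_ge0 (u x - v x); have := sqr_ge0 (u x + v x);
  have := sqr_ge0 (u x); have := sqr_ge0 (v x); split; lra.
Qed.

Lemma Rintegral_wAMGM u v (e : R) : 0 < e -> square_integrable u -> square_integrable v ->
  `|\int[mu]_(x in D) (u x * v x)| <=
  (e * \int[mu]_(x in D) (u x ^+ 2) + e^-1 * \int[mu]_(x in D) (v x ^+ 2)) / 2.
Proof.
move=> e0 su sv.
have iu := square_integrable_sq su; have iv := square_integrable_sq sv.
have iuv := square_integrableM su sv.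
apply: (le_trans (le_normr_Rintegral mD iuv)).
rewrite -!RintegralZl// -RintegralD//; [|exact: RintegrableZ..].
rewrite -RintegralZr//; last by apply: RintegrableD => //; exact: RintegrableZ.
apply: le_Rintegral => //; first exact: integrable_norm.
  have := RintegrableZ mD (2^-1) (RintegrableD mD (RintegrableZ mD e iu) (RintegrableZ mD e^-1 iv)).
  by apply: eq_Rintegrable => // x _; rewrite mulrC.
move=> x _; rewrite ler_norml; apply/andP.
have h1 := mulr_ge0 (ltW (_ : 0 < e^-1)) (sqr_ge0 (e * u x - v x)).
have h2 := mulr_ge0 (ltW (_ : 0 < e^-1)) (sqr_ge0 (e * u x + v x)).
rewrite invr_gt0 in h1 h2; move: h1 h2 => /(_ e0) h1 /(_ e0) h2.
have E1 : e^-1 * (e * u x - v x) ^+ 2 = e * u x ^+ 2 + e^-1 * v x ^+ 2 - 2 * (u x * v x).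
  by field; rewrite gt_eqF.
have E2 : e^-1 * (e * u x + v x) ^+ 2 = e * u x ^+ 2 + e^-1 * v x ^+ 2 + 2 * (u x * v x).
  by field; rewrite gt_eqF.
by rewrite E1 in h1; rewrite E2 in h2; split; lra.
Qed.

Lemma Rintegral_cauchy_schwarz u v : square_integrable u -> square_integrable v ->
  `|\int[mu]_(x in D) (u x * v x)| <=
  Num.sqrt (\int[mu]_(x in D) (u x ^+ 2)) * Num.sqrt (\int[mu]_(x in D) (v x ^+ 2)).
Proof.
move=> su sv; set A := \int[mu]_(x in D) (u x ^+ 2); set B := \int[mu]_(x in D) (v x ^+ 2).
have A0 : 0 <= A by apply: Rintegral_ge0 => x _; exact: sqr_ge0.
have B0 : 0 <= B by apply: Rintegral_ge0 => x _; exact: sqr_ge0.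
apply: le_forall_shift => [||del d0]; [exact: sqrtr_ge0..|].
set x := Num.sqrt A + del; set y := Num.sqrt B + del.
have x0 : 0 < x by rewrite ltr_wpDl ?sqrtr_ge0.
have y0 : 0 < y by rewrite ltr_wpDl ?sqrtr_ge0.
apply: (le_trans (Rintegral_wAMGM (divr_gt0 y0 x0) su sv)); rewrite -/A -/B.
have xx : A <= x ^+ 2.
  by rewrite -[leLHS]sqr_sqrtr// ler_sqr ?nnegrE ?sqrtr_ge0 ?(ltW x0)// lerDl ltW.
have yy : B <= y ^+ 2.
  by rewrite -[leLHS]sqr_sqrtr// ler_sqr ?nnegrE ?sqrtr_ge0 ?(ltW y0)// lerDl ltW.
have -> : x * y = (y / x * x ^+ 2 + (y / x)^-1 * y ^+ 2) / 2 by field; rewrite !gt_eqF.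
by rewrite ler_wpM2r// lerD// ler_wpM2l// ?invr_ge0 divr_ge0// ltW.
Qed.

Lemma bounded_square_integrable v (B : R) : (mu D < +oo)%E -> measurable_fun D v ->
  (forall x, D x -> `|v x| <= B) -> square_integrable v.
Proof.
move=> Dfin mv vB; split => //.
have : mu.-integrable D (EFin \o (fun x => v x ^+ 2)).
  apply: (@Rintegrable_bounded _ _ _ mu _ mD _ (B ^+ 2)) => //.
    exact: measurable_funX.
  move=> x Dx; have := vB _ Dx => h.
  by rewrite ger0_norm ?sqr_ge0// -[leLHS]real_normK ?num_real// ler_sqr ?nnegrE// (le_trans _ h).
case/integrableP => _; apply: le_lt_trans.
by apply: ge0_le_integral_any => // x _; rewrite ?lee_fin ?sqr_ge0//= ger0_norm ?sqr_ge0.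
Qed.

End square_integrable.

(** * Borel sets and simplices *)

Section borel_rV.
Variables (R : realType) (n : nat).
Local Notation E := 'rV[R]_n.

Let box (p : 'rV[rat]_n * nat) : set E :=
  [set x | forall i, `|ratr (p.1 ord0 i) - x ord0 i| < p.2.+1%:R^-1].

Let measurable_box p : measurable (box p).
Proof.
rewrite (_ : box p = \bigcap_(i in [set: 'I_n])
    [set x : E | `|ratr (p.1 ord0 i) - x ord0 i| < p.2.+1%:R^-1]); last first.
  by apply/seteqP; split=> x h i; [move=> _; exact: h|exact: h].
apply: fin_bigcap_measurable => // i _.
rewrite (_ : [set _ | _] = (fun x : E => x ord0 i) @^-1`
    [set y : R | `|ratr (p.1 ord0 i) - y| < p.2.+1%:R^-1])//.
rewrite -[X in measurable X]setTI; apply: measurable_coord => //.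
rewrite (_ : [set y | _] = ball (ratr (p.1 ord0 i) : R) p.2.+1%:R^-1)//.
exact: measurable_ball.
Qed.

(** Open sets are countable unions of boxes with rational centres. *)
Lemma open_measurable_rV (A : set E) : open A -> measurable A.
Proof.
move=> oA.
pose F k : set E := if unpickle k is Some p then
  if `[< box p `<=` A >] then box p else set0 else set0.
have -> : A = \bigcup_k F k.
  apply/seteqP; split=> [x Ax|x [k _]]; last first.
    rewrite /F; case: unpickle => [p|//]; case: asboolP => // h; exact: h.
  have /nbhs_ballP[e /= e0 he] : nbhs x A by exact: open_nbhs_nbhs.
  have [k hk] : exists k : nat, k.+1%:R^-1 < e / 2.
    have e2 : 0 < (e / 2)^-1 by rewrite invr_gt0 divr_gt0.
    exists (Num.bound (e / 2)^-1); rewrite invf_plt ?posrE ?divr_gt0//.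
    by apply: lt_trans (archi_boundP (ltW e2)) _; rewrite ltr_nat.
  have k0 : 0 < (k.+1%:R^-1 : R) by rewrite invr_gt0.
  have /choice[c hc] : forall i : 'I_n, exists c : rat, `|ratr c - x ord0 i| < k.+1%:R^-1.
    move=> i; have [c] := @rat_in_itvoo R (x ord0 i - k.+1%:R^-1) (x ord0 i + k.+1%:R^-1)
      ltac:(by rewrite ltrD2l gtrN).
    rewrite in_itv/= => /andP[c1 c2]; exists c; rewrite ltr_norml.
    by move: c1 c2; move: (k.+1%:R^-1) => z c1 c2; apply/andP; split; lra.
  pose p : 'rV[rat]_n * nat := (\row_i c i, k).
  exists (pickle p) => //; rewrite /F pickleK asboolT.
    by move=> i; rewrite /= mxE.
  move=> y hy; apply: he; split => // i j; rewrite (ord1 i).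
  have := hy j; rewrite /= mxE => h1; have h2 := hc j.
  rewrite /ball/= (le_lt_trans (ler_distD (ratr (c j)) _ _))//.
  rewrite distrC; move: h1 h2 hk; move: (k.+1%:R^-1) => z; lra.
apply: bigcupT_measurable => k; rewrite /F.
by case: unpickle => [p|//]; case: asboolP => // _; exact: measurable_box.
Qed.

Lemma bounded_finite_measure (A : set E) : measurable A -> bounded_set A ->
  (lebesgue_rV R n A < +oo)%E.
Proof.
move=> mA [M [Mr hM]]; pose N : R := `|M| + 1.
have hN x : A x -> `|x| <= N by apply: hM; rewrite /N (le_lt_trans (ler_norm _))// ltrDl.
have N0 : 0 <= N by rewrite addr_ge0.
pose a : E := \row_i (- N); pose b : E := \row_i N.
have ab i : a ord0 i <= b ord0 i by rewrite !mxE; lra.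
have mB : measurable [set x : E | forall i, a ord0 i <= x ord0 i <= b ord0 i].
  rewrite [X in measurable X](_ : _ = \bigcap_(i in [set: 'I_n])
     [set x : E | a ord0 i <= x ord0 i <= b ord0 i]).
    apply: fin_bigcap_measurable => // i _.
    rewrite [X in measurable X](_ : _ = (fun x : E => x ord0 i) @^-1`
      `[a ord0 i, b ord0 i]%classic).
      by rewrite -[X in measurable X]setTI; exact: measurable_coord.
    by apply/seteqP; split=> x /=; rewrite in_itv.
  by apply/seteqP; split=> x /= h i; [move=> _; exact: h|exact: h].
apply: (@le_lt_trans _ _ (lebesgue_rV R n [set x : E | forall i, a ord0 i <= x ord0 i <= b ord0 i])).
  apply: le_measure; rewrite ?inE// => x Ax i; rewrite !mxE -ler_norml.
  apply: le_trans (hN _ Ax); rewrite -[leRHS]/(mx_norm x) mx_normrE.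
  exact: (le_bigmax _ (fun p : 'I_1 * 'I_n => `|x p.1 p.2|) (ord0, i)).
by rewrite lebesgue_rV_box// ltry.
Qed.

Lemma measurable_mulmx_coord m (A : 'M[R]_(n, m)) (j : 'I_m) :
  measurable_fun setT (fun x : E => (x *m A) ord0 j).
Proof.
under eq_fun do rewrite mxE.
apply: measurable_sum => i; apply: measurable_funM => //; exact: measurable_coord.
Qed.

Lemma measurable_rV_sub : measurable_fun setT (fun z : E * E => z.1 - z.2).
Proof.
apply/measurable_fun_coordP => i; under eq_fun do rewrite !mxE.
by apply: measurable_funB; [exact: (measurableT_comp (measurable_coord i) measurable_fst)|
  exact: (measurableT_comp (measurable_coord i) measurable_snd)].
Qed.

Lemma measurable_enorm : measurable_fun setT (@enorm R n).
Proof.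
have -> : @enorm R n = @Num.sqrt R \o (fun x => edot x x) by [].
apply: measurableT_comp.
  by apply: continuous_measurable_fun => x; exact: sqrt_continuous.
by apply: measurable_sum => i; apply: measurable_funM; exact: measurable_coord.
Qed.

Lemma measurable_kernel (a : R) (D : set (E * E)) :
  measurable_fun D (fun z : E * E => (enorm (z.1 - z.2) `^ a)^-1).
Proof.
apply: measurable_funTS.
have -> : (fun z : E * E => (enorm (z.1 - z.2) `^ a)^-1) =
    (fun x : R => x `^ (-1)) \o (fun x : R => x `^ a) \o (fun z : E * E => enorm (z.1 - z.2)).
  by apply/funext => z /=; rewrite powR_inv1// powR_ge0.
apply: measurableT_comp; first apply: measurableT_comp.
- exact: measurable_powR.
- exact: measurable_powR.
exact: (measurableT_comp measurable_enorm measurable_rV_sub).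
Qed.

End borel_rV.
Section simplices.
Variables (R : realType) (n k : nat).
Local Notation E := 'rV[R]_n.
Implicit Types (K : 'M[R]_(k.+1, n)) (G : seq 'M[R]_(k.+1, n)).

Let std_of_bary (c : 'rV[R]_k.+1) : 'rV[R]_k := \row_j c ord0 (lift ord0 j).

Let bary_of_std (y : 'rV[R]_k) : 'rV[R]_k.+1 :=
  \row_i (if unlift ord0 i is Some j then y ord0 j else 1 - \sum_j y ord0 j).

Let sum_bary (c : 'rV[R]_k.+1) :
  \sum_i c ord0 i = c ord0 ord0 + \sum_j std_of_bary c ord0 j.
Proof. by rewrite big_ord_recl; congr (_ + _); apply: eq_bigr => j _; rewrite mxE. Qed.

Let bary_mul K (c : 'rV[R]_k.+1) : \sum_i c ord0 i = 1 ->
  c *m K = param K (std_of_bary c).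
Proof.
move=> c1; apply/rowP => j; rewrite !mxE big_ord_recl.
have -> : c ord0 ord0 = 1 - \sum_i std_of_bary c ord0 i.
  by rewrite -c1 sum_bary addrK.
rewrite mulrBl mul1r mulr_suml -addrA; congr (_ + _).
rewrite addrC -sumrB; apply: eq_bigr => i _; rewrite !mxE.
by rewrite mulrBr.
Qed.

Let bary_of_stdK y : std_of_bary (bary_of_std y) = y.
Proof. by apply/rowP => j; rewrite !mxE liftK. Qed.

Let sum_bary_of_std y : \sum_i bary_of_std y ord0 i = 1.
Proof. by rewrite sum_bary bary_of_stdK mxE unlift_none subrK. Qed.

Lemma param_simplex K y : std_simplex y -> simplex K (param K y).
Proof.
move=> [y0 y1]; exists (bary_of_std y); last first.
  by rewrite bary_mul ?bary_of_stdK.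
split=> [i|]; last exact: sum_bary_of_std.
by rewrite mxE; case: unliftP => [j _|_]; [exact: y0|rewrite subr_ge0].
Qed.

Lemma measurable_param K : measurable_fun setT (@param R n k K).
Proof.
apply/measurable_fun_coordP => i; under eq_fun do rewrite mxE.
by apply: measurable_funD => //; exact: measurable_mulmx_coord.
Qed.

Lemma measurable_std_simplex : measurable (@std_simplex R k).
Proof.
rewrite (_ : @std_simplex R k = \bigcap_(i in [set: 'I_k]) [set y | 0 <= y ord0 i] `&`
   [set y | \sum_i y ord0 i <= 1]); last first.
  apply/seteqP; split=> y [h1 h2]; split => // i; first by move=> _; exact: h1.
  exact: h1.
apply: measurableI.
  apply: fin_bigcap_measurable => // i _.
  rewrite -[X in measurable X]setTI.
  apply: (measurable_fun_ler (f := cst 0) (g := fun y : 'rV[R]_k => y ord0 i)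
    _ _ measurableT (Y := [set true])) => //; exact: measurable_coord.
rewrite -[X in measurable X]setTI.
apply: (measurable_fun_ler (f := fun y : 'rV[R]_k => \sum_i y ord0 i) (g := cst 1)
    _ _ measurableT (Y := [set true])) => //.
by apply: measurable_sum => i; exact: measurable_coord.
Qed.

Lemma std_simplex_finite_measure : (lebesgue_rV R k (@std_simplex R k) < +oo)%E.
Proof.
apply: bounded_finite_measure; first exact: measurable_std_simplex.
exists 1; split; first exact: num_real.
move=> M M1 y [y0 y1]; apply: (le_trans _ (ltW M1)).
rewrite -[leLHS]/(mx_norm y) mx_normrE; apply: bigmax_le => // -[i j] _ /=.
rewrite (ord1 i) ger0_norm//; apply: le_trans y1.
by rewrite (bigD1 j)//= lerDl; apply: sumr_ge0.
Qed.

Section one_simplex.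
Variable K : 'M[R]_(k.+1, n).
Hypothesis nK : Defs.nondegenerate K.

(** Barycentric coordinates are affine functions of the point, through a left
    inverse of the matrix of edges; this makes simplices measurable. *)
Let coords (x : E) : 'rV[R]_k := (x - row ord0 K) *m pinvmx (edges K).

Let paramK y : coords (param K y) = y.
Proof. by rewrite /coords /param addrAC subrr add0r mulmxKp. Qed.

Let measurable_coords j : measurable_fun setT (fun x : E => coords x ord0 j).
Proof.
rewrite /coords; under eq_fun do rewrite mulmxBl mxE [X in _ + X]mxE.
by apply: measurable_funB => //; exact: measurable_mulmx_coord.
Qed.

Let measurable_image : measurable [set x : E | param K (coords x) = x].
Proof.
rewrite (_ : [set x | _] = \bigcap_(j in [set: 'I_n])
   [set x : E | param K (coords x) ord0 j == x ord0 j]); last first.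
  apply/seteqP; split=> [x /= e j _|x h]; first by rewrite /= e.
  by apply/rowP => j; apply/eqP; exact: (h j).
apply: fin_bigcap_measurable => // j _; rewrite -[X in measurable X]setTI.
apply: (measurable_fun_eqr _ _ measurableT (Y := [set true])) => //.
  rewrite /param; under eq_fun do rewrite mxE [X in _ + X]mxE.
  apply: measurable_funD => //; apply: measurable_sum => i.
  by apply: measurable_funM.
exact: measurable_coord.
Qed.

Let bary_coords (c : 'rV[R]_k.+1) : \sum_i c ord0 i = 1 ->
  [/\ param K (coords (c *m K)) = c *m K,
      forall j, c ord0 (lift ord0 j) = coords (c *m K) ord0 j &
      c ord0 ord0 = 1 - \sum_j coords (c *m K) ord0 j].
Proof.
move=> c1; rewrite (bary_mul K c1) paramK; split => //.
  by move=> j; rewrite mxE.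
by rewrite -c1 sum_bary addrK.
Qed.

Lemma measurable_simplex : measurable (simplex K).
Proof.
rewrite (_ : simplex K = [set x | param K (coords x) = x] `&`
    (coords @^-1` @std_simplex R k)); last first.
  apply/seteqP; split=> [x [c [c0 c1] ->]|x [/= e h]].
    have [e cj c00] := bary_coords c1; split => //; split=> [j|].
      by rewrite -cj.
    by rewrite -subr_ge0 -c00.
  by rewrite -e; exact: param_simplex.
apply: measurableI => //; rewrite -[X in measurable X]setTI.
apply: (_ : measurable_fun setT coords) => //; last exact: measurable_std_simplex.
by apply/measurable_fun_coordP.
Qed.

Lemma measurable_open_simplex : measurable (open_simplex K).
Proof.
rewrite (_ : open_simplex K = [set x | param K (coords x) = x] `&`
    (\bigcap_(j in [set: 'I_k]) [set x | 0 < coords x ord0 j] `&`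
     [set x | \sum_j coords x ord0 j < 1])); last first.
  apply/seteqP; split=> [x [c [[c0 c1] c2 ->]]|x [/= e [h1 h2]]].
    have [e cj c00] := bary_coords c1; split => //; split=> [j _|] /=.
      by rewrite -cj.
    by rewrite -subr_gt0 -c00.
  exists (bary_of_std (coords x)).
  have pos i : 0 < bary_of_std (coords x) ord0 i.
    rewrite mxE; case: unliftP => [j _|_]; first exact: (h1 j).
    by rewrite subr_gt0.
  split => //; last by rewrite bary_mul ?bary_of_stdK.
  by split=> [i|]; [exact: ltW|exact: sum_bary_of_std].
apply: measurableI => //; apply: measurableI.
  apply: fin_bigcap_measurable => // j _; rewrite -[X in measurable X]setTI.
  exact: (measurable_fun_ltr (f := cst 0) _ _ measurableT (Y := [set true])).
rewrite -[X in measurable X]setTI.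
apply: (measurable_fun_ltr (g := cst 1) _ _ measurableT (Y := [set true])) => //.
by apply: measurable_sum => i.
Qed.

End one_simplex.

Lemma measurable_polyhedron G : (forall K, K \in G -> Defs.nondegenerate K) ->
  measurable (polyhedron G).
Proof.
move=> nG; rewrite (_ : polyhedron G = \bigcup_(K in [set` G]) simplex K).
  apply: fin_bigcup_measurable; first exact: finite_seq.
  by move=> K /nG; exact: measurable_simplex.
by apply/seteqP; split=> x [K KG Kx]; exists K.
Qed.

Lemma piecewise_constant_bounded G g : (forall K, K \in G -> Defs.nondegenerate K) ->
  piecewise_constant G g ->
  measurable_fun setT (g : E -> R) /\ exists B : R, 0 <= B /\ forall x, `|g x| <= B.
Proof.
move=> nG [c ->]; split.
  have H s : {subset s <= G} ->
      measurable_fun setT (fun x : E => \sum_(K <- s) c K * \1_(open_simplex K) x : R).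
    elim: s => [|K s IH] sG; first by under eq_fun do rewrite big_nil; exact: measurable_cst.
    under eq_fun do rewrite big_cons; apply: measurable_funD.
      apply: measurable_funM => //; apply: measurable_indic.
      by apply: measurable_open_simplex; apply: nG; apply: sG; rewrite mem_head.
    by apply: IH => L Ls; apply: sG; rewrite inE Ls orbT.
  exact: H.
exists (\sum_(K <- G) `|c K|); split; first by apply: sumr_ge0.
move=> x; apply: (le_trans (ler_norm_sum _ _ _)); apply: ler_sum => K _.
rewrite normrM ler_piMr// indicE.
by case: (_ \in _); rewrite /= ?normr1 ?normr0.
Qed.

End simplices.

(** * Sobolev seminorms *)

Section closures.
Variables (R : realType) (L : lmodType R) (V : seminormed L).
Hypothesis sV : is_seminorm V.

Lemma closure_in_seminorm (A : set L) : A 0 ->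
  (forall (c : R) u v, A u -> A v -> A (c *: u + v)) -> is_seminorm (closure_in V A).
Proof.
move=> A0 AL; split=> /=.
- split=> [|e e0]; first exact: carrier0.
  by exists 0; split=> //; [exact: carrier0|rewrite subrr (nrm0 sV)].
- move=> c u v [Vu uA] [Vv vA]; split; first exact: carrierL.
  move=> e e0; have c0 : 0 < `|c| + 1 by rewrite ltr_wpDl.
  have [u' [Au' Vu' uu']] := uA (e / 2 / (`|c| + 1)) (divr_gt0 (divr_gt0 e0 (ltr0n _ 2)) c0).
  have [v' [Av' Vv' vv']] := vA (e / 2) (divr_gt0 e0 (ltr0n _ 2)).
  exists (c *: u' + v'); split; [exact: AL|exact: carrierL|].
  have -> : c *: u + v - (c *: u' + v') = c *: (u - u') + (v - v').
    by rewrite scalerBr opprD addrACA.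
  have Vuu := carrierB sV Vu Vu'; have Vvv := carrierB sV Vv Vv'.
  apply: (le_lt_trans (nrmD sV (carrierZ sV c Vuu) Vvv)).
  rewrite (nrmZ sV)// [e in _ < e](_ : _ = e / 2 + e / 2); last lra.
  apply: ler_ltD => //.
  apply: (@le_trans _ _ ((`|c| + 1) * nrm V (u - u'))).
    by rewrite ler_wpM2r ?lerDl// (nrm_ge0 sV).
  by rewrite mulrC -ler_pdivlMr// ltW.
- by move=> v [Vv _]; exact: (nrm_ge0 sV).
- by move=> c v [Vv _]; exact: (nrmZ sV).
- by move=> u v [Vu _] [Vv _]; exact: (nrmD sV).
Qed.

End closures.

Section smooth_functions.
Variables (R : realType) (n : nat).
Local Notation E := 'rV[R]_n.

Lemma dir_derive_lin (f g : E -> R) (c : R) : smooth_fun f -> smooth_fun g ->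
  forall vs, dir_derive vs (c *: (f : E -> R^o) + g) =
    c *: (dir_derive vs f : E -> R^o) + dir_derive vs g.
Proof.
move=> sf sg; elim=> [//|v vs IH] /=; rewrite IH; apply/funext => x.
have df := diff_derivable (v := v) (sf vs x).
have dg := diff_derivable (v := v) (sg vs x).
have dcf : derivable (c *: (dir_derive vs f : E -> R^o)) x v := @derivableZ _ _ _ _ c x v df.
by rewrite (@deriveD _ E R^o _ _ x v dcf dg) (@deriveZ _ E R^o _ c x v df).
Qed.

Lemma smooth_fun_lin (f g : E -> R) (c : R) : smooth_fun f -> smooth_fun g ->
  smooth_fun (c *: (f : E -> R^o) + g).
Proof.
move=> sf sg vs x; rewrite (dir_derive_lin c sf sg vs).
apply: (@differentiableD _ E R^o _ _ x _ (sg vs x)).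
exact: (@differentiableZ _ E R^o _ c x (sf vs x)).
Qed.

Lemma smooth_fun0 : smooth_fun (0 : E -> R).
Proof.
move=> vs x; suff -> : dir_derive vs (0 : E -> R) = 0 by exact: differentiable_cst.
elim: vs => [//|v vs IH] /=; rewrite IH; apply/funext => y.
by rewrite -[0 : E -> R]/(cst 0) derive_cst.
Qed.

End smooth_functions.

Section function_spaces.
Variables (R : realType) (n : nat).
Local Notation E := 'rV[R]_n.
Local Notation fn := (E -> R^o).
Local Notation mu := (lebesgue_rV R n).

(** All the seminorms at hand are square roots of integrals of squares, of values
    at a point p x or of differences between the values at p x and p' x; the map
    p is the identity, a projection or the parametrization of a simplex. *)
Lemma L2_qform d (X : measurableType d) (nu : {measure set X -> \bar R}) (D : set X)
    (M : set fn) (p : X -> E) : measurable D ->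
  (forall u : fn, M u -> measurable_fun D (fun x => u (p x) : R)) ->
  is_qform M (fun u : fn => \int[nu]_(x in D) ((u (p x)) ^+ 2)%:E)%E.
Proof.
move=> mD mM; apply: (@qform_integral _ fn M _ _ _ _ (fun (u : fn) x => (u (p x) : R) ^+ 2)) => //.
- by move=> u Mu; apply: measurable_funX; exact: mM.
- by move=> u x; exact: sqr_ge0.
- by move=> c u x; rewrite /= exprMn.
- by move=> e u v x e0; exact: sqr_wAMGM.
Qed.

Lemma difference_qform d (X : measurableType d) (nu : {measure set X -> \bar R}) (D : set X)
    (M : set fn) (p p' : X -> E) (w : X -> R) : measurable D -> measurable_fun D w ->
  (forall x, 0 <= w x) ->
  (forall u : fn, M u -> measurable_fun D (fun x => u (p x) : R) /\
     measurable_fun D (fun x => u (p' x) : R)) ->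
  is_qform M (fun u : fn => \int[nu]_(x in D) ((u (p x) - u (p' x)) ^+ 2 * w x)%:E)%E.
Proof.
move=> mD mw w0 mM.
apply: (@qform_integral _ fn M _ _ _ _ (fun (u : fn) x => (u (p x) - u (p' x) : R) ^+ 2 * w x)) => //.
- move=> u /mM[m1 m2]; apply: measurable_funM => //; apply: measurable_funX.
  exact: measurable_funB.
- by move=> u x; rewrite mulr_ge0 ?sqr_ge0.
- by move=> c u x; rewrite /= -scalerBr mulrA exprMn.
- move=> e u v x e0.
  have -> : (u + v) (p x) - (u + v) (p' x) = (u (p x) - u (p' x)) + (v (p x) - v (p' x)) :> R.
    by rewrite /= opprD addrACA.
  apply: (le_trans (ler_wpM2r (w0 x) (sqr_wAMGM _ _ e0))).
  by rewrite mulrDl -(mulrA (1 + e)) -(mulrA (1 + e^-1)).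
Qed.

Let measurable0 (D : set E) : measurable_fun D ((0 : fn) : E -> R).
Proof. exact: measurable_cst. Qed.

Let measurable_lin (D : set E) : forall (c : R) (u v : fn), measurable_fun D (u : E -> R) ->
  measurable_fun D (v : E -> R) -> measurable_fun D ((c *: u + v : fn) : E -> R).
Proof.
by move=> c u v mu' mv; apply: measurable_funD => //; exact: measurable_funM.
Qed.

Lemma L2_space_seminorm (D : set E) : measurable D -> is_seminorm (L2_space D).
Proof.
move=> mD; have q : is_qform [set v : fn | measurable_fun D (v : E -> R)]
    (fun u : fn => \int[mu]_(x in D) ((u x) ^+ 2)%:E)%E.
  exact: (@L2_qform _ _ mu D _ id mD).
exact: (qform_seminorm (@measurable0 D) (@measurable_lin D) q).
Qed.

Lemma L2_inner_product (D : set E) : measurable D ->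
  is_inner_product (L2_space D) (dotL2 D).
Proof.
move=> mD; split=> [c u v w hu hv hw|u v|u hu|u v hu hv].
- have iu := square_integrableM mD hu hw; have iv := square_integrableM mD hv hw.
  rewrite /dotL2 -RintegralZl// -RintegralD//; last exact: RintegrableZ.
  by apply: eq_Rintegral => x _; rewrite /= mulrDl mulrA.
- by apply: eq_Rintegral => x _; rewrite mulrC.
- by rewrite /= sqr_sqrtr//; apply: Rintegral_ge0 => x _; exact: sqr_ge0.
- exact: Rintegral_cauchy_schwarz.
Qed.

Let measurable_factors (G : set E) d (Y : measurableType d) (D : set Y) (u : fn)
  (p : Y -> E) : measurable G -> measurable D -> measurable_fun setT p ->
  D `<=` p @^-1` G -> measurable_fun G (u : E -> R) -> measurable_fun D (fun y => u (p y) : R).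
Proof.
move=> mG mD mp Dp mu'; apply: (measurable_comp mG _ mu').
  by move=> _ [y Dy <-]; exact: Dp.
exact: measurable_funTS.
Qed.

Lemma measurable_fun_setX_fst (D D' : set E) (u : fn) : measurable D -> measurable D' ->
  measurable_fun D (u : E -> R) -> measurable_fun (D `*` D') (fun z => u z.1 : R).
Proof.
move=> mD mD' mu'; apply: (measurable_factors mD) => //; first exact: measurableX.
by move=> z [].
Qed.

Lemma measurable_fun_setX_snd (D D' : set E) (u : fn) : measurable D -> measurable D' ->
  measurable_fun D' (u : E -> R) -> measurable_fun (D `*` D') (fun z => u z.2 : R).
Proof.
move=> mD mD' mu'; apply: (measurable_factors mD') => //; first exact: measurableX.
by move=> z [].
Qed.

Lemma Hs_seminorm (D : set E) (s : R) : measurable D -> is_seminorm (Hs D s).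
Proof.
move=> mD; have q1 : is_qform [set v : fn | measurable_fun D (v : E -> R)]
    (fun u : fn => \int[mu]_(x in D) ((u x) ^+ 2)%:E)%E.
  exact: (@L2_qform _ _ mu D _ id mD).
have q2 : is_qform [set v : fn | measurable_fun D (v : E -> R)] (slobodeckij D s).
  apply: (@difference_qform _ _ (mu \x mu)%E _ _ fst snd) => //.
  - exact: measurableX.
  - exact: measurable_kernel.
  - by move=> z; rewrite invr_ge0 powR_ge0.
  - by move=> u Mu; split; [exact: measurable_fun_setX_fst|exact: measurable_fun_setX_snd].
have := qform2_seminorm (@measurable0 D) (@measurable_lin D) q1 q2.
congr is_seminorm; congr Seminormed.
by apply/seteqP; split=> v [] // [].
Qed.

Lemma Hs_vanishing_seminorm (D : set E) (s : R) (A : set E) : measurable D ->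
  is_seminorm (Hs_vanishing D s A).
Proof.
move=> mD; apply: closure_in_seminorm; first exact: Hs_seminorm.
  by split=> //; exact: smooth_fun0.
move=> c u v [su u0] [sv v0]; split; first exact: smooth_fun_lin.
by move=> x Ax; rewrite -[LHS]/(c * u x + v x : R) u0// v0// mulr0 addr0.
Qed.

Section surfaces.
Variables (k : nat) (G : seq 'M[R]_(k.+1, n)).
Hypothesis nG : forall K, K \in G -> Defs.nondegenerate K.
Local Notation nu := (lebesgue_rV R k).
Local Notation S := (@std_simplex R k).

Lemma jac_ge0 (K : 'M[R]_(k.+1, n)) : 0 <= jac K.
Proof. exact: sqrtr_ge0. Qed.

Lemma measurable_on_simplex (K : 'M[R]_(k.+1, n)) (v : fn) : K \in G ->
  measurable_fun (polyhedron G) (v : E -> R) -> measurable_fun S (fun y => v (param K y) : R).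
Proof.
move=> KG; apply: (measurable_factors) => //.
- exact: measurable_polyhedron.
- exact: measurable_std_simplex.
- exact: measurable_param.
- by move=> y Sy; exists K => //; exact: param_simplex.
Qed.

Lemma Hs_surf_seminorm (r : R) : is_seminorm (Hs_surf G r).
Proof.
have mS : measurable S := @measurable_std_simplex R k.
apply: (qform2_seminorm (@measurable0 _) (@measurable_lin _)).
  apply: qform_sum => K KG; apply: qform_scale; first exact: jac_ge0.
  by apply: L2_qform => // u; exact: measurable_on_simplex.
apply: qform_sum => K KG; apply: qform_sum => K' KG'.
apply: qform_scale; first by rewrite mulr_ge0 ?jac_ge0.
apply: (@difference_qform _ _ (nu \x nu)%E _ _ (fun z => param K z.1) (fun z => param K' z.2)
  (fun z => (enorm (param K z.1 - param K' z.2) `^ (k%:R + 2 * r))^-1)).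
- exact: measurableX.
- have mk := @measurable_kernel R n (k%:R + 2 * r) setT.
  have mp : measurable_fun setT (fun z : 'rV[R]_k * 'rV[R]_k => (param K z.1, param K' z.2)).
    apply/measurable_fun_pairP; split => /=.
      exact: (measurableT_comp (measurable_param K) measurable_fst).
    exact: (measurableT_comp (measurable_param K') measurable_snd).
  by have h := measurableT_comp mk mp; apply: measurable_funTS.
- by move=> z; rewrite invr_ge0 powR_ge0.
- have mP := measurable_polyhedron nG; have mSS : measurable (S `*` S) by exact: measurableX.
  move=> u Mu; split.
    apply: (measurable_factors mP mSS _ _ Mu).
      exact: (measurableT_comp (measurable_param K) measurable_fst).
    by move=> z [Sz _]; exists K => //; exact: param_simplex.
  apply: (measurable_factors mP mSS _ _ Mu).
    exact: (measurableT_comp (measurable_param K') measurable_snd).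
  by move=> z [_ Sz]; exists K' => //; exact: param_simplex.
Qed.

End surfaces.
End function_spaces.

(** * The energy form *)

Section energies.
Variables (R : realType) (n : nat) (Om : set 'rV[R]_n) (s : R).
Local Notation E := 'rV[R]_n.
Local Notation fn := (E -> R^o).
Local Notation mu := (lebesgue_rV R n).
Hypothesis mOm : measurable Om.

Let D2 : set (E * E) := Om `*` setT `|` setT `*` Om.

Let mD2 : measurable D2.
Proof. by apply: measurableU; exact: measurableX. Qed.

(** The difference quotient whose square is the energy density, so that the
    energy is an L2 inner product. *)
Definition weighted_diff (u : fn) (z : E * E) : R :=
  ((u \_ Om) z.1 - (u \_ Om) z.2) * Num.sqrt ((enorm (z.1 - z.2) `^ (n%:R + 2 * s))^-1).

Definition finite_energy (u : fn) := square_integrable (mu \x mu)%E D2 (weighted_diff u).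

Lemma energyE (u v : fn) : energy Om s u v =
  c_ns n s / 2 * \int[(mu \x mu)%E]_(z in D2) (weighted_diff u z * weighted_diff v z).
Proof.
congr (_ * _); apply: eq_Rintegral => z _; rewrite /weighted_diff mulrACA.
by rewrite -expr2 sqr_sqrtr// invr_ge0 powR_ge0.
Qed.

Let weighted_diff_lin (c : R) (u v : fn) z :
  weighted_diff (c *: u + v) z = c * weighted_diff u z + weighted_diff v z.
Proof.
rewrite /weighted_diff mulrA -mulrDl; congr (_ * _).
rewrite mulrBr addrACA -opprD; congr (_ - _).
  by rewrite /patch; case: ifP => _; rewrite ?mulr0 ?addr0.
by rewrite /patch; case: ifP => _; rewrite ?mulr0 ?addr0.
Qed.

Lemma energy_lin (c : R) (u v w : fn) : finite_energy u -> finite_energy v ->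
  finite_energy w -> energy Om s (c *: u + v) w = c * energy Om s u w + energy Om s v w.
Proof.
move=> hu hv hw; rewrite !energyE mulrCA -mulrDr; congr (_ * _).
have iu := square_integrableM mD2 hu hw; have iv := square_integrableM mD2 hv hw.
rewrite -RintegralZl// -RintegralD//; last exact: RintegrableZ.
by apply: eq_Rintegral => x _; rewrite weighted_diff_lin mulrDl mulrA.
Qed.

Lemma energy_sym (u v : fn) : energy Om s u v = energy Om s v u.
Proof. by rewrite !energyE; congr (_ * _); apply: eq_Rintegral => z _; rewrite mulrC. Qed.

Let measurable_ext (u : fn) : measurable_fun Om (u : E -> R) ->
  measurable_fun setT (u \_ Om : E -> R).
Proof. by move=> mu'; apply/(measurable_restrictT _ mOm). Qed.

Let measurable_weighted_diff (u : fn) (D : set (E * E)) : measurable_fun Om (u : E -> R) ->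
  measurable_fun D (weighted_diff u).
Proof.
move=> /measurable_ext mu'; apply: measurable_funTS.
apply: measurable_funM; last first.
  apply: (measurableT_comp (f := @Num.sqrt R)); last exact: measurable_kernel.
  by apply: continuous_measurable_fun => x; exact: sqrt_continuous.
by apply: measurable_funB; [exact: (measurableT_comp mu' measurable_fst)|
  exact: (measurableT_comp mu' measurable_snd)].
Qed.

(* such a function vanishes a.e., hence so does its difference quotient *)
Let null_finite_energy (u : fn) : carrier (L2_space Om) u -> nrm (L2_space Om) u = 0 ->
  finite_energy u.
Proof.
move=> [mu' fu] /= /eqP; rewrite sqrtr_eq0 => u0.
split; first exact: measurable_weighted_diff.
pose N : set E := (u \_ Om) @^-1` (~` [set 0]).
have mN : measurable N.
  rewrite -[N]setTI; apply: measurable_ext => //.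
  by apply: measurableC; exact: measurable_set1.
have N0 : mu N = 0%E.
  have : (\int[mu]_(x in Om) `|((u x : R) ^+ 2)%:E| = 0)%E.
    under eq_integral do rewrite gee0_abs ?lee_fin ?sqr_ge0//.
    rewrite -[LHS]fineK; last first.
      by rewrite ge0_fin_numE//; apply: integral_ge0 => x _; rewrite lee_fin sqr_ge0.
    congr EFin; apply/eqP; rewrite eq_le u0/=.
    by apply: Rintegral_ge0 => x _; exact: sqr_ge0.
  have mu2 : measurable_fun Om (EFin \o (fun x => (u x : R) ^+ 2)).
    by apply/measurable_EFinP; exact: measurable_funX.
  move/(ae_eq_integral_abs mu mOm mu2) => h.
  apply: measure_negligible => //; apply: negligibleS h.
  move=> x /= ux hx; apply: ux; rewrite /patch; case: ifPn => // xOm.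
  have := hx (set_mem xOm); case=> /eqP; rewrite expf_eq0/= => /eqP ->.
  by [].
pose B : set (E * E) := N `*` setT `|` setT `*` N.
have mB : measurable B by apply: measurableU; exact: measurableX.
have B0 : (mu \x mu)%E B = 0%E.
  have mNT : measurable (N `*` [set: E]) by exact: measurableX.
  have mTN : measurable ([set: E] `*` N) by exact: measurableX.
  have e1 : (mu \x mu)%E (N `*` [set: E]) = 0%E.
    by transitivity (mu N * mu setT)%E; [exact: product_measure1E|rewrite N0 mul0e].
  have e2 : (mu \x mu)%E ([set: E] `*` N) = 0%E.
    by transitivity (mu setT * mu N)%E; [exact: product_measure1E|rewrite N0 mule0].
  by rewrite -[RHS]e1; exact: (measureU0 mNT mTN e2).
have mDB : measurable (D2 `\` B) by exact: measurableD.
have DB0 : (mu \x mu)%E (D2 `\` (D2 `\` B)) = 0%E.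
  apply: (subset_measure0 _ mB _ B0); first exact: measurableD.
  by move=> z [h1 h2]; apply: contrapT => h; exact: h2.
rewrite (integral_conull _ mDB mD2 _ DB0); last by move=> z [].
rewrite integral0_eq ?ltry// => z [_ Bz].
  have -> : weighted_diff u z = 0; last by rewrite expr0n.
  rewrite /weighted_diff; have h1 : (u \_ Om) z.1 = 0.
    by apply: contrapT => h; apply: Bz; left.
  have h2 : (u \_ Om) z.2 = 0 by apply: contrapT => h; apply: Bz; right.
  by rewrite h1 h2 subrr mul0r.
Qed.

(** An infinite energy would be recorded as 0; a positive value therefore
    certifies finiteness. *)
Lemma coercive_finite_energy (u : fn) : carrier (L2_space Om) u ->
  (nrm (L2_space Om) u != 0 -> 0 < energy Om s u u) -> finite_energy u.
Proof.
move=> cu; have [/eqP u0 _|u0 /(_ isT)] := boolP (nrm (L2_space Om) u == 0).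
  exact: null_finite_energy.
rewrite energyE => h; split; first by apply: measurable_weighted_diff; case: cu.
rewrite ltey; apply/eqP => hoo; move: h; rewrite /Rintegral.
have -> : (\int[(mu \x mu)%E]_(z in D2) (weighted_diff u z * weighted_diff u z)%:E = +oo)%E.
  by rewrite -hoo; apply: eq_integral => z _; rewrite expr2.
by rewrite /= mulr0 ltxx.
Qed.

End energies.

(** * Pairings with bounded functions *)

Section bounded_functions.
Variables (R : realType) (n : nat).
Local Notation fn := ('rV[R]_n -> R^o).

Definition bounded_measurable : set fn :=
  [set g : fn | measurable_fun setT (g : 'rV[R]_n -> R) /\
     exists B : R, 0 <= B /\ forall x, `|g x| <= B].

Lemma bounded_measurable0 : bounded_measurable 0.
Proof. by split; [exact: measurable_cst|exists 0; split=> // x; rewrite normr0]. Qed.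

Lemma bounded_measurable_lin (c : R) u v : bounded_measurable u -> bounded_measurable v ->
  bounded_measurable (c *: u + v).
Proof.
move=> [mu [B [B0 hB]]] [mv [B' [B'0 hB']]]; split.
  by apply: measurable_funD => //; exact: measurable_funM.
exists (`|c| * B + B'); split; first by rewrite addr_ge0// mulr_ge0.
move=> x; apply: (le_trans (ler_normD _ _)); apply: lerD => //.
by rewrite normrM ler_wpM2l.
Qed.

Lemma bounded_measurable_sum (l : fn -> R) (I : Type) (r : seq I) (a : I -> R) (g : I -> fn) :
  (forall (c : R) u v, bounded_measurable u -> bounded_measurable v ->
     l (c *: u + v) = c * l u + l v) -> (forall i, bounded_measurable (g i)) ->
  l (\sum_(i <- r) a i *: g i) = \sum_(i <- r) a i * l (g i).
Proof.
move=> ll hg; have l0 : l 0 = 0.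
  have := ll 1 0 0 bounded_measurable0 bounded_measurable0.
  by rewrite scaler0 addr0 mul1r => /eqP; rewrite -subr_eq0 opprD addrA subrr sub0r oppr_eq0 => /eqP.
suff [_ ->] : bounded_measurable (\sum_(i <- r) a i *: g i) /\
    l (\sum_(i <- r) a i *: g i) = \sum_(i <- r) a i * l (g i) by [].
elim: r => [|i r [b e]]; first by rewrite !big_nil; split=> //; exact: bounded_measurable0.
by rewrite !big_cons; split; [exact: bounded_measurable_lin|rewrite ll// e].
Qed.

Lemma bounded_measurable_L2 (D : set 'rV[R]_n) (g : fn) : measurable D ->
  (lebesgue_rV R n D < +oo)%E -> bounded_measurable g -> carrier (L2_space D) g.
Proof.
move=> mD Dfin [mg [B [_ hB]]].
apply: (bounded_square_integrable mD Dfin (B := B)) => [|x _]; last exact: hB.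
exact: measurable_funTS.
Qed.

End bounded_functions.

Section surface_pairing.
Variables (R : realType) (n k : nat) (G : seq 'M[R]_(k.+1, n)) (r : R).
Local Notation E := 'rV[R]_n.
Local Notation fn := (E -> R^o).
Local Notation nu := (lebesgue_rV R k).
Local Notation S := (@std_simplex R k).
Local Notation Y := (Hs_surf G r).
Hypothesis nG : forall K, K \in G -> Defs.nondegenerate K.

Let mS : measurable S := @measurable_std_simplex R k.

Lemma surf_intE (h : E -> R) :
  (forall K, K \in G -> jac K = 0 \/ nu.-integrable S (EFin \o (fun y => h (param K y)))) ->
  surf_int G (fun x => (h x)%:E) =
  (\sum_(K <- G) jac K * \int[nu]_(y in S) h (param K y))%:E.
Proof.
move=> ih; rewrite /surf_int -sumEFin; apply: eq_big_seq => K /ih[->|i].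
  by rewrite mul0e mul0r.
by rewrite EFinM Rintegral_EFin.
Qed.

(* a simplex with vanishing surface element imposes nothing on v, and
   contributes nothing to the pairing *)
Let square_integrable_on (v : fn) K : carrier Y v -> K \in G ->
  jac K = 0 \/ square_integrable nu S (fun y => v (param K y)).
Proof.
move=> [mv fv _] KG; have [->|J0] := eqVneq (jac K) 0; [by left|right].
split; first exact: (measurable_on_simplex nG KG).
have J : 0 < jac K by rewrite lt_neqAle eq_sym J0 jac_ge0.
have t0 L : (0 <= (jac L)%:E * \int[nu]_(y in S) ((v (param L y)) ^+ 2)%:E)%E.
  by rewrite mule_ge0 ?lee_fin ?jac_ge0//; apply: integral_ge0 => y _; rewrite lee_fin sqr_ge0.
move: fv; rewrite /surf_int (big_rem K)//= => h.
have {}h : ((jac K)%:E * \int[nu]_(y in S) ((v (param K y)) ^+ 2)%:E < +oo)%E.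
  by apply: le_lt_trans h; rewrite leeDl//; apply: sume_ge0 => L _; exact: t0.
rewrite ltey; apply/eqP => e; move: h.
by rewrite e gt0_muley ?lte_fin// ltxx.
Qed.

Let bounded_on (g : fn) K : bounded_measurable g -> square_integrable nu S (fun y => g (param K y)).
Proof.
move=> [mg [B [_ hB]]].
apply: (bounded_square_integrable mS (@std_simplex_finite_measure R k) (B := B)) => [|y _].
  by apply: measurable_funTS; exact: (measurableT_comp mg (measurable_param K)).
exact: hB.
Qed.

Let pairingE (g v : fn) : bounded_measurable g -> carrier Y v ->
  fine (surf_int G (fun x => (g x * v x)%:E)) =
  \sum_(K <- G) jac K * \int[nu]_(y in S) (g (param K y) * v (param K y)).
Proof.
move=> hg hv; rewrite (surf_intE (h := fun x => g x * v x))// => K KG.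
have [->|sv] := square_integrable_on hv KG; [by left|right].
exact: (square_integrableM mS (bounded_on K hg) sv).
Qed.

Lemma surf_pairing_linl (c : R) (g h v : fn) : bounded_measurable g -> bounded_measurable h ->
  carrier Y v ->
  fine (surf_int G (fun x => ((c *: g + h) x * v x)%:E)) =
  c * fine (surf_int G (fun x => (g x * v x)%:E)) + fine (surf_int G (fun x => (h x * v x)%:E)).
Proof.
move=> hg hh hv; rewrite !pairingE//; last exact: bounded_measurable_lin.
rewrite mulr_sumr -big_split/=; apply: eq_big_seq => K KG.
have [->|sv] := square_integrable_on hv KG; first by rewrite !mul0r mulr0 addr0.
rewrite mulrCA -mulrDr; congr (_ * _).
have ig := square_integrableM mS (bounded_on K hg) sv.
have ih := square_integrableM mS (bounded_on K hh) sv.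
rewrite -RintegralZl// -RintegralD//; last exact: RintegrableZ.
by apply: eq_Rintegral => x _; rewrite /= mulrDl mulrA.
Qed.

Let pairing_linr (c : R) (g u v : fn) : bounded_measurable g -> carrier Y u -> carrier Y v ->
  fine (surf_int G (fun x => (g x * (c *: u + v) x)%:E)) =
  c * fine (surf_int G (fun x => (g x * u x)%:E)) + fine (surf_int G (fun x => (g x * v x)%:E)).
Proof.
move=> hg hu hv; rewrite !pairingE//; last exact: (carrierL (Hs_surf_seminorm nG r)).
rewrite mulr_sumr -big_split/=; apply: eq_big_seq => K KG.
have [->|sv] := square_integrable_on hv KG; first by rewrite !mul0r mulr0 addr0.
have [->|su] := square_integrable_on hu KG; first by rewrite !mul0r mulr0 addr0.
rewrite mulrCA -mulrDr; congr (_ * _).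
have iu := square_integrableM mS (bounded_on K hg) su.
have iv := square_integrableM mS (bounded_on K hg) sv.
rewrite -RintegralZl// -RintegralD//; last exact: RintegrableZ.
by apply: eq_Rintegral => x _; rewrite /= mulrDr mulrCA.
Qed.

(** By Young's inequality on each simplex the pairing is bounded by a multiple of
    1 plus the squared norm. *)
Lemma surf_pairing_dual (g : fn) : bounded_measurable g ->
  carrier (dual_space Y) (fun v : fn => fine (surf_int G (fun x => (g x * v x)%:E)) : R^o).
Proof.
move=> hg; pose A := \sum_(K <- G) jac K * \int[nu]_(y in S) (g (param K y) ^+ 2).
have A0 : 0 <= A.
  apply: sumr_ge0 => K _; rewrite mulr_ge0 ?jac_ge0//.
  by apply: Rintegral_ge0 => y _; exact: sqr_ge0.
apply: (dual_intro (Hs_surf_seminorm nG r) (K := A + 1)) => [c u v hu hv|v hv].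
  exact: pairing_linr.
rewrite pairingE//; pose B := \sum_(K <- G) jac K * \int[nu]_(y in S) (v (param K y) ^+ 2).
have B0 : 0 <= B.
  apply: sumr_ge0 => K _; rewrite mulr_ge0 ?jac_ge0//.
  by apply: Rintegral_ge0 => y _; exact: sqr_ge0.
have BE : B <= nrm Y v ^+ 2.
  have -> : B = fine (surf_int G (fun x => ((v x : R) ^+ 2)%:E)).
    rewrite surf_intE// => K KG; have [->|sv] := square_integrable_on hv KG; [by left|right].
    exact: (square_integrable_sq sv).
  rewrite /=; set a := fine _; set b := Num.sqrt (fine (surf_slobodeckij _ _ _)).
  have a0 : 0 <= a.
    apply: fine_ge0; apply: sume_ge0 => K _; rewrite mule_ge0 ?lee_fin ?jac_ge0//.
    by apply: integral_ge0 => y _; rewrite lee_fin sqr_ge0.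
  rewrite -[leLHS]sqr_sqrtr// ler_sqr ?nnegrE ?addr_ge0 ?sqrtr_ge0//.
  by rewrite lerDl sqrtr_ge0.
apply: (@le_trans _ _ (A + B)); last first.
  rewrite mulrDr mulr1 mulrDl mul1r; have := mulr_ge0 A0 (sqr_ge0 (nrm Y v)); lra.
rewrite /A /B -big_split/=; apply: (le_trans (ler_norm_sum _ _ _)).
rewrite big_seq [leRHS]big_seq; apply: ler_sum => K KG.
have [->|sv] := square_integrable_on hv KG; first by rewrite !mul0r normr0 addr0.
rewrite normrM (ger0_norm (jac_ge0 K)) -mulrDr ler_wpM2l ?jac_ge0//.
apply: (le_trans (Rintegral_wAMGM mS ltr01 (bounded_on K hg) sv)).
rewrite invr1 !mul1r.
have h1 : 0 <= \int[nu]_(y in S) (g (param K y) ^+ 2) by apply: Rintegral_ge0 => y _; exact: sqr_ge0.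
have h2 : 0 <= \int[nu]_(y in S) (v (param K y) ^+ 2) by apply: Rintegral_ge0 => y _; exact: sqr_ge0.
move: h1 h2; lra.
Qed.

End surface_pairing.

(** * The spaces of the contact problem *)

Section problem_spaces.
Variables (R : realType) (P : problem R).
Hypothesis wp : well_posed P.
Local Notation fn := ('rV[R]_(sdim P) -> R^o).
Local Notation mu := (lebesgue_rV R (sdim P)).
Local Notation H := (Hspace P).
Local Notation W := (L2Omega P).
Local Notation Y := (Yspace P).

Lemma measurable_domain : measurable (domain P).
Proof. by case: wp => _ _ _ [[oO _ _ _ _] _] _; exact: open_measurable_rV. Qed.

Lemma domain_finite_measure : (mu (domain P) < +oo)%E.
Proof.
case: wp => _ _ _ [[_ _ _ bO _] _] _.
by apply: bounded_finite_measure bO; exact: measurable_domain.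
Qed.

Lemma L2Omega_seminorm : is_seminorm W.
Proof. exact: (L2_space_seminorm measurable_domain). Qed.

Lemma dotL2_inner_product : is_inner_product W (dotL2 (domain P)).
Proof. exact: (L2_inner_product measurable_domain). Qed.

Lemma Hspace_seminorm : is_seminorm H.
Proof. exact: (Hs_vanishing_seminorm _ _ measurable_domain). Qed.

Lemma tGamma_nondegenerate : on_surface (case_of P) ->
  forall K, K \in tGamma P -> Defs.nondegenerate K.
Proof. by case: wp => _ _ _ _ /[apply] -[_ [_ h _] _ _]. Qed.

Lemma Yspace_seminorm : is_seminorm Y.
Proof.
rewrite /Yspace; case: ifPn => [h|_]; last exact: Hspace_seminorm.
exact: (Hs_surf_seminorm (tGamma_nondegenerate h)).
Qed.

Lemma Hspace_L2 v : carrier H v -> carrier W v.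
Proof. by move=> [[]]. Qed.

Lemma nrm_L2_Hspace v : carrier H v -> nrm W v <= nrm H v.
Proof. by move=> _; rewrite /= lerDl sqrtr_ge0. Qed.

Lemma trace_Yspace v : carrier H v -> carrier Y (trace_of P v).
Proof.
move=> hv; rewrite /trace_of /Yspace; case: ifPn => h //.
by case: wp => _ _ _ _ /(_ h)[_ _ _ [+ _ _ _]] => /(_ _ hv); rewrite /Yspace h.
Qed.

Lemma trace_bounded : exists2 K : R, 0 <= K &
  forall v, carrier H v -> nrm Y (trace_of P v) <= K * nrm H v.
Proof.
case h : (on_surface (case_of P)).
  case: wp => _ _ _ _ /(_ h)[_ _ _ [_ _ [K hK] _]].
  exists `|K| => // v hv; rewrite /trace_of h; apply: (le_trans (hK _ hv)).
  by rewrite ler_wpM2r ?ler_norm// (nrm_ge0 Hspace_seminorm).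
by exists 1 => // v hv; rewrite /trace_of /Yspace h mul1r.
Qed.

(** The trace is linear up to vectors of norm 0, which multipliers do not see. *)
Lemma bform_lin (l : fn -> R^o) (c : R) u v : carrier (dual_space Y) l ->
  carrier H u -> carrier H v -> bform P l (c *: u + v) = c * bform P l u + bform P l v.
Proof.
move=> hl hu hv; have sY := Yspace_seminorm; have sH := Hspace_seminorm.
have tu := trace_Yspace hu; have tv := trace_Yspace hv.
have tw := trace_Yspace (carrierL sH c hu hv).
rewrite /bform -(dual_lin c hl tu tv); apply/eqP; rewrite -subr_eq0 -normr_le0.
rewrite -(dualB sY hl tw (carrierL sY c tu tv)).
apply: (le_trans (dual_le sY hl (carrierB sY tw (carrierL sY c tu tv)))).
suff -> : nrm Y (trace_of P (c *: u + v) - (c *: trace_of P u + trace_of P v)) = 0.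
  by rewrite mulr0.
rewrite /trace_of; case: ifPn => h; last by rewrite subrr (nrm0 sY).
by case: wp => _ _ _ _ /(_ h)[_ _ _ [_ + _ _]]; exact.
Qed.

Lemma bform_dual (l : fn -> R^o) : carrier (dual_space Y) l -> carrier (dual_space H) (bform P l).
Proof.
move=> hl; split=> [c u v|]; first exact: bform_lin.
have [K K0 hK] := trace_bounded.
exists (nrm (dual_space Y) l * K) => v hv; rewrite -mulrA.
apply: (le_trans (dual_le Yspace_seminorm hl (trace_Yspace hv))).
by rewrite ler_wpM2l ?(dual_nrm_ge0 Yspace_seminorm)// hK.
Qed.

Lemma bform_nrm : exists2 K : R, 0 <= K & forall l : fn -> R^o, carrier (dual_space Y) l ->
  nrm (dual_space H) (bform P l) <= K * nrm (dual_space Y) l.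
Proof.
have [K K0 hK] := trace_bounded; exists K => // l hl.
have l0 := dual_nrm_ge0 Yspace_seminorm l.
apply: (dual_nrm_le Hspace_seminorm); first exact: mulr_ge0.
move=> v hv; rewrite mulrAC mulrC.
apply: (le_trans (dual_le Yspace_seminorm hl (trace_Yspace hv))).
by rewrite ler_wpM2l// hK.
Qed.

Section multiplier_embedding.
Variables (D : discretization P) (kappa : R).
Hypothesis adm : admissible D kappa.

Lemma Mh_bounded g : Mh D g -> bounded_measurable g.
Proof.
case: adm => _ _ _; rewrite /Mh; case: ifPn => _ [[_ nG _] _] hg;
  exact: (piecewise_constant_bounded nG hg).
Qed.

Lemma emb_dual (g : fn) : bounded_measurable g -> carrier (dual_space Y) (emb g).
Proof.
move=> hg; rewrite /emb /dotY; case h : (on_surface (case_of P)).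
  by have := surf_pairing_dual (frac_order P - 1 / 2) (tGamma_nondegenerate h) hg; rewrite /Yspace h.
have gW : carrier W g.
  by apply: bounded_measurable_L2 => //; [exact: measurable_domain|exact: domain_finite_measure].
have hd := dotL2_inner_product.
rewrite /Yspace h; split=> [c u v /Hspace_L2 hu /Hspace_L2 hv|].
  rewrite (dot_sym hd) (dot_lin hd)//.
  by congr (_ * _ + _); exact: (dot_sym hd).
exists (nrm W g) => v hv; apply: (le_trans (dot_cs hd gW (Hspace_L2 hv))).
by rewrite ler_wpM2l ?nrm_L2_Hspace//; exact: (nrm_ge0 L2Omega_seminorm).
Qed.

Lemma emb_linl (v : fn) (c : R) (g g' : fn) : carrier Y v ->
  bounded_measurable g -> bounded_measurable g' ->
  emb (c *: g + g') v = c * emb g v + emb g' v.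
Proof.
move=> + hg hg'; rewrite /emb /dotY /Yspace; case: ifPn => h hv.
  exact: (surf_pairing_linl (tGamma_nondegenerate h) c hg hg' hv).
apply: (dot_lin dotL2_inner_product); last exact: Hspace_L2.
  by apply: bounded_measurable_L2 => //; [exact: measurable_domain|exact: domain_finite_measure].
by apply: bounded_measurable_L2 => //; [exact: measurable_domain|exact: domain_finite_measure].
Qed.

End multiplier_embedding.

(** Only coercivity guarantees that the energy of a function in H is finite, and
    thereby that the form is bilinear on H. *)
Section energy_form.
Variables (C alpha : R).
Hypotheses (alpha0 : 0 < alpha) (aC : a_continuous P C) (aA : a_coercive P alpha).

Let fin_energy u : carrier H u -> finite_energy (domain P) (frac_order P) u.
Proof.
move=> hu; apply: (coercive_finite_energy measurable_domain (Hspace_L2 hu)) => u0.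
apply: lt_le_trans (aA hu); rewrite mulr_gt0// exprn_gt0//.
apply: lt_le_trans (nrm_L2_Hspace hu).
by rewrite lt_neqAle eq_sym u0 (nrm_ge0 L2Omega_seminorm)//; exact: Hspace_L2.
Qed.

Lemma aform_lin (c : R) u v w : carrier H u -> carrier H v -> carrier H w ->
  aform P (c *: u + v) w = c * aform P u w + aform P v w.
Proof.
by move=> hu hv hw; apply: (energy_lin measurable_domain); exact: fin_energy.
Qed.

Lemma aform_sym u v : aform P u v = aform P v u.
Proof. exact: energy_sym. Qed.

(** Continuity bounds the form from above; the opposite bound comes from - u. *)
Lemma aform_bound u v : carrier H u -> carrier H v ->
  `|aform P u v| <= `|C| * nrm H u * nrm H v.
Proof.
move=> hu hv; have sH := Hspace_seminorm.
have CC (x y : fn) : carrier H x -> carrier H y ->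
    C * nrm H x * nrm H y <= `|C| * nrm H x * nrm H y.
  by move=> hx hy; rewrite -!mulrA ler_wpM2r ?ler_norm// mulr_ge0// (nrm_ge0 sH).
rewrite ler_norml (le_trans (aC hu hv)) ?CC// andbT lerNl.
have hN := carrierN sH hu.
have -> : - aform P u v = aform P (- u) v.
  have a0 : aform P 0 v = 0.
    have := aform_lin 1 (carrier0 sH) (carrier0 sH) hv.
    rewrite scaler0 addr0 mul1r => /esym/eqP; rewrite -subr_eq0 addrK => /eqP.
    exact.
  by have := aform_lin (-1) hu (carrier0 sH) hv; rewrite addr0 scaleN1r a0 addr0 mulN1r => ->.
by apply: (le_trans (aC hN hv)); rewrite -(nrmN sH hu); exact: CC.
Qed.

Lemma aform_dual u : carrier H u -> carrier (dual_space H) (aform P u).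
Proof.
move=> hu; split=> [c v w hv hw|].
  by rewrite aform_sym aform_lin// aform_sym; congr (_ + _); exact: aform_sym.
by exists (`|C| * nrm H u) => v hv; exact: aform_bound.
Qed.

End energy_form.
End problem_spaces.

(** * Test functions of time *)

Section test_functions.
Variables (R : realType) (T : R).
Local Notation leb := (@lebesgue_measure R).
Implicit Types phi psi : R -> R.

Lemma test_function_continuous phi : test_function T phi -> continuous phi.
Proof.
move=> [h _] x; exact/differentiable_continuous/derivable1_diffP/(h 0%N).
Qed.

Lemma test_function_derive1 phi : test_function T phi -> test_function T (derive1 phi).
Proof.
move=> [h [a [b [a0 bT ph0]]]]; split.
  move=> k t; have -> : derive1n k (derive1 phi) = derive1n k.+1 phi.
    by elim: k => [//|k IH]; rewrite /= IH.
  exact: (h k.+1).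
exists a, b; split => // t tab.
rewrite derive1E (@near_eq_derive _ _ _ phi (cst 0)); first exact: derive_cst.
have : open (~` `[a, b]%classic) by exact/closed_openC/itv_closed.
rewrite openE => /(_ t) /= h2; have {}h2 : nbhs t (~` `[a, b]%classic).
  by apply: h2 => /= h3; rewrite h3 in tab.
by apply: filterS h2 => y hy; apply: ph0; apply/negP.
Qed.

Lemma test_function_bounded phi : test_function T phi ->
  exists2 K : R, 0 <= K & forall t, `|phi t| <= K.
Proof.
move=> tp; have [h [a [b [a0 bT ph0]]]] := tp.
have [ab|ba] := leP a b; last first.
  by exists 0 => // t; rewrite ph0 ?normr0// in_itv/=; apply/negP => /andP[] /le_trans /[apply]; lra.
have [|c _ hc] := @EVT_max R (fun t => `|phi t|) a b ab.
  apply: continuous_subspaceT => x; apply: cvg_norm; exact: test_function_continuous.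
exists `|phi c| => // t; have [tab|/ph0 ->] := boolP (t \in `[a, b]); first exact: hc.
by rewrite normr0.
Qed.

Lemma test_function_by_parts phi psi : 0 < T -> test_function T phi -> test_function T psi ->
  \int[leb]_(t in `]0, T[) (phi t * derive1 psi t) =
  - \int[leb]_(t in `]0, T[) (derive1 phi t * psi t).
Proof.
move=> T0 tp tq.
have z f : test_function T f -> f 0 = 0 /\ f T = 0.
  move=> [_ [a [b [a0 bT f0]]]]; split; apply: f0; rewrite in_itv/=.
    by rewrite leNgt a0.
  by rewrite negb_and orbC -ltNge bT.
have toC (f : R -> R) : \int[leb]_(t in `[0, T]) f t = \int[leb]_(t in `]0, T[) f t.
  apply: Rintegral_conull => //; last exact: lebesgue_measure_endpoints.
  by apply: subset_itv; rewrite bnd_simp.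
rewrite -!toC; have [p0 pT] := z _ tp; have [q0 qT] := z _ tq.
have LR f : test_function T f -> derivable_oo_LRcontinuous f 0 T.
  move=> tf; split => [x _||]; first by have [h _] := tf; exact: (h 0%N x).
    by apply: cvg_at_right_filter; exact: test_function_continuous.
  by apply: cvg_at_left_filter; exact: test_function_continuous.
have wc f : test_function T f -> {within `[0, T], continuous f}.
  by move=> tf; apply: continuous_subspaceT; exact: test_function_continuous.
rewrite (Rintegration_by_parts T0 (wc _ (test_function_derive1 tp)) (LR _ tp) _
  (wc _ (test_function_derive1 tq)) (LR _ tq))//.
by rewrite p0 pT !mul0r subrr sub0r.
Qed.

End test_functions.

Section bochner_spaces.
Variables (R : realType) (T : R).
Local Notation leb := (@lebesgue_measure R).
Variables (L : lmodType R) (V : seminormed L).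
Hypothesis sV : is_seminorm V.

Lemma bochner_L2_scale (phi : R -> R) (z : L) (K : R) : measurable_fun setT phi ->
  (forall t, `|phi t| <= K) -> carrier V z -> bochner_L2 T V (fun t => phi t *: z).
Proof.
move=> mphi hK hz; split.
- by apply: aeW => t _; exact: carrierZ.
- have [m [A [c [mA cA]]]] := measurable_sfun_approx measurableT mphi.
  exists (fun j t => \sum_(i < m j) (\1_(A j i) t : R) *: (c j i *: z)).
    by move=> j; exists (m j), (A j), (fun i => c j i *: z); split=> // i; exact: carrierZ.
  apply: aeW => t _.
  have -> : (fun j => nrm V (\sum_(i < m j) (\1_(A j i) t : R) *: (c j i *: z) - phi t *: z)) =
      (fun j => `|\sum_(i < m j) \1_(A j i) t * c j i - phi t| * nrm V z).
    apply/funext => j; rewrite -(nrmZ sV)// scalerBl scaler_suml.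
    by congr (nrm V (_ - _)); apply: eq_bigr => i _; rewrite scalerA.
  rewrite -[X in _ --> X](mul0r (nrm V z)); apply: cvgM; last exact: cvg_cst.
  have h : \sum_(i < m j) \1_(A j i) t * c j i - phi t @[j --> \oo] --> phi t - phi t.
    by apply: cvgB; [exact: cA|exact: cvg_cst].
  rewrite subrr in h; apply: cvg_trans (cvg_norm h) _; rewrite normr0.
  exact: cvg_id.
- have K0 : 0 <= K by apply: le_trans (hK 0).
  apply: (@le_lt_trans _ _ (\int[leb]_(t in `]0%R, T[) ((K * nrm V z) ^+ 2)%:E)%E).
    apply: ge0_le_integral_any => // t _; rewrite ?lee_fin ?sqr_ge0//.
    rewrite (nrmZ sV)// ler_sqr ?nnegrE ?mulr_ge0 ?(nrm_ge0 sV)//.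
    by rewrite ler_wpM2r ?(nrm_ge0 sV).
  rewrite integral_cst//= lte_mul_pinfty ?lee_fin ?sqr_ge0//.
  by rewrite lebesgue_measure_itv/=; case: ifPn => // _; rewrite -EFinB ltry.
Qed.

(** The a.e. conditions of Bochner square integrability hold on one set of
    times, and restrict to each of its subsets. *)
Lemma bochner_L2_conull (u : R -> L) : bochner_L2 T V u ->
  exists Q : set R, {ae leb, forall t, t \in `]0, T[ -> Q t} /\
    forall D : set (measurableTypeR R), measurable D -> D `<=` `]0, T[ -> D `<=` Q ->
      bochner_sq_integrable leb D V u.
Proof.
move=> [hc [u_ su hu] fu].
exists [set t | carrier V (u t) /\ (nrm V (u_ j t - u t) @[j --> \oo] --> (0 : R))]; split.
  move: hc hu; apply: filterS2; first exact: (ae_filter_ringOfSetsType leb).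
  by move=> t h1 h2 tT; split; [exact: h1|exact: h2].
move=> D mD DT DQ.
have bm : bochner_measurable D V u.
  split; first by move=> t /DQ[].
  exists u_; first by move=> j; exact: simple_in_finitely_based.
  by move=> t /DQ[].
split => //; apply/integrableP; split.
  by apply/measurable_EFinP/measurable_funX; exact: (bochner_measurable_nrm sV bm).
apply: le_lt_trans fu.
apply: ge0_le_integral_any => // t _; rewrite ?lee_fin ?sqr_ge0//=.
by rewrite ger0_norm ?sqr_ge0.
Qed.

End bochner_spaces.

Lemma ae_conull (R : realType) (A : set (measurableTypeR R)) (Q : set R) : measurable A ->
  {ae @lebesgue_measure R, forall t, A t -> Q t} ->
  exists D : set (measurableTypeR R), [/\ measurable D, D `<=` A,
    @lebesgue_measure R (A `\` D) = 0%E & D `<=` Q].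
Proof.
move=> mA [N [mN N0 hN]]; exists (A `\` N); split.
- exact: measurableD.
- by move=> t [].
- apply: (subset_measure0 _ mN _ N0); first by apply: measurableD => //; exact: measurableD.
  by move=> t [h1 h2]; apply: contrapT => h; exact: h2.
- move=> t [tA Nt]; apply: contrapT => h; apply: Nt; apply: hN => /= h2.
  by apply: h; exact: h2.
Qed.

Section bochner_pairing_with_scalars.
Variable R : realType.
Local Notation leb := (@lebesgue_measure R).
Variables (D : set (measurableTypeR R)) (mD : measurable D) (Dfin : (leb D < +oo)%E).

Lemma bochner_sq_integrable_scale (L : lmodType R) (V : seminormed L) (phi : R -> R) (z : L)
    (K : R) : is_seminorm V -> measurable_fun D phi -> (forall t, D t -> `|phi t| <= K) ->
  carrier V z -> bochner_sq_integrable leb D V (fun t => phi t *: z).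
Proof.
move=> sV mphi hK hz.
have K0 : 0 <= `|K| := normr_ge0 K.
apply: (bochner_sq_integrable_intro mD sV (b := fun=> (`|K| * nrm V z) ^+ 2)).
- exact: bochner_measurable_scale.
- apply: (@Rintegrable_bounded _ _ _ leb _ mD _ ((`|K| * nrm V z) ^+ 2)) => // t _.
  by rewrite ger0_norm ?sqr_ge0.
- move=> t Dt; rewrite (nrmZ sV)// ler_sqr ?nnegrE ?mulr_ge0 ?(nrm_ge0 sV)//.
  rewrite ler_wpM2r ?(nrm_ge0 sV)//; apply: le_trans (ler_norm K); exact: hK.
Qed.

Lemma bochner_sq_integrable_map (L1 L2 : lmodType R) (V1 : seminormed L1) (V2 : seminormed L2)
    (B : L1 -> L2) (K : R) (x : R -> L1) : is_seminorm V1 -> is_seminorm V2 ->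
  (forall u, carrier V1 u -> carrier V2 (B u)) ->
  (forall u v, carrier V1 u -> carrier V1 v -> nrm V2 (B u - B v) <= K * nrm V1 (u - v)) ->
  (forall u, carrier V1 u -> nrm V2 (B u) <= K * nrm V1 u) ->
  bochner_sq_integrable leb D V1 x -> bochner_sq_integrable leb D V2 (fun t => B (x t)).
Proof.
move=> s1 s2 cB dB nB [bx ix].
apply: (bochner_sq_integrable_intro mD s2 (b := fun t => K ^+ 2 * nrm V1 (x t) ^+ 2)).
- apply: (bochner_measurable_map (K := K) cB _ bx) => u v hu hv.
  by rewrite dB// andbT (nrm_ge0 s2)//; apply: carrierB => //; exact: cB.
- exact: RintegrableZ.
- move=> t Dt; have h := (bx.1 _ Dt).
  have n2 : 0 <= nrm V2 (B (x t)) by apply: (nrm_ge0 s2); exact: cB.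
  by rewrite -exprMn ler_sqr ?nnegrE ?nB// (le_trans n2)// nB.
Qed.

End bochner_pairing_with_scalars.

Section variational_identity.
Variable R : realType.
Local Notation leb := (@lebesgue_measure R).
Variables (T : R) (D : set (measurableTypeR R)).
Hypotheses (T0 : 0 < T) (mD : measurable D) (DT : D `<=` `]0, T[)
  (D0 : leb (`]0, T[ `\` D) = 0%E).
Variables (L : lmodType R) (V : seminormed L).
Hypothesis sV : is_seminorm V.

Lemma conull_finite_measure : (leb D < +oo)%E.
Proof.
apply: (@le_lt_trans _ _ (leb `]0%R, T[)); first by apply: le_measure; rewrite ?inE.
by rewrite lebesgue_measure_itv/=; case: ifPn => // _; rewrite -EFinB ltry.
Qed.

Lemma test_scale_integrable (psi : R -> R) (v : L) : test_function T psi -> carrier V v ->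
  bochner_sq_integrable leb D V (fun t => psi t *: v).
Proof.
move=> tp hv; have [K _ hK] := test_function_bounded tp.
apply: (bochner_sq_integrable_scale mD conull_finite_measure (K := K) sV) => //.
apply: measurable_funTS; apply: continuous_measurable_fun; exact: test_function_continuous tp.
Qed.

(** For each vector this is the fundamental lemma of the calculus of variations;
    the exceptional sets of times are then merged. *)
Lemma ae_functional_vanishes (g : R -> L -> R^o) : bochner_sq_integrable leb D (dual_space V) g ->
  (forall v psi, carrier V v -> test_function T psi ->
     \int[leb]_(t in D) ((g t v : R) * psi t) = 0) ->
  exists D' : set (measurableTypeR R), [/\ measurable D', D' `<=` D,
    leb (`]0, T[ `\` D') = 0%E & forall t, D' t -> forall v, carrier V v -> g t v = 0].
Proof.
move=> bg g0.
have gv v : carrier V v -> {ae leb, forall t, D t -> g t v = 0}.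
  move=> hv; apply: (test_function_eq0_ae mD DT) => [|psi tp]; last exact: g0.
  apply: (integrable_pairing mD sV bg).
  apply: (bochner_sq_integrable_intro mD sV (b := fun=> nrm V v ^+ 2)) => //.
    exact: bochner_measurable_cst.
  apply: (@Rintegrable_bounded _ _ _ leb _ mD _ (nrm V v ^+ 2)) => //.
    exact: conull_finite_measure.
  by move=> t _; rewrite ger0_norm ?sqr_ge0.
have [D' [mD' D'D D'0 h]] := ae_conull mD (ae_functional_eq0 sV bg.1 gv).
exists D'; split => //.
have mT : measurable (`]0, T[%classic : set (measurableTypeR R)) by exact: measurable_itv.
have -> : `]0, T[ `\` D' = (`]0, T[ `\` D) `|` (D `\` D') :> set (measurableTypeR R).
  apply/seteqP; split=> [t [tT nD']|t [[tT nD]|[Dt nD']]].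
  - by have [Dt|nDt] := pselect (D t); [right|left].
  - by split=> // /D'D.
  - by split=> //; exact: DT.
by apply: null_set_setU => //; exact: measurableD.
Qed.

End variational_identity.

(** * The equation at almost all times *)

Section equation_at_almost_all_times.
Variables (R : realType) (P : problem R) (C alpha : R).
Hypotheses (wp : well_posed P) (alpha0 : 0 < alpha) (aC : a_continuous P C)
  (aA : a_coercive P alpha).
Local Notation leb := (@lebesgue_measure R).
Local Notation fn := ('rV[R]_(sdim P) -> R^o).
Local Notation H := (Hspace P).
Local Notation W := (L2Omega P).
Local Notation Y := (Yspace P).
Local Notation T := (final_time P).
Local Notation dot := (dotL2 (domain P)).
Let sH := Hspace_seminorm wp.
Let sY := Yspace_seminorm wp.
Let sdH := dual_seminorm sH.
Let sdY := dual_seminorm sY.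
Let hd := dotL2_inner_product wp.

Lemma final_time_gt0 : 0 < T.
Proof. by case: wp. Qed.

Lemma dotL2_dual v : carrier W v -> carrier (dual_space H) (dot v : fn -> R^o).
Proof.
move=> hv; split=> [c u w /Hspace_L2 hu /Hspace_L2 hw|].
  rewrite (dot_sym hd) (dot_lin hd)//.
  by congr (_ * _ + _); exact: (dot_sym hd).
exists (nrm W v) => w hw; apply: (le_trans (dot_cs hd hv (Hspace_L2 hw))).
by rewrite ler_wpM2l ?nrm_L2_Hspace//; exact: (nrm_ge0 (L2Omega_seminorm wp)).
Qed.

Lemma dotL2Z (c : R) (u v : fn) : carrier W u -> carrier W v -> dot (c *: u) v = c * dot u v.
Proof.
move=> hu hv; have sW := L2Omega_seminorm wp.
have d0 : dot 0 v = 0.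
  have := dot_lin hd 1 (carrier0 sW) (carrier0 sW) hv.
  by rewrite scaler0 addr0 mul1r => /eqP; rewrite -subr_eq0 opprD addrA subrr sub0r oppr_eq0 => /eqP.
by have := dot_lin hd c hu (carrier0 sW) hv; rewrite addr0 d0 addr0.
Qed.

(** The time derivative of the product is the derivative of the scalar factor
    times the functional that v represents in the pivot space. *)
Lemma Wspace_test (v : fn) (phi : R -> R) : carrier H v -> test_function T phi ->
  Wspace P (fun t => phi t *: v).
Proof.
move=> hv tp; exists (fun t => derive1 phi t *: (dot v : fn -> R^o)).
have mt f : test_function T f -> measurable_fun setT f.
  by move=> tf; apply: continuous_measurable_fun; exact: test_function_continuous tf.
have tp' := test_function_derive1 tp.
split.
- have [K K0 hK] := test_function_bounded tp.
  exact: (bochner_L2_scale T sH (mt _ tp) hK hv).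
- have [K K0 hK] := test_function_bounded tp'.
  exact: (bochner_L2_scale T sdH (mt _ tp') hK (dotL2_dual (Hspace_L2 hv))).
move=> w psi hw tq.
have hv' := Hspace_L2 hv; have hw' := Hspace_L2 hw.
have -> : (fun t => dot (phi t *: v) w * derive1 psi t) =
    (fun t => dot v w * (phi t * derive1 psi t)).
  by apply/funext => t; rewrite dotL2Z// mulrCA mulrA.
have -> : (fun t => (derive1 phi t *: (dot v : fn -> R^o)) w * psi t : R) =
    (fun t => dot v w * (derive1 phi t * psi t)).
  by apply/funext => t; rewrite -[(_ *: _) w]/(derive1 phi t * dot v w) mulrCA mulrA.
have ib f g : test_function T f -> test_function T g ->
    leb.-integrable (`]0, T[ : set (measurableTypeR R)) (EFin \o (fun t => f t * g t)).
  move=> tf tg; have [K K0 hK] := test_function_bounded tf.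
  have [K' K'0 hK'] := test_function_bounded tg.
  apply: (@Rintegrable_bounded _ _ _ leb _ _ _ (K * K')) => //.
  - by apply: (@conull_finite_measure R T); [exact: measurable_itv|move=> t].
  - by apply: measurable_funTS; apply: measurable_funM; exact: mt.
  - by move=> t _; rewrite normrM ler_pM.
rewrite !RintegralZl//; [|exact: ib|exact: ib (test_function_derive1 tq)].
by rewrite (test_function_by_parts final_time_gt0 tp tq) mulrN.
Qed.

Section conull.
Variable D : set (measurableTypeR R).
Hypotheses (mD : measurable D) (DT : D `<=` `]0, T[)
  (D0 : leb (`]0, T[ `\` D) = 0%E).

Let toD (f : R -> R) : \int[leb]_(t in `]0, T[) f t = \int[leb]_(t in D) f t.
Proof. exact: Rintegral_conull. Qed.

Lemma bform_sq_integrable (l : R -> fn -> R^o) : bochner_sq_integrable leb D (dual_space Y) l ->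
  bochner_sq_integrable leb D (dual_space H) (fun t => bform P (l t)).
Proof.
move=> bl; have [K K0 hK] := bform_nrm wp.
have h1 g : carrier (dual_space Y) g -> carrier (dual_space H) (bform P g) by exact: bform_dual.
have h2 g g' : carrier (dual_space Y) g -> carrier (dual_space Y) g' ->
    nrm (dual_space H) (bform P g - bform P g') <= K * nrm (dual_space Y) (g - g').
  by move=> hg hg'; apply: (hK (g - g')); exact: (carrierB sdY).
exact: (@bochner_sq_integrable_map R D mD _ _ (dual_space Y) (dual_space H) (bform P) K l
  sdY sdH h1 h2 hK bl).
Qed.

Lemma aform_sq_integrable (u : R -> fn) : bochner_sq_integrable leb D H u ->
  bochner_sq_integrable leb D (dual_space H) (fun t => aform P (u t)).
Proof.
move=> bu; have nB u' : carrier H u' -> nrm (dual_space H) (aform P u') <= `|C| * nrm H u'.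
  move=> hu; apply: (dual_nrm_le sH); first by rewrite mulr_ge0 ?(nrm_ge0 sH).
  by move=> v hv; exact: (aform_bound wp alpha0 aC aA).
have h1 u' : carrier H u' -> carrier (dual_space H) (aform P u').
  exact: (aform_dual wp alpha0 aC aA).
have h2 v w : carrier H v -> carrier H w ->
    nrm (dual_space H) (aform P v - aform P w) <= `|C| * nrm H (v - w).
  move=> hv hw; have -> : nrm (dual_space H) (aform P v - aform P w) =
      nrm (dual_space H) (aform P (v - w)).
    apply: eq_dual_nrm => z hz.
    by rewrite -[LHS]/(aform P v z - aform P w z) [v - w]addrC -scaleN1r
      (aform_lin wp alpha0 aA)// mulN1r addrC.
  by apply: nB; exact: (carrierB sH).
exact: (@bochner_sq_integrable_map R D mD _ _ H (dual_space H) (aform P) `|C| u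
  sH sdH h1 h2 nB bu).
Qed.

(** Testing with products of test functions of time and vectors localizes the
    variational equation in time. *)
Lemma equation_ae (u : R -> fn) (du lam f : R -> fn -> R^o) :
  bochner_sq_integrable leb D H u -> bochner_sq_integrable leb D (dual_space H) du ->
  bochner_sq_integrable leb D (dual_space Y) lam ->
  bochner_sq_integrable leb D (dual_space H) f ->
  (forall v, Wspace P v ->
    \int[leb]_(t in `]0, T[) (du t (v t) + aform P (u t) (v t) + bform P (lam t) (v t))
    = \int[leb]_(t in `]0, T[) f t (v t)) ->
  exists D' : set (measurableTypeR R), [/\ measurable D', D' `<=` D,
    leb (`]0, T[ `\` D') = 0%E & forall t, D' t -> forall v, carrier H v ->
    du t v + aform P (u t) v + bform P (lam t) v = f t v].
Proof.
move=> bu bdu blam bf eqn.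
have ba := aform_sq_integrable bu; have bb := bform_sq_integrable blam.
pose g t : fn -> R^o := (-1) *: f t + (1 *: du t + (1 *: aform P (u t) + bform P (lam t))).
have bg : bochner_sq_integrable leb D (dual_space H) g.
  have b1 := bochner_sq_integrable_lin mD sdH 1 ba bb.
  exact: (bochner_sq_integrable_lin mD sdH (-1) bf (bochner_sq_integrable_lin mD sdH 1 bdu b1)).
have gE t v : g t v = (du t v + aform P (u t) v + bform P (lam t) v) - f t v :> R.
  rewrite -[LHS]/((-1) * f t v + (1 * du t v + (1 * aform P (u t) v + bform P (lam t) v))) !mul1r mulN1r.
  by rewrite addrC !addrA.
have [v psi hv tp|D' [mD' D'D D'0 h]] := ae_functional_vanishes mD DT D0 sH bg.
  have bt := test_scale_integrable mD DT sH tp hv.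
  have i1 := integrable_pairing mD sH bdu bt; have i2 := integrable_pairing mD sH ba bt.
  have i3 := integrable_pairing mD sH bb bt; have i4 := integrable_pairing mD sH bf bt.
  transitivity (\int[leb]_(t in D) ((du t (psi t *: v) + aform P (u t) (psi t *: v) +
      bform P (lam t) (psi t *: v)) - f t (psi t *: v))).
    apply: eq_Rintegral => t /set_mem Dt; rewrite gE.
    rewrite (dualZ sH _ (bdu.1.1 _ Dt) hv) (dualZ sH _ (ba.1.1 _ Dt) hv).
    by rewrite (dualZ sH _ (bb.1.1 _ Dt) hv) (dualZ sH _ (bf.1.1 _ Dt) hv) -!mulrDr -mulrBr mulrC.
  rewrite RintegralB//; last by do 2 (apply: RintegrableD => //).
  by rewrite -!toD (eqn _ (Wspace_test hv tp)) subrr.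
exists D'; split => // t D't v hv; apply/eqP; rewrite -subr_eq0 -gE; apply/eqP.
exact: h.
Qed.

Lemma weak_derivativeB (u U : R -> fn) (du dU : R -> fn -> R^o) :
  bochner_sq_integrable leb D H u -> bochner_sq_integrable leb D (dual_space H) du ->
  bochner_sq_integrable leb D H U -> bochner_sq_integrable leb D (dual_space H) dU ->
  weak_derivative u du -> weak_derivative U dU ->
  forall v psi, carrier H v -> test_function T psi ->
  \int[leb]_(t in `]0, T[) (dot (u t - U t) v * derive1 psi t) =
  - \int[leb]_(t in `]0, T[) ((du t - dU t) v * psi t).
Proof.
move=> bu bdu bU bdU wu wU v psi hv tp; rewrite !toD.
have bt := test_scale_integrable mD DT sH tp hv.
have hv' := Hspace_L2 hv.
have bl := test_scale_integrable mD DT sdH (test_function_derive1 tp) (dotL2_dual hv').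
have := wu v psi hv tp; have := wU v psi hv tp; rewrite !toD => eU eu.
have i1 := integrable_pairing mD sH bdu bt; have i2 := integrable_pairing mD sH bdU bt.
have i3 := integrable_pairing mD sH bl bu; have i4 := integrable_pairing mD sH bl bU.
transitivity (\int[leb]_(t in D) (dot (u t) v * derive1 psi t) -
    \int[leb]_(t in D) (dot (U t) v * derive1 psi t)).
  rewrite -RintegralB//; last 2 first.
  - by apply: (eq_Rintegrable mD _ i3) => t _; rewrite -[LHS]/(derive1 psi t * dot v (u t)) (dot_sym hd) mulrC.
  - by apply: (eq_Rintegrable mD _ i4) => t _; rewrite -[LHS]/(derive1 psi t * dot v (U t)) (dot_sym hd) mulrC.
  apply: eq_Rintegral => t /set_mem Dt.
  have hu := Hspace_L2 (bu.1.1 _ Dt); have hU := Hspace_L2 (bU.1.1 _ Dt).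
  by rewrite -scaleN1r addrC (dot_lin hd)// mulN1r -mulrBl addrC.
rewrite eu eU opprK addrC -[RHS]opprK opprK; apply/esym.
transitivity (- (\int[leb]_(t in D) (du t v * psi t) - \int[leb]_(t in D) (dU t v * psi t))); last first.
  by rewrite opprB.
congr (- _); rewrite -RintegralB//; last 2 first.
- by apply: (eq_Rintegrable mD _ i1) => t Dt; rewrite (dualZ sH _ (bdu.1.1 _ Dt) hv) mulrC.
- by apply: (eq_Rintegrable mD _ i2) => t Dt; rewrite (dualZ sH _ (bdU.1.1 _ Dt) hv) mulrC.
by apply: eq_Rintegral => t _; rewrite -mulrBl.
Qed.

End conull.
End equation_at_almost_all_times.

(** * Time grids and vector-valued polynomials *)

Section time_grid.
Variables (R : realType) (T : R) (M : nat) (tp : nat -> R).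
Local Notation leb := (@lebesgue_measure R).
Hypotheses (T0 : 0 < T) (tp0 : tp 0%N = 0) (tpM : tp M = T)
  (tpS : forall k, (k < M)%N -> tp k < tp k.+1).

Lemma grid_le k l : (k <= l <= M)%N -> tp k <= tp l.
Proof.
move=> /andP[]; elim: l => [|l IH]; first by rewrite leqn0 => /eqP ->.
rewrite leq_eqVlt => /predU1P[-> //|kl lM].
exact: le_trans (IH kl (ltnW lM)) (ltW (tpS lM)).
Qed.

Lemma grid_cover t : 0 <= t -> t < T -> exists2 k, (k < M)%N & tp k <= t < tp k.+1.
Proof.
move=> t0 tT.
suff H l : (l <= M)%N -> t < tp l -> exists2 k, (k < M)%N & tp k <= t < tp k.+1.
  by apply: (H M) => //; rewrite tpM.
elim: l => [|l IH] lM; first by rewrite tp0 ltNge t0.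
by move=> tl; have [h|h] := ltP t (tp l); [exact: IH (ltnW lM) h|exists l; rewrite ?h].
Qed.

Lemma grid_cover_closed t : 0 <= t -> t <= T -> exists2 k, (k < M)%N & tp k <= t <= tp k.+1.
Proof.
move=> t0; rewrite le_eqVlt => /predU1P[->|tT].
  case: M tpM tpS => [|m] em hm; first by move: T0; rewrite -em tp0 ltxx.
  by exists m => //; rewrite -em lexx andbT ltW// hm.
by have [k kM /andP[h1 /ltW h2]] := grid_cover t0 tT; exists k; rewrite ?h1.
Qed.

Lemma grid_itv k : (k < M)%N -> 0 <= tp k /\ tp k.+1 <= T.
Proof.
by move=> kM; rewrite -tp0 -tpM; split; apply: grid_le; rewrite ?leqnn ?kM ?(ltnW kM).
Qed.

Section conull.
Variable D : set (measurableTypeR R).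
Hypotheses (mD : measurable D) (DT : D `<=` `]0, T[)
  (D0 : leb (`]0, T[ `\` D) = 0%E).

Lemma measurable_slab k : measurable (D `&` `[tp k, tp k.+1[).
Proof. by apply: measurableI => //; exact: measurable_itv. Qed.

Lemma slab_conull k : (k < M)%N -> leb (`[tp k, tp k.+1[ `\` (D `&` `[tp k, tp k.+1[)) = 0%E.
Proof.
move=> kM; have [k0 kT] := grid_itv kM.
have mT : measurable (`]0, T[%classic : set (measurableTypeR R)) by exact: measurable_itv.
have m1 : measurable ([set 0] : set (measurableTypeR R)) by exact: measurable_set1.
have mk : measurable (`[tp k, tp k.+1[%classic : set (measurableTypeR R)) by exact: measurable_itv.
apply: (@subset_measure0 _ _ _ leb _ ([set 0] `|` (`]0, T[ `\` D))).
- by apply: measurableD => //; exact: measurable_slab.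
- by apply: measurableU => //; exact: measurableD.
- move=> t [tk nD]; have [->|t0] := eqVneq t 0; [by left|right].
  move: (tk); rewrite /= in_itv/= => /andP[h1 h2].
  split; first by rewrite /= in_itv/= lt_neqAle eq_sym t0 (le_trans k0 h1) (lt_le_trans h2 kT).
  by move=> Dt; apply: nD.
- by apply: null_set_setU => //; [exact: measurableD|exact: lebesgue_measure_set1].
Qed.

Lemma Rintegral_slabs (f : R -> R) : leb.-integrable D (EFin \o f) ->
  \int[leb]_(t in D) f t = \sum_(k < M) \int[leb]_(t in D `&` `[tp k, tp k.+1[) f t.
Proof.
move=> fi.
have H k : (k <= M)%N -> \int[leb]_(t in D `&` `[0, tp k[) f t =
    \sum_(j < k) \int[leb]_(t in D `&` `[tp j, tp j.+1[) f t.
  elim: k => [|k IH] kM.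
    by rewrite big_ord0 tp0 set_itvco0 setI0 Rintegral_set0.
  have [k0 _] := grid_itv kM.
  rewrite big_ord_recr/= -IH ?(ltnW kM)// -Rintegral_setU.
  - rewrite -setIUr; congr (\int[leb]_(t in D `&` _) f t).
    apply/seteqP; split=> t /=; rewrite !in_itv/=.
      move=> /andP[h1 h2]; have [h|h] := ltP t (tp k); [left|right].
        by rewrite h1.
      by rewrite h2.
    have hk := tpS kM.
    by case=> /andP[h1 h2]; apply/andP; split => //;
      [exact: lt_trans h2 hk|exact: le_trans k0 h1].
  - by apply: measurableI => //; exact: measurable_itv.
  - exact: measurable_slab.
  - apply: (integrableS mD _ _ fi); last by rewrite -setIUr; exact: subIsetl.
    apply: measurableU; last exact: measurable_slab.
    by apply: measurableI => //; exact: measurable_itv.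
  - apply/disj_setPS => t [[_ /=]] + [_ /=]; rewrite !in_itv/=.
    by move=> /andP[_ h1] /andP[h2 _]; move: (lt_le_trans h1 h2); rewrite ltxx.
rewrite -H// tpM; congr (\int[leb]_(t in _) f t).
apply/seteqP; split=> [t Dt|t []//]; split=> //.
by have := DT Dt; rewrite /= !in_itv/= => /andP[/ltW -> ->].
Qed.

Lemma conull_meets a b : 0 <= a -> a < b -> b <= T -> exists2 t, D t & a < t < b.
Proof.
move=> a0 ab bT; apply: contrapT => h.
have mab : measurable (`]a, b[%classic : set (measurableTypeR R)) by exact: measurable_itv.
have mT : measurable (`]0, T[%classic : set (measurableTypeR R)) by exact: measurable_itv.
have : leb `]a, b[%classic = 0%E.
  apply: (@subset_measure0 _ _ _ leb _ (`]0, T[ `\` D)) => //; first exact: measurableD.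
  move=> t; rewrite /= in_itv/= => /andP[h1 h2]; split.
    by rewrite /= in_itv/= (le_lt_trans a0 h1) (lt_le_trans h2 bT).
  by move=> Dt; apply: h; exists t => //; rewrite h1.
rewrite lebesgue_measure_itv/= lte_fin ab => /eqP; rewrite -EFinB eqe subr_eq0 => /eqP e.
by move: ab; rewrite e ltxx.
Qed.

(** One point in each cell of a uniform subdivision of ]a, b[. *)
Lemma conull_distinct m a b : 0 <= a -> a < b -> b <= T ->
  exists2 s : 'I_m -> R, injective s & forall i, D (s i) /\ a < s i < b.
Proof.
move=> a0 ab bT; case: m => [|m]; first by exists (fun _ => 0); [move=> []|move=> []].
pose h := (b - a) / m.+1%:R; have h0 : 0 < h by rewrite divr_gt0 ?subr_gt0// ltr0n.
have /choice[s hs] : forall i : 'I_m.+1, exists t, D t /\ a + i%:R * h < t < a + i.+1%:R * h.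
  move=> i; have [||| t Dt ht] := @conull_meets (a + i%:R * h) (a + i.+1%:R * h).
  - by rewrite addr_ge0// mulr_ge0// ltW.
  - by rewrite ltrD2l ltr_pM2r// ltr_nat.
  - apply: le_trans bT; rewrite -lerBrDl -ler_pdivlMr// /h invf_div mulrC mulfVK.
      by rewrite ler_nat.
    by rewrite subr_eq0 gt_eqF.
  - by exists t.
exists s.
  move=> i j; wlog : i j / (i <= j)%N => [W|].
    by case: (leqP i j) => [|/ltnW] ij e; [exact: W|apply/esym/W].
  rewrite leq_eqVlt => /predU1P[/ord_inj//|ij] e.
  have [_ /andP[_ h1]] := hs i; have [_ /andP[h2 _]] := hs j.
  have : a + i.+1%:R * h <= a + j%:R * h by rewrite lerD2l ler_pM2r// ler_nat.
  by move: h1 h2; rewrite e => h1 h2 h3; have := lt_trans h1 (le_lt_trans h3 h2); rewrite ltxx.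
move=> i; have [Di /andP[h1 h2]] := hs i; split => //; apply/andP; split.
  by apply: le_lt_trans h1; rewrite lerDl mulr_ge0// ltW.
apply: (lt_le_trans h2); rewrite -lerBrDl -ler_pdivlMr// /h invf_div mulrC mulfVK.
  by rewrite ler_nat.
by rewrite subr_eq0 gt_eqF.
Qed.

End conull.
End time_grid.

Section vector_polynomials.
Variables (R : realType) (L : lmodType R) (V : seminormed L).
Hypothesis sV : is_seminorm V.

(** Lagrange interpolation: the coefficients are linear combinations of the
    values at as many distinct points, by inversion of a Vandermonde matrix. *)
Lemma polynomial_coef_carrier m (c : 'I_m -> L) (s : 'I_m -> R) : injective s ->
  (forall i, carrier V (\sum_(j < m) s i ^+ j *: c j)) -> forall j, carrier V (c j).
Proof.
move=> si hc l; pose A : 'M[R]_m := Vandermonde m (\row_i s i).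
have uA : A \in unitmx.
  rewrite unitmxE det_Vandermonde unitfE; apply/prodf_neq0 => i _.
  apply/prodf_neq0 => j ij; rewrite !mxE subr_eq0; apply: contraTneq ij => /si ->.
  by rewrite ltnn.
have e j : \sum_i A j i * invmx A i l = (j == l)%:R.
  by have /matrixP/(_ j l) := mulmxV uA; rewrite !mxE.
have -> : c l = \sum_i invmx A i l *: (\sum_(j < m) s i ^+ j *: c j).
  under eq_bigr do rewrite scaler_sumr.
  rewrite exchange_big/= (bigD1 l)//= [X in _ = _ + X]big1 ?addr0 => [|j jl].
    transitivity ((\sum_i A l i * invmx A i l) *: c l); first by rewrite e eqxx scale1r.
    by rewrite scaler_suml; apply: eq_bigr => i _; rewrite scalerA !mxE mulrC.
  transitivity ((\sum_i A j i * invmx A i l) *: c j).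
    by rewrite scaler_suml; apply: eq_bigr => i _; rewrite scalerA !mxE mulrC.
  by rewrite e (negbTE jl) scale0r.
by apply: (carrier_sum sV) => i _; exact: carrierZ.
Qed.

Lemma polynomial_carrier m (c : 'I_m -> L) t : (forall j, carrier V (c j)) ->
  carrier V (\sum_(j < m) t ^+ j *: c j).
Proof. by move=> hc; apply: (carrier_sum sV) => i _; exact: carrierZ. Qed.

Lemma polynomial_continuous m (c : 'I_m -> L) (t eps : R) : (forall j, carrier V (c j)) -> 0 < eps ->
  exists2 delta : R, 0 < delta & forall t', `|t' - t| < delta ->
    nrm V (\sum_(j < m) t' ^+ j *: c j - \sum_(j < m) t ^+ j *: c j) < eps.
Proof.
move=> hc e0; pose F (t' : R) : R := \sum_(j < m) `|t' ^+ j - t ^+ j| * nrm V (c j).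
have cF : F t' @[t' --> t] --> (0 : R).
  have -> : (0 : R) = \sum_(j < m) `|t ^+ j - t ^+ j| * nrm V (c j).
    by rewrite big1// => j _; rewrite subrr normr0 mul0r.
  rewrite /F; elim: (index_enum _) => [|j r IH].
    by under eq_fun do rewrite big_nil; rewrite big_nil; exact: cvg_cst.
  under eq_fun do rewrite big_cons; rewrite big_cons; apply: cvgD => //.
  apply: cvgM; last exact: cvg_cst.
  apply: cvg_norm; apply: cvgB; last exact: cvg_cst.
  exact: exprn_continuous.
have /nbhs_ballP[delta /= d0 hd] : \forall t' \near t, F t' < eps.
  by apply: cvgr_lt cF _ e0.
exists delta => // t' tt'; apply: le_lt_trans (hd t' _); last by rewrite /ball/= distrC.
rewrite -sumrB; under eq_bigr do rewrite -scalerBl.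
apply: (le_trans (nrm_sum sV _ _)) => [j _|]; first exact: carrierZ.
by apply: ler_sum => j _; rewrite (nrmZ sV).
Qed.

End vector_polynomials.

Section piecewise_polynomials.
Variables (R : realType) (T : R) (M : nat) (tp : nat -> R).
Hypotheses (T0 : 0 < T) (tp0 : tp 0%N = 0) (tpM : tp M = T)
  (tpS : forall k, (k < M)%N -> tp k < tp k.+1).
Variables (L : lmodType R) (W : seminormed L).
Hypothesis sW : is_seminorm W.

Lemma piecewise_polynomial_carrier m (U : R -> L) :
  (forall k, (k < M)%N -> exists2 c : 'I_m -> L, (forall j, carrier W (c j)) &
     forall t, t \in `[tp k, tp k.+1] -> U t = \sum_(j < m) t ^+ j *: c j) ->
  forall t, t \in `[0, T] -> carrier W (U t).
Proof.
move=> hU t; rewrite in_itv/= => /andP[t0 tT].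
have [k kM htk] := grid_cover_closed T0 tp0 tpM tpS t0 tT.
have [c hc Uc] := hU k kM.
by rewrite Uc ?in_itv//; exact: polynomial_carrier.
Qed.

Lemma piecewise_polynomial_continuous m (U : R -> L) :
  (forall k, (k < M)%N -> exists2 c : 'I_m -> L, (forall j, carrier W (c j)) &
     forall t, t \in `[tp k, tp k.+1] -> U t = \sum_(j < m) t ^+ j *: c j) ->
  forall t, t \in `[0, T] -> forall eps : R, 0 < eps ->
    exists2 delta : R, 0 < delta & forall t', t' \in `[0, T] ->
      `|t' - t| < delta -> nrm W (U t' - U t) < eps.
Proof.
move=> hU t tT eps e0.
have one k : (k < M)%N -> exists2 delta : R, 0 < delta &
    forall t', tp k <= t' <= tp k.+1 -> `|t' - t| < delta -> nrm W (U t' - U t) < eps.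
  move=> kM; have [c hc Uc] := hU k kM.
  have [kt|tk] := leP (tp k) t; last first.
    exists (tp k - t) => [|t' /andP[h1 h2]]; first by rewrite subr_gt0.
    by move=> /(le_lt_trans (ler_norm _)); rewrite ltrD2r ltNge h1.
  have [tk|kt'] := leP t (tp k.+1); last first.
    exists (t - tp k.+1) => [|t' /andP[h1 h2]]; first by rewrite subr_gt0.
    by rewrite distrC => /(le_lt_trans (ler_norm _)); rewrite ltrD2l ltrN2 ltNge h2.
  have [delta d0 hd] := polynomial_continuous sW t hc e0.
  exists delta => // t' ht' h; rewrite !Uc ?in_itv//=; first exact: hd.
  by rewrite kt tk.
have all m' : (m' <= M)%N -> exists2 delta : R, 0 < delta & forall k, (k < m')%N ->
    forall t', tp k <= t' <= tp k.+1 -> `|t' - t| < delta -> nrm W (U t' - U t) < eps.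
  elim: m' => [|m' IH] mM; first by exists 1.
  have [d d0 hd] := IH (ltnW mM); have [d' d'0 hd'] := one m' mM.
  exists (Num.min d d') => [|k]; first by rewrite lt_min d0.
  rewrite ltnS leq_eqVlt => /predU1P[->|km] t' ht'; rewrite lt_min => /andP[h1 h2].
    exact: hd'.
  exact: hd km _ ht' h1.
have [d d0 hd] := all M (leqnn M); exists d => // t'; rewrite in_itv/= => /andP[h0 hT] htt.
have [k kM htk] := grid_cover_closed T0 tp0 tpM tpS h0 hT.
exact: hd kM _ htk htt.
Qed.

End piecewise_polynomials.

(** * The estimate at one time *)

Section pointwise_estimate.
Variables (R : realType) (P : problem R) (C alpha : R).
Hypotheses (wp : well_posed P) (alpha0 : 0 < alpha) (aC : a_continuous P C)
  (aA : a_coercive P alpha).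
Local Notation fn := ('rV[R]_(sdim P) -> R^o).
Local Notation H := (Hspace P).
Let sH := Hspace_seminorm wp.
Let sdH := dual_seminorm sH.

(** The constants of the estimate. Since the dual norm of the error is bounded by
    the dual residual plus |C| times the norm n of u - uh, and n by the sum of
    the norms e of u - U and b of uh - U, the sum of the three squares is at
    most weight_error e^2 + 2 a^2 + (weight_error - 1) b^2, where a is the norm
    of the residual. The pairing controls alpha / 2 times e^2. *)
Definition weight_error : R := 4 * C ^+ 2 + 3.
Definition weight_pairing : R := 2 * weight_error / alpha + 2.
Definition weight_residual : R :=
  2 + weight_error + weight_pairing * (1 + C ^+ 2) / alpha.

Lemma weight_error_ge3 : 3 <= weight_error.
Proof. by rewrite /weight_error lerDr mulr_ge0 ?sqr_ge0. Qed.

Lemma weight_pairing_ge2 : 2 <= weight_pairing.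
Proof.
rewrite /weight_pairing lerDr divr_ge0 ?(ltW alpha0)// mulr_ge0//.
exact: le_trans weight_error_ge3.
Qed.

Lemma weight_residual_gt0 : 0 < weight_residual.
Proof.
rewrite /weight_residual; have h3 := weight_error_ge3; have h2 := weight_pairing_ge2.
apply: (@lt_le_trans _ _ (2 + weight_error)); first by rewrite addr_gt0// (lt_le_trans _ h3).
rewrite lerDl; apply: divr_ge0; last exact: ltW.
by apply: mulr_ge0; [exact: le_trans h2|rewrite addr_ge0// sqr_ge0].
Qed.

Let weighted_sum (A a b e n s : R) : 0 <= A -> 0 <= a -> 0 <= n -> 0 <= e -> 0 <= b ->
  A <= a + `|C| * n -> n <= e + b ->
  alpha * e ^+ 2 - `|C| * b * e - a * e <= s ->
  A ^+ 2 + e ^+ 2 + n ^+ 2 <= weight_pairing * s + weight_residual * (a ^+ 2 + b ^+ 2).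
Proof.
move=> A0 a0 n0 e0 b0 hA hn hs.
have C0 : 0 <= `|C| by [].
have CE : C ^+ 2 = `|C| ^+ 2 by rewrite real_normK// num_real.
have q0 := ltW alpha0.
rewrite /weight_residual /weight_pairing /weight_error CE; move: (`|C|) C0 hA hs => g g0 hA hs.
have A2 : A ^+ 2 <= 2 * a ^+ 2 + 2 * g ^+ 2 * n ^+ 2.
  apply: (@le_trans _ _ ((a + g * n) ^+ 2)).
    by rewrite ler_sqr ?nnegrE ?addr_ge0 ?mulr_ge0.
  have := sqr_ge0 (a - g * n); rewrite !expr2; lra.
have n2 : n ^+ 2 <= 2 * e ^+ 2 + 2 * b ^+ 2.
  apply: (@le_trans _ _ ((e + b) ^+ 2)); first by rewrite ler_sqr ?nnegrE ?addr_ge0.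
  have := sqr_ge0 (e - b); rewrite !expr2; lra.
have s2 : alpha / 2 * e ^+ 2 - (a ^+ 2 + g ^+ 2 * b ^+ 2) / alpha <= s.
  apply: le_trans hs; rewrite -subr_ge0.
  have -> : alpha * e ^+ 2 - g * b * e - a * e - (alpha / 2 * e ^+ 2 - (a ^+ 2 + g ^+ 2 * b ^+ 2) / alpha)
      = ((alpha * e / 2 - a) ^+ 2 + (alpha * e / 2 - g * b) ^+ 2) / alpha.
    by field; rewrite gt_eqF.
  by rewrite divr_ge0// addr_ge0 ?sqr_ge0.
pose w := 4 * g ^+ 2 + 3; pose K := 2 * w / alpha + 2.
have w3 : 3 <= w by rewrite /w lerDr mulr_ge0 ?sqr_ge0.
have K0 : 0 <= K by rewrite addr_ge0// divr_ge0// mulr_ge0// (le_trans _ w3).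
set r := (a ^+ 2 + g ^+ 2 * b ^+ 2) / alpha in s2 *.
have h1 : K * (alpha / 2 * e ^+ 2) - K * r <= K * s by rewrite -mulrBr ler_wpM2l.
have h2 : K * (alpha / 2 * e ^+ 2) = w * e ^+ 2 + alpha * e ^+ 2.
  by rewrite /K; field; rewrite gt_eqF.
have h3 : K * r <= K * (1 + g ^+ 2) / alpha * (a ^+ 2 + b ^+ 2).
  rewrite -!mulrA ler_wpM2l// mulrCA /r mulrC ler_wpM2l ?invr_ge0//.
  have := mulr_ge0 (sqr_ge0 g) (sqr_ge0 a); have := sqr_ge0 b; lra.
have h4 : g ^+ 2 * n ^+ 2 <= g ^+ 2 * (2 * e ^+ 2 + 2 * b ^+ 2).
  by rewrite ler_wpM2l ?sqr_ge0.
have h5 : 0 <= alpha * e ^+ 2 by rewrite mulr_ge0 ?sqr_ge0.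
have h6 := mulr_ge0 (sqr_ge0 g) (sqr_ge0 a).
rewrite -/w -/K; move: (K * (1 + g ^+ 2) / alpha) h3 => X h3.
rewrite h2 in h1; move: (K * r) (K * s) h1 h3 => Kr Ks.
move: (alpha * e ^+ 2) h5 => ae h5; rewrite /w.
have := sqr_ge0 b; have := sqr_ge0 a.
move: (a ^+ 2) (b ^+ 2) (e ^+ 2) (n ^+ 2) (A ^+ 2) (g ^+ 2) A2 n2 h4 h6 h5.
move=> a2 b2 e2 n2 A2 g2; lra.
Qed.

(** The quantity to be bounded, up to squares of known residuals, is the
    difference between the multiplier pairing and the derivative of half the
    squared L2 error: coercivity in the error equation tested with the error
    itself controls the error in H, and the error equation then controls the
    dual norm. *)
Lemma pointwise_estimate (u U uh : fn) (du dU f m mh : fn -> R^o) :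
  carrier H u -> carrier H U -> carrier H uh ->
  carrier (dual_space H) du -> carrier (dual_space H) dU -> carrier (dual_space H) f ->
  carrier (dual_space H) m -> carrier (dual_space H) mh ->
  (forall v, carrier H v -> du v + aform P u v + m v = f v) ->
  nrm (dual_space H) (du - dU + (m - mh)) ^+ 2 + nrm H (u - U) ^+ 2 + nrm H (u - uh) ^+ 2 <=
  weight_pairing * ((mh (u - U) - m (u - U)) - (du - dU) (u - U)) +
  weight_residual * (nrm (dual_space H) (f - dU - (fun v => aform P uh v) - mh) ^+ 2 +
    nrm H (uh - U) ^+ 2).
Proof.
move=> hu hU huh hdu hdU hf hm hmh eqn.
set l1 : fn -> R^o := du - dU + (m - mh); set l2 : fn -> R^o := f - dU - _ - mh.
have hauh := aform_dual wp alpha0 aC aA huh.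
have hl2 : carrier (dual_space H) l2 :=
  carrierB sdH (carrierB sdH (carrierB sdH hf hdU) hauh) hmh.
have hl1 : carrier (dual_space H) l1 :=
  carrierD sdH (carrierB sdH hdu hdU) (carrierB sdH hm hmh).
have he := carrierB sH hu hU; have huuh := carrierB sH hu huh.
have hb := carrierB sH huh hU.
have aB x y v : carrier H x -> carrier H y -> carrier H v ->
    aform P (x - y) v = aform P x v - aform P y v.
  move=> hx hy hv; rewrite [x - y]addrC -scaleN1r (aform_lin wp alpha0 aA)//.
  by rewrite mulN1r addrC.
have key v : carrier H v -> l1 v = l2 v - aform P (u - uh) v :> R.
  move=> hv; rewrite aB// -[l1 v]/(du v - dU v + (m v - mh v)).
  rewrite -[l2 v]/(f v - dU v - aform P uh v - mh v) -(eqn v hv).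
  by move: (du v : R) (dU v : R) (m v : R) (mh v : R) (aform P u v) (aform P uh v) => *; lra.
have n0 := nrm_ge0 sH huuh; have e0 := nrm_ge0 sH he; have b0 := nrm_ge0 sH hb.
have a0 := nrm_ge0 sdH hl2.
apply: (weighted_sum (nrm_ge0 sdH hl1) a0 n0 e0 b0).
- apply: (dual_nrm_le sH); first by rewrite addr_ge0// mulr_ge0.
  move=> v hv; rewrite key//; apply: (le_trans (ler_normB _ _)); rewrite mulrDl.
  exact: (lerD (dual_le sH hl2 hv) (aform_bound wp alpha0 aC aA huuh hv)).
- by rewrite (nrm_distC sH huh hU); exact: (nrm_triangle sH hu huh hU).
- have h := key _ he; rewrite -[l1 _]/(du (u - U) - dU (u - U) + (m (u - U) - mh (u - U))) in h.
  have -> : (du - dU) (u - U) = du (u - U) - dU (u - U) :> R by [].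
  have h1 := aA he.
  have h2 : aform P (u - uh) (u - U) = aform P (u - U) (u - U) - aform P (uh - U) (u - U).
    rewrite (aB _ _ _ hu huh he) (aB _ _ _ hu hU he) (aB _ _ _ huh hU he).
    by rewrite opprB addrA subrK.
  have h3 := ler_normlW (aform_bound wp alpha0 aC aA hb he).
  have h4 := ler_normlW (dual_le sH hl2 he).
  rewrite h2 in h; move: h h1 h3 h4.
  move: (du (u - U) : R) (dU (u - U) : R) (m (u - U) : R) (mh (u - U) : R) (l2 (u - U) : R).
  move: (aform P (u - U) (u - U)) (aform P (uh - U) (u - U)) => *; lra.
Qed.

End pointwise_estimate.

(** * The a posteriori estimate *)

Section discrete_functions.
Variables (R : realType) (P : problem R) (D : discretization P) (q : nat) (kappa : R).
Hypotheses (wp : well_posed P) (adm : admissible D kappa).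
Local Notation leb := (@lebesgue_measure R).
Local Notation fn := ('rV[R]_(sdim P) -> R^o).
Local Notation H := (Hspace P).
Local Notation T := (final_time P).
Let sH := Hspace_seminorm wp.

(** On each slab U takes values in H at almost all times, hence at enough times
    for its coefficients to belong to H; so U takes values in H at all
    times, continuously. *)
Lemma interpolant_coefs (X : set (measurableTypeR R)) (U uh : R -> fn) (uh0 : fn) :
  measurable X -> X `<=` `]0, T[ -> leb (`]0, T[ `\` X) = 0%E ->
  (forall t, X t -> carrier H (U t)) -> interpolant D q uh0 uh U ->
  forall k, (k < nsteps D)%N -> exists2 c : 'I_q.+2 -> fn, (forall j, carrier H (c j)) &
    forall t, t \in `[tpoint D k, tpoint D k.+1] -> U t = \sum_(j < q.+2) t ^+ j *: c j.
Proof.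
move=> mX XT X0 hU hint k kM; have [[tp0 tpM tpS] _ _ _] := adm.
have [[c Uc] _ _] := hint k kM; exists c => //.
have [k0 kT] := grid_itv tp0 tpM tpS kM.
have [s si hs] := conull_distinct mX X0 q.+2 k0 (tpS _ kM) kT.
apply: (polynomial_coef_carrier sH si) => i; have [Xi /andP[h1 h2]] := hs i.
by rewrite -Uc; [exact: hU|rewrite in_itv/= !ltW].
Qed.

Lemma Wh_carrier (uh : R -> fn) : Wh D q uh -> forall k, (k < nsteps D)%N ->
  forall t, tslab D k t -> carrier H (uh t).
Proof.
move=> hW k kM t tk; have [c hc uc] := hW k kM.
by rewrite (uc _ tk); apply: (polynomial_carrier sH) => j; case: (hc j).
Qed.

Lemma discrete_multiplier_expansion (lamh : R -> fn) : tensor_time D q (Mh D) lamh ->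
  forall k, (k < nsteps D)%N ->
  (forall t, tslab D k t -> carrier (dual_space H) (bform P (emb (lamh t)))) /\
  exists2 l : 'I_q.+1 -> fn -> R^o, (forall j, carrier (dual_space H) (l j)) &
    forall t v, tslab D k t -> carrier H v ->
      bform P (emb (lamh t)) v = \sum_(j < q.+1) t ^+ j * l j v.
Proof.
move=> hl k kM; have [c hc lc] := hl k kM.
have bc j : bounded_measurable (c j) by apply: (Mh_bounded adm).
split.
  move=> t tk; apply: (bform_dual wp); apply: (emb_dual wp).
  rewrite (lc _ tk); elim: (index_enum _) => [|j r IH].
    by rewrite big_nil; exact: bounded_measurable0.
  by rewrite big_cons; exact: bounded_measurable_lin.
exists (fun j => bform P (emb (c j))); first by move=> j; apply: (bform_dual wp); exact: (emb_dual wp).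
move=> t v tk hv; rewrite (lc _ tk) /bform.
apply: (@bounded_measurable_sum _ _ (fun g => emb g (trace_of P v))) => // a u' v' hu hv'.
exact: (emb_linl wp _ (trace_Yspace wp hv)).
Qed.

End discrete_functions.

Lemma ae_time_and (R : realType) (P : problem R) (Q1 Q2 : R -> Prop) :
  ae_time P Q1 -> ae_time P Q2 -> ae_time P (fun t => Q1 t /\ Q2 t).
Proof.
rewrite /ae_time; apply: filterS2; first exact: (ae_filter_ringOfSetsType (@lebesgue_measure R)).
by move=> t h1 h2 tT; split; [exact: h1|exact: h2].
Qed.

Lemma absorb_final_error (R : realType) (k s x y z : R) : k / 2 * z <= x -> 2 * y <= k * y ->
  y + k * (s - (y - z) / 2) <= x + k * s.
Proof. lra. Qed.

(* The second term on the right has no sign; it carries its own constant. *)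
Theorem theorem6p18 (R : realType) (P : problem R) (q : nat)
    (kappa C alpha : R) :
  well_posed P -> (q <= 1)%N ->
  0 < alpha -> a_continuous P C -> a_coercive P alpha ->
  exists C1 C2 : R, [/\ 0 < C1, 0 < C2 &
    forall (D : discretization P)
      (S : set 'rV[R]_(sdim P)) (F w : 'rV[R]_(sdim P) -> R^o)
      (f : R -> ('rV[R]_(sdim P) -> R^o) -> R^o)
      (u0 uh0 : 'rV[R]_(sdim P) -> R^o)
      (u : R -> 'rV[R]_(sdim P) -> R^o)
      (du lam : R -> ('rV[R]_(sdim P) -> R^o) -> R^o)
      (uh lamh U : R -> 'rV[R]_(sdim P) -> R^o)
      (dU : R -> ('rV[R]_(sdim P) -> R^o) -> R^o),
    admissible D kappa ->
    contact_data P S F w ->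
    bochner_L2 (final_time P) (dual_space (Hspace P)) f ->
    carrier (L2Omega P) u0 ->
    uh0 = u0 \/ Vh D uh0 ->
    continuous_solution P S F w f u0 u du lam ->
    discrete_solution D q S F w f uh0 uh lamh ->
    interpolant D q uh0 uh U -> Wspace_with P U dU ->
    let rh t : ('rV[R]_(sdim P) -> R^o) -> R^o :=
      f t - dU t - (fun v => aform P (uh t) v) in
    let mult t : ('rV[R]_(sdim P) -> R^o) -> R^o :=
      fun v => bform P (lam t) v in
    let multh t : ('rV[R]_(sdim P) -> R^o) -> R^o :=
      fun v => bform P (emb (lamh t)) v in
    ((nrm (L2Omega P) (u (final_time P) - U (final_time P)) ^+ 2)%:E
     + \sum_(k < nsteps D) \int[@lebesgue_measure R]_(t in tslab D k)
         (nrm (dual_space (Hspace P)) (du t - dU t + (mult t - multh t)) ^+ 2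
          + nrm (Hspace P) (u t - U t) ^+ 2
          + nrm (Hspace P) (u t - uh t) ^+ 2)%:E
     <= C1%:E * (nrm (L2Omega P) (u 0%R - U 0%R) ^+ 2)%:E
        + C2%:E * (\sum_(k < nsteps D)
            \int[@lebesgue_measure R]_(t in tslab D k)
            (bform P (emb (lamh t) - lam t) (u t - U t))%:E)
        + C1%:E * (\sum_(k < nsteps D)
            \int[@lebesgue_measure R]_(t in tslab D k)
            (nrm (dual_space (Hspace P)) (rh t - multh t) ^+ 2
             + nrm (Hspace P) (uh t - U t) ^+ 2)%:E))%E].
Proof.
move=> wp _ alpha0 aC aA.
pose K := weight_pairing C alpha; pose c := weight_residual C alpha.
have K2 : 2 <= K := weight_pairing_ge2 C alpha0.
have K0 : 0 < K by exact: lt_le_trans K2.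
have c0 : 0 < c := weight_residual_gt0 C alpha0.
exists (Num.max (K / 2) c), K; split => //; first by rewrite lt_max c0 orbT.
move=> D S F w f u0 uh0 u du lam uh lamh U dU adm _ bf _ _ cs ds hint WU.
have sH := Hspace_seminorm wp; have sdH := dual_seminorm sH.
have sY := Yspace_seminorm wp; have sdY := dual_seminorm sY.
have sW := L2Omega_seminorm wp.
have T0 := final_time_gt0 wp.
set T := final_time P in T0 *; set leb := @lebesgue_measure R.
have [[[bu bdu wu] [uW uC]] [blam _] _ eqn _] := cs.
have [bU bdU wU] := WU.
have [hWh [hlamh _] _ _] := ds.
have [[tp0 tpM tpS] _ _ _] := adm.
have mT : measurable (`]0, T[%classic : set (measurableTypeR R)) by exact: measurable_itv.
have [Q1 [aQ1 bQ1]] := bochner_L2_conull sH bu.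
have [Q2 [aQ2 bQ2]] := bochner_L2_conull sdH bdu.
have [Q3 [aQ3 bQ3]] := bochner_L2_conull sdY blam.
have [Q4 [aQ4 bQ4]] := bochner_L2_conull sdH bf.
have [Q5 [aQ5 bQ5]] := bochner_L2_conull sH bU.
have [Q6 [aQ6 bQ6]] := bochner_L2_conull sdH bdU.
(* a set of times of full measure on which all functions are Bochner measurable *)
have [X [mX XT X0 XQ]] := ae_conull mT (ae_time_and aQ1 (ae_time_and aQ2 (ae_time_and aQ3
  (ae_time_and aQ4 (ae_time_and aQ5 aQ6))))).
have {bQ1} xu := bQ1 X mX XT (fun t h => (XQ t h).1).
have {bQ2} xdu := bQ2 X mX XT (fun t h => (XQ t h).2.1).
have {bQ3} xlam := bQ3 X mX XT (fun t h => (XQ t h).2.2.1).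
have {bQ4} xf := bQ4 X mX XT (fun t h => (XQ t h).2.2.2.1).
have {bQ5} xU := bQ5 X mX XT (fun t h => (XQ t h).2.2.2.2.1).
have {bQ6} xdU := bQ6 X mX XT (fun t h => (XQ t h).2.2.2.2.2).
(* on a smaller one the equation holds against all vectors *)
have [Y [mY YX Y0 eqY]] := equation_ae wp alpha0 aC aA mX XT X0 xu xdu xlam xf eqn.
have YT : Y `<=` `]0, T[ by move=> t /YX; exact: XT.
have yu := bochner_sq_integrable_sub mX mY YX xu.
have ydu := bochner_sq_integrable_sub mX mY YX xdu.
have ylam := bochner_sq_integrable_sub mX mY YX xlam.
have yf := bochner_sq_integrable_sub mX mY YX xf.
have yU := bochner_sq_integrable_sub mX mY YX xU.
have ydU := bochner_sq_integrable_sub mX mY YX xdU.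
have ymult := bform_sq_integrable wp mY ylam.
have ye : bochner_sq_integrable leb Y (Hspace P) (fun t => u t - U t).
  have -> : (fun t => u t - U t) = (fun t => (-1) *: U t + u t).
    by apply/funext => t; rewrite scaleN1r addrC.
  exact: (bochner_sq_integrable_lin mY sH (-1) yU yu).
have yde : bochner_sq_integrable leb Y (dual_space (Hspace P)) (fun t => du t - dU t).
  have -> : (fun t => du t - dU t) = (fun t => (-1) *: dU t + du t).
    by apply/funext => t; rewrite scaleN1r addrC.
  exact: (bochner_sq_integrable_lin mY sdH (-1) ydU ydu).
have coefU := interpolant_coefs wp adm mY YT Y0 yU.1.1 hint.
have coefUW k : (k < nsteps D)%N -> exists2 c' : 'I_q.+2 -> ('rV[R]_(sdim P) -> R^o),
    (forall j, carrier (L2Omega P) (c' j)) &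
    forall t, t \in `[tpoint D k, tpoint D k.+1] -> U t = \sum_(j < q.+2) t ^+ j *: c' j.
  by move=> /coefU[c' hc' hU']; exists c' => // j; exact/Hspace_L2/hc'.
have UW := piecewise_polynomial_carrier T0 tp0 tpM tpS sW coefUW.
have UC := piecewise_polynomial_continuous T0 tp0 tpM tpS sW coefUW.
pose p t : R := (du t - dU t) (u t - U t).
have ip : leb.-integrable Y (EFin \o p) := integrable_pairing mY sH yde ye.
have eW t : t \in `[0, T] -> carrier (L2Omega P) (u t - U t).
  by move=> tT; exact: (carrierB sW (uW t tT) (UW t tT)).
have eC t : t \in `[0, T] -> forall eps : R, 0 < eps ->
    exists2 delta : R, 0 < delta & forall t', t' \in `[0, T] ->
      `|t' - t| < delta -> nrm (L2Omega P) (u t' - U t' - (u t - U t)) < eps.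
  move=> tT eps e0; have e2 : 0 < eps / 2 by rewrite divr_gt0.
  have [d1 d10 h1] := uC t tT _ e2; have [d2 d20 h2] := UC t tT _ e2.
  exists (Num.min d1 d2) => [|t' t'T]; first by rewrite lt_min d10.
  rewrite lt_min => /andP[l1 l2].
  have -> : u t' - U t' - (u t - U t) = (u t' - u t) - (U t' - U t).
    by rewrite !opprD !opprK !addrA (addrAC (u t')).
  apply: (le_lt_trans (nrmB sW (carrierB sW (uW _ t'T) (uW _ tT)) (carrierB sW (UW _ t'T) (UW _ tT)))).
  by rewrite [ltRHS]splitr; exact: (ltrD (h1 _ t'T l1) (h2 _ t'T l2)).
have energy : \int[leb]_(t in Y) p t =
    (nrm (L2Omega P) (u T - U T) ^+ 2 - nrm (L2Omega P) (u 0 - U 0) ^+ 2) / 2.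
  exact: (energy_identity T0 mY YT Y0 sH sW (dotL2_inner_product wp) (@Hspace_L2 _ _) ye yde
    (weak_derivativeB wp mY YT Y0 yu ydu yU ydU wu wU) eW eC).
(* G, beta and rho are the integrands of the left-hand side, of the multiplier
   term and of the residual; p is the derivative of half the squared error *)
pose G t : R := nrm (dual_space (Hspace P)) (du t - dU t + (bform P (lam t) - bform P (emb (lamh t)))) ^+ 2
  + nrm (Hspace P) (u t - U t) ^+ 2 + nrm (Hspace P) (u t - uh t) ^+ 2.
pose beta t : R := bform P (emb (lamh t)) (u t - U t) - bform P (lam t) (u t - U t).
pose rho t : R := nrm (dual_space (Hspace P)) (f t - dU t - (fun v => aform P (uh t) v) -
    bform P (emb (lamh t))) ^+ 2 + nrm (Hspace P) (uh t - U t) ^+ 2.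
pose Yk k : set (measurableTypeR R) := Y `&` tslab D k.
have mYk k : measurable (Yk k) by exact: (measurable_slab _ mY).
have YkY k : Yk k `<=` Y by move=> t [].
have ptw k t : (k < nsteps D)%N -> Yk k t -> G t <= K * (beta t - p t) + c * rho t.
  move=> kM [Yt tk].
  exact: (pointwise_estimate wp alpha0 aC aA (yu.1.1 _ Yt) (yU.1.1 _ Yt)
    (Wh_carrier wp hWh kM tk) (ydu.1.1 _ Yt) (ydU.1.1 _ Yt) (yf.1.1 _ Yt) (ymult.1.1 _ Yt)
    ((discrete_multiplier_expansion wp adm hlamh kM).1 t tk) (eqY t Yt)).
(* the discrete multiplier is a polynomial in time with values in the dual *)
have ibeta k : (k < nsteps D)%N -> leb.-integrable (Yk k) (EFin \o beta).
  move=> kM; have [_ [l hl lE]] := discrete_multiplier_expansion wp adm hlamh kM.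
  have yek := bochner_sq_integrable_sub mY (mYk k) (@YkY k) ye.
  have ymk := bochner_sq_integrable_sub mY (mYk k) (@YkY k) ymult.
  have im := integrable_pairing (mYk k) sH ymk yek.
  have fk : (leb (Yk k) < +oo)%E.
    by apply: (conull_finite_measure (T := T) (mYk k)) => t /YkY/YT.
  have il (j : 'I_q.+1) : leb.-integrable (Yk k) (EFin \o (fun t => t ^+ j * l j (u t - U t) : R)).
    have hj t : Yk k t -> `|t ^+ j| <= T ^+ j.
      move=> /YkY/YT; rewrite /= in_itv/= => /andP[t0 tT].
      have t0' := ltW t0; rewrite (ger0_norm (exprn_ge0 _ t0')).
      by rewrite lerXn2r ?nnegrE ?(ltW tT) ?(ltW T0).
    have mj : measurable_fun (Yk k) (fun t : R => t ^+ j).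
      by apply: measurable_funTS; apply: continuous_measurable_fun => x; exact: exprn_continuous.
    exact: (integrable_pairing (mYk k) sH
      (bochner_sq_integrable_scale (mYk k) fk sdH mj hj (hl j)) yek).
  apply: (eq_Rintegrable (mYk k) _ (RintegrableB (mYk k) (Rintegrable_sum (mYk k) _ il) im)) => t Ykt.
  by rewrite /beta lE//; [case: Ykt|exact: yek.1.1].
have toY k (h : R -> \bar R) : (k < nsteps D)%N ->
    (\int[leb]_(t in tslab D k) h t = \int[leb]_(t in Yk k) h t)%E.
  move=> kM; apply: integral_conull => //; first exact: measurable_itv.
    by move=> t [].
  exact: (slab_conull tp0 tpM tpS mY Y0 kM).
have ipk k : leb.-integrable (Yk k) (EFin \o p).
  exact: (integrableS mY (mYk k) (@YkY k) ip).
have slabG k : (k < nsteps D)%N ->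
    (\int[leb]_(t in tslab D k) (G t)%:E <=
     (K * (\int[leb]_(t in Yk k) beta t - \int[leb]_(t in Yk k) p t))%:E +
     c%:E * \int[leb]_(t in tslab D k) (rho t)%:E)%E.
  move=> kM; rewrite !toY//.
  have ib := RintegrableB (mYk k) (ibeta k kM) (ipk k).
  have -> : K * (\int[leb]_(t in Yk k) beta t - \int[leb]_(t in Yk k) p t) =
      \int[leb]_(t in Yk k) (K * (beta t - p t)).
    by rewrite RintegralZl// RintegralB//; exact: ibeta.
  apply: (le_integral_dominated (mYk k) c0).
  - by move=> t _; rewrite !addr_ge0 ?sqr_ge0.
  - by move=> t _; rewrite addr_ge0 ?sqr_ge0.
  - exact: RintegrableZ.
  - by move=> t Ykt; exact: ptw Ykt.
pose C1 := Num.max (K / 2) c.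
pose nT := nrm (L2Omega P) (u T - U T) ^+ 2; pose n0 := nrm (L2Omega P) (u 0 - U 0) ^+ 2.
pose SB := \sum_(k < nsteps D) \int[leb]_(t in Yk k) beta t.
pose SR : \bar R := (\sum_(k < nsteps D) \int[leb]_(t in tslab D k) (rho t)%:E)%E.
have SBE : (\sum_(k < nsteps D) \int[leb]_(t in tslab D k) (beta t)%:E)%E = SB%:E.
  rewrite /SB -sumEFin; apply: eq_bigr => k _.
  by rewrite toY// (Rintegral_EFin (mYk k) (ibeta k (ltn_ord k))).
have SPE : \sum_(k < nsteps D) \int[leb]_(t in Yk k) p t = (nT - n0) / 2.
  by rewrite -energy (Rintegral_slabs tp0 tpM tpS mY YT ip).
have SR0 : (0 <= SR)%E.
  by apply: sume_ge0 => k _; apply: integral_ge0 => t _; rewrite lee_fin addr_ge0 ?sqr_ge0.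
have sumG : (\sum_(k < nsteps D) \int[leb]_(t in tslab D k) (G t)%:E <=
    (K * (SB - (nT - n0) / 2))%:E + c%:E * SR)%E.
  apply: (@le_trans _ _ (\sum_(k < nsteps D) ((K * (\int[leb]_(t in Yk k) beta t -
      \int[leb]_(t in Yk k) p t))%:E + c%:E * \int[leb]_(t in tslab D k) (rho t)%:E))%E).
    by apply: lee_sum => k _; exact: (slabG k (ltn_ord k)).
  rewrite big_split/= sumEFin -mulr_sumr sumrB SPE.
  rewrite -ge0_sume_distrr// => k _; apply: integral_ge0 => t _.
  by rewrite lee_fin addr_ge0 ?sqr_ge0.
(* K / 2 >= 1 times the final error appears with a negative sign, and absorbs
   the final error *)
have fin : (nT%:E + \sum_(k < nsteps D) \int[leb]_(t in tslab D k) (G t)%:E <=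
    C1%:E * n0%:E + K%:E * (\sum_(k < nsteps D) \int[leb]_(t in tslab D k) (beta t)%:E) +
    C1%:E * SR)%E.
  rewrite SBE; apply: (le_trans (leeD2l _ sumG)); rewrite addeA; apply: leeD.
    rewrite -!EFinM -!EFinD lee_fin.
    have h1 : K / 2 * n0 <= C1 * n0 by rewrite ler_wpM2r ?sqr_ge0// le_max lexx.
    have h2 : 2 * nT <= K * nT by rewrite ler_wpM2r ?sqr_ge0.
    exact: absorb_final_error.
  by rewrite lee_wpmul2r// lee_fin le_max lexx orbT.
exact: fin.
Qed.
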